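(* Let $\ell, T>0$ and $0<\alpha<1$. Let $p, q \in C^1[0,\ell]$ and $a\in C^2[0,\ell]$, and assume that $|a(x)|\neq 0$ for all $0\le x\le \ell$. Let $u, \widetilde{u} \in W^{1,1}(0,T;L^2(0,\ell)) \cap L^2(0,T;H^2(0,\ell))$ satisfy $u(x,0) = \widetilde{u}(x,0) = a(x)$ for $0<x<\ell$ and $$ d_t^{\alpha} u (x,t)= \partial_x^2u(x,t) - p(x)u(x,t), \quad d_t^{\alpha} \widetilde{u}(x,t) = \partial_x^2\widetilde{u}(x,t) - q(x)\widetilde{u}(x,t) \quad \text{in } (0,\ell) \times (0,T). $$ Assume that there exists $\varepsilon_0\in (0,\ell)$ such that $p(x)=q(x)$ for $0\le x\le \varepsilon_0$. If $u(0,t) = \widetilde{u}(0,t)$ and $\partial_x u(0,t) = \partial_x \widetilde{u}(0,t)$ for $0<t<T$, then $p(x) = q(x)$ for all $0\le x\le \ell$.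
   Context: For $0<\alpha<1$ the Caputo derivative is $d_t^{\alpha} v(t) = \frac{1}{\Gamma(1-\alpha)}\int^t_0 (t-s)^{-\alpha} \frac{dv}{ds}(s)\, ds$ for $v \in W^{1,1}(0,T)$, where $\Gamma$ is the gamma function; it is applied in the same way in the time variable to functions in $W^{1,1}(0,T;L^2(0,\ell))$. $L^2(0,\ell)$, $H^2(0,\ell)$, $W^{1,1}(0,T;L^2(0,\ell))$, $L^2(0,T;H^2(0,\ell))$ are the usual Lebesgue, Sobolev and Bochner spaces. The equations and boundary identities are understood in the sense natural for this regularity: almost everywhere in $(0,\ell)\times(0,T)$ for the equations, and for almost every $t$ for the boundary traces at $x=0$. No boundary condition is imposed at $x=\ell$. *)

(* Defs.v *)
From HB Require Import structures.
From mathcomp Require Import all_boot all_order all_algebra.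
From mathcomp Require Import all_classical all_reals all_analysis.

Set Implicit Arguments.
Unset Strict Implicit.
Unset Printing Implicit Defensive.
Import Order.TTheory GRing.Theory Num.Theory.
Import numFieldNormedType.Exports.

Local Open Scope classical_set_scope.
Local Open Scope ring_scope.

Section Defs.
Context {R : realType}.
Implicit Types (l T alpha b : R) (k : nat) (f g phi : R -> R) (u v : R * R -> R).

Local Notation leb := (@lebesgue_measure R).

(* f belongs to C^k[0,l]; the derivatives are taken in ]0,l[ and extend
   continuously to [0,l]. *)
Fixpoint Ck_itv k l f : Prop :=
  {within `[0, l], continuous f} /\
  match k with
  | 0 => True
  | j.+1 => exists g,
      (forall x, x \in `]0, l[ -> is_derive x (1 : R) f (g x)) /\ Ck_itv j l g
  end.

Definition Gamma (z : R) : R :=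
  (\int[leb]_(x in `]0%R, +oo[) (x `^ (z - 1) * expR (- x)))%R.

(* phi belongs to C_c^oo(0,b). *)
Definition test_function b phi : Prop :=
  (forall k x, derivable (derive1n k phi) x 1) /\
  exists c d, [/\ 0 < c, d < b & forall x, phi x != 0 -> c <= x <= d].

Definition L2 l f : Prop := (f \_ `]0, l[) \in Lfun leb 2%:E.

Definition L2norm l f : \bar R := ('N[leb]_2%:E [EFin \o (f \_ `]0%R, l[)])%E.

Definition is_weak_deriv b f g : Prop :=
  forall phi, test_function b phi ->
    (\int[leb]_(x in `]0%R, b[) (f x * derive1 phi x))%R =
    - (\int[leb]_(x in `]0%R, b[) (g x * phi x))%R.

(* Value at 0 of the continuous representative on [0,l] of the class of f. For
   f in H^1(0,l) this representative exists and is unique on [0,l]. *)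
Definition trace0 l f : R :=
  xget (fun=> 0) [set g | {within `[0, l], continuous g} /\
    {ae leb, forall x, x \in `]0, l[ -> g x = f x}] 0.

(* Elements of L^r(0,T;L^2(0,l)) are represented by functions of (x,t) which
   are jointly measurable on the space-time cylinder. *)
Definition cylinder l T : set (measurableTypeR R * measurableTypeR R) :=
  `]0, l[ `*` `]0, T[.

Definition LrL2 (r : R) l T u : Prop :=
  measurable_fun (cylinder l T) u /\
  ('N[leb]_r%:E [(fun t => L2norm l (fun x => u (x, t))) \_ `]0%R, T[] < +oo)%E.

(* For each test function, the equality of the two L^2(0,l)-valued Bochner
   integrals is expressed for almost every x. *)
Definition is_weak_dt l T u v : Prop :=
  LrL2 1 l T v /\
  forall phi, test_function T phi ->
    {ae leb, forall x, x \in `]0, l[ ->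
      (\int[leb]_(t in `]0%R, T[) (u (x, t) * derive1 phi t))%R =
      - (\int[leb]_(t in `]0%R, T[) (v (x, t) * phi t))%R}.

Definition is_weak_dx l T u v : Prop :=
  LrL2 2 l T v /\
  {ae leb, forall t, t \in `]0, T[ ->
    is_weak_deriv l (fun x => u (x, t)) (fun x => v (x, t))}.

Definition W11_L2 l T u : Prop := LrL2 1 l T u /\ exists v, is_weak_dt l T u v.

Definition L2_H2 l T u : Prop :=
  LrL2 2 l T u /\ exists v w, is_weak_dx l T u v /\ is_weak_dx l T v w.

(* The weak derivatives, unique up to null sets when they exist. *)
Definition weak_dt l T u : R * R -> R := xget (fun=> 0) [set v | is_weak_dt l T u v].
Definition weak_dx l T u : R * R -> R := xget (fun=> 0) [set v | is_weak_dx l T u v].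

(* U is the representative of u in C([0,T];L^2(0,l)). *)
Definition is_time_cont_repr l T u (U : R * R -> R) : Prop :=
  [/\ forall t, t \in `[0, T] -> L2 l (fun x => U (x, t)),
      forall t, t \in `[0, T] ->
        L2norm l (fun x => U (x, s) - U (x, t)) @[s --> within `[0, T] (nbhs t)]
          --> 0%E
    & {ae leb, forall t, t \in `]0, T[ ->
        {ae leb, forall x, x \in `]0, l[ -> U (x, t) = u (x, t)}}].

(* u(.,0), through that representative, which exists for u in
   W^{1,1}(0,T;L^2(0,l)); it is determined for almost every x. *)
Definition initial_value l T u (x : R) : R :=
  xget (fun=> 0) [set U | is_time_cont_repr l T u U] (x, 0).

(* d_t^alpha u, with the weak time derivative of u on (0,T). *)
Definition caputo l T alpha u (z : R * R) : R :=
  (Gamma (1 - alpha))^-1 *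
  (\int[leb]_(s in `]0%R, z.2[) ((z.2 - s) `^ (- alpha) * weak_dt l T u (z.1, s)))%R.

Definition subdiffusion_eq l T alpha (p : R -> R) u : Prop :=
  {ae (leb \x leb)%E, forall z, cylinder l T z ->
    caputo l T alpha u z = weak_dx l T (weak_dx l T u) z - p z.1 * u z}.

End Defs.

(* Main.v *)
Require Import Defs.
From HB Require Import structures.
From mathcomp Require Import all_boot all_order all_algebra.
From mathcomp Require Import all_classical all_reals all_analysis.
From mathcomp Require Import measurable_realfun ring lra.
Import Order.TTheory GRing.Theory Num.Theory.
Import numFieldNormedType.Exports.
Local Open Scope classical_set_scope.
Local Open Scope ring_scope.

(** Apply to both equations the Laplace transform in time truncated at [T],
[laplace T s u x], the integral over ]0, T[ of exp (- s t) u(x, t), and put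
k^2 = s^alpha and v = s * laplace T s u.  The Abel kernel of the Caputo
derivative has transform proportional to s^(alpha - 1), and truncating at [T]
costs only an error of order exp (- s T / 2), so that
  v'' = (k^2 + p) v - k^2 a + error,   w'' = (k^2 + q) w - k^2 a + error,
where w comes from the second solution.  Equal lateral data at x = 0 say that
v and w have the same Cauchy data there.  Since s = k^(2 / alpha) is at least
k^2, the error is smaller than exp (- 4 l k) for large k, although v and w only
grow polynomially in k ([solution_profile], [large_k]).  What is left is the
following question for ordinary differential equations: the initial value [a],
never 0, appears as a known source, and p = q has to be deduced from the
existence of such v and w for all large k ([reduced_unique]).

Potentials are removed by a transmutation operator [transm p d], given by a
geometrically convergent series on short intervals [0, d]: it keeps Cauchy data
at 0 and satisfies
  (T_p phi)'' = T_p (phi'' - p phi)                              ([transm_ode]).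
Hence V = T_p v solves V'' = k^2 (V - T_p a) up to the error, and the difference
Z = T_p v - T_q w solves Z'' = k^2 (Z - g) with g = T_p a - T_q a and zero
Cauchy data.  Pairing with exp (k (d - y)) shows that the integral over [0, d]
of exp (k (d - y)) g(y) grows slower than every exponential in k, which forces
g = 0 ([cauchy_zero], [Laplace_unique]).  Differentiating T_p a = T_q a twice
gives T_p (a'' - p a) = T_q (a'' - q a), that is
  T_p (f a) = (T_p - T_q) (a'' - q a),   f = p - q.
Since T_p - id and T_p - T_q are both of order d^2, the latter with a factor
sup |f|, and |a| is bounded below, a small d gives sup |f| <= sup |f| / 2 and
f = 0 ([local_step]).

The operator at x uses phi on [-x, x], so the argument is run from a point c in
]0, l[ up to which p = q is known and after shifting the origin to c.  Agreement
on [0, c] makes the Cauchy data of v and w at c equal up to an exponentially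
small quantity ([ode_pair_local]), and equality of the potentials extends beyond
c ([extend_agreement]); the supremum of such c is therefore l.

The equations hold almost everywhere and the derivatives are weak, which is
dealt with by integration.  Every function involved is integrable on the
cylinder, so transforms commute with integrals in x.  A weak derivative makes a
function equal almost everywhere to a primitive ([weak_deriv_prim]).  The trace
at 0 is a combination of two moments, l f(0) being the integral of
f - (l - x) f' ([weak_moment]), and in this form it commutes with the transform.
The initial value enters through the integrals of u over space intervals, which
are absolutely continuous functions of time ([slice_initial]). *)

(** * Primitives of continuous functions *)

Section Primitive.
Context {R : realType}.
Implicit Types (f g : R -> R) (x y a b M : R).
Local Notation leb := (@lebesgue_measure R).

Lemma ct_cst {S U : topologicalType} (c : U) : continuous (fun _ : S => c).
Proof. by move=> y; exact: cvg_cst. Qed.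

Lemma ct_add {S : topologicalType} {f g : S -> R} :
  continuous f -> continuous g -> continuous (fun z => f z + g z).
Proof. by move=> cf cg y; apply: cvgD; [exact: cf|exact: cg]. Qed.

Lemma ct_opp {S : topologicalType} {f : S -> R} :
  continuous f -> continuous (fun z => - f z).
Proof. by move=> cf y; apply: cvgN; exact: cf. Qed.

Lemma ct_mul {S : topologicalType} {f g : S -> R} :
  continuous f -> continuous g -> continuous (fun z => f z * g z).
Proof. by move=> cf cg y; apply: cvgM; [exact: cf|exact: cg]. Qed.

Lemma ct_comp {S U V : topologicalType} {f : U -> V} {g : S -> U} :
  continuous f -> continuous g -> continuous (fun z => f (g z)).
Proof. by move=> cf cg y; apply: continuous_comp; [exact: cg|exact: cf]. Qed.

Lemma ct_pair {S U V : topologicalType} {f : S -> U} {g : S -> V} :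
  continuous f -> continuous g -> continuous (fun z => (f z, g z)).
Proof. by move=> cf cg y; apply: cvg_pair; [exact: cf|exact: cg]. Qed.

Lemma ct_id {S : topologicalType} : continuous (fun z : S => z).
Proof. by move=> y. Qed.

Lemma ct_fst {S U : topologicalType} : continuous (fun z : S * U => z.1).
Proof. by move=> y; exact: cvg_fst. Qed.

Lemma ct_snd {S U : topologicalType} : continuous (fun z : S * U => z.2).
Proof. by move=> y; exact: cvg_snd. Qed.

Lemma is_derive_affine (c d x : R) : is_derive x 1 (fun y => d + c * y) c.
Proof. by apply: is_derive_eq; rewrite add0r mul1r [LHS]mulr1. Qed.

Lemma is_derive_ext {f g x d d'} : is_derive x 1 f d -> f =1 g -> d = d' -> is_derive x 1 g d'.
Proof. by move=> + /funext <- <-. Qed.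

(** The integral from 0 to [x], with its sign, for [x] on the whole line. Identities
    between oriented primitives need no case analysis on the position of the bounds:
    they follow by comparing derivatives and values at 0. *)
Definition J f x : R :=
  (\int[leb]_(t in `[0, x]) f t)%R - (\int[leb]_(t in `[x, 0]) f t)%R.

Lemma cont_integrable_itv f a b : continuous f -> leb.-integrable `[a, b] (EFin \o f).
Proof.
move=> cf; apply: continuous_compact_integrable; first exact: segment_compact.
exact: continuous_subspaceT.
Qed.

Lemma J_split f a x : continuous f -> a <= 0 -> a <= x ->
  J f x = (\int[leb]_(t in `[a, x]) f t)%R - (\int[leb]_(t in `[a, 0]) f t)%R.
Proof.
move=> cf a0 ax; rewrite /J.
case: (ltrgtP 0 x) => [x0|x0|x0].
- rewrite [X in _ - X = _](_ : _ = 0) ?subr0; last first.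
    by rewrite set_itv_ge ?Rintegral_set0// bnd_simp -ltNge.
  rewrite Rintegral_itvB//; last 2 first.
    exact: cont_integrable_itv.
    by rewrite bnd_simp ltW.
  rewrite Rintegral_itv_obnd_cbnd//; apply: (integrableS _ _ _ (cont_integrable_itv f _ _ cf)) => //.
  exact: subset_itv_oc_cc.
- rewrite [X in X - _ = _](_ : _ = 0) ?sub0r; last first.
    by rewrite set_itv_ge ?Rintegral_set0// bnd_simp -ltNge.
  rewrite -[RHS]opprB; congr (- _); rewrite Rintegral_itvB//; last 2 first.
    exact: cont_integrable_itv.
    by rewrite bnd_simp ltW.
  rewrite Rintegral_itv_obnd_cbnd//; apply: (integrableS _ _ _ (cont_integrable_itv f _ _ cf)) => //.
  exact: subset_itv_oc_cc.
- by rewrite -x0 set_itv1 !Rintegral_set1 !subrr.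
Qed.

Lemma eqJ f g x : f =1 g -> J f x = J g x.
Proof. by move=> /funext ->. Qed.

Lemma J0 f : J f 0 = 0.
Proof. by rewrite /J subrr. Qed.

Lemma is_derive_J f x : continuous f -> is_derive x 1 (J f) (f x).
Proof.
move=> cf; pose a : R := - (`|x| + 1); pose u : R := `|x| + 1.
have ax : a < x by rewrite /a ltrNl (le_lt_trans (ler_norm _))// normrN ltrDl.
have xu : x < u by rewrite /u (le_lt_trans (ler_norm _))// ltrDl.
have a0 : a <= 0 by rewrite /a oppr_le0 addr_ge0.
have ax' : (BLeft a < BRight x)%E by rewrite lte_fin.
have [d e] := @continuous_FTC1 R f (BLeft a) x u xu (cont_integrable_itv f a u cf) ax' (cf x).
pose F := fun y => (\int[leb]_(t in `[a, y]) f t)%R.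
apply: (@near_eq_is_derive _ _ _ (fun y => F y - (\int[leb]_(t in `[a, 0]) f t)%R)).
  near=> y; rewrite (J_split f a)//; near: y.
  by apply: lt_le_nbhsr.
have dF : is_derive x 1 F (f x).
  by apply: DeriveDef; [exact: d|rewrite -derive1E; exact: e].
rewrite -[f x]subr0; exact: is_deriveB.
Unshelve. all: end_near. Qed.

Lemma continuous_J f : continuous f -> continuous (J f).
Proof.
move=> cf x; apply: differentiable_continuous; apply/derivable1_diffP.
by have [] := is_derive_J f x cf.
Qed.

Lemma eq_is_derive f g h : (forall x, is_derive x 1 f (h x)) ->
  (forall x, is_derive x 1 g (h x)) -> f 0 = g 0 -> f =1 g.
Proof.
move=> df dg fg0 x.
have : (f \- g) x = (f \- g) 0.
  apply: is_derive_0_is_cst => y.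
  by have := is_deriveB (df y) (dg y); rewrite subrr.
by rewrite /= fg0 subrr => /eqP; rewrite subr_eq0 => /eqP.
Qed.

(** Reduces the computation of a primitive to the verification of a derivative and
    of a value at 0; most identities about [J] are proved this way. *)
Lemma J_unique f F : continuous f -> (forall x, is_derive x 1 F (f x)) ->
  F 0 = 0 -> F =1 J f.
Proof.
move=> cf dF F0; apply: (@eq_is_derive _ _ f) => //; last by rewrite J0.
by move=> x; exact: is_derive_J.
Qed.

Lemma JD f g x : continuous f -> continuous g -> J (fun t => f t + g t) x = J f x + J g x.
Proof.
move=> cf cg; apply/esym.
apply: (@J_unique (fun t => f t + g t) (fun x => J f x + J g x)); last by rewrite !J0 addr0.
- by move=> y; apply: cvgD; [exact: cf|exact: cg].
- by move=> y; apply: is_deriveD; exact: is_derive_J.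
Qed.

Lemma JZ f c x : continuous f -> J (fun t => c * f t) x = c * J f x.
Proof.
move=> cf; apply/esym.
apply: (@J_unique (fun t => c * f t) (fun x => c * J f x)); last by rewrite J0 mulr0.
- by move=> y; apply: cvgM; [exact: cvg_cst|exact: cf].
- by move=> y; apply: is_deriveZ; exact: is_derive_J.
Qed.

Lemma JN f x : continuous f -> J (fun t => - f t) x = - J f x.
Proof.
move=> cf; rewrite -mulN1r -JZ//; congr J.
by apply/funext => t; rewrite mulN1r.
Qed.

Lemma JB f g x : continuous f -> continuous g -> J (fun t => f t - g t) x = J f x - J g x.
Proof.
move=> cf cg; rewrite JD ?JN//.
by move=> y; apply: cvgN; exact: cg.
Qed.

Lemma J_cst c x : J (fun=> c) x = c * x.
Proof.
apply/esym; apply: (@J_unique (fun=> c) (fun x => c * x)); last by rewrite mulr0.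
- by move=> y; exact: cvg_cst.
- move=> y; rewrite -[X in is_derive _ _ _ X]mulr1.
  by apply: is_deriveZ.
Qed.

Lemma J_itv f x : continuous f -> 0 <= x -> J f x = (\int[leb]_(t in `[0, x]) f t)%R.
Proof.
move=> cf x0; rewrite (J_split f 0)// [X in _ - X](_ : _ = 0) ?subr0//.
by rewrite set_itv1 Rintegral_set1.
Qed.

Lemma J_le f g x : continuous f -> continuous g -> 0 <= x ->
  (forall t, 0 <= t <= x -> f t <= g t) -> J f x <= J g x.
Proof.
move=> cf cg x0 fg; rewrite !J_itv//; apply: le_Rintegral => //.
- exact: cont_integrable_itv.
- exact: cont_integrable_itv.
Qed.

Lemma eq_J_ge0 f g x : 0 <= x -> (forall t, 0 <= t <= x -> f t = g t) -> J f x = J g x.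
Proof.
move=> x0 fg; rewrite /J; congr (_ - _); apply: eq_Rintegral => t;
  rewrite inE/= in_itv/= => /andP[t1 t2]; apply: fg; first by rewrite t1.
by rewrite (le_trans t2 x0) (le_trans x0 t1).
Qed.

Lemma J_bound f x M : continuous f -> 0 <= x -> (forall t, 0 <= t <= x -> `|f t| <= M) ->
  `|J f x| <= M * x.
Proof.
move=> cf x0 fM; rewrite ler_norml -mulNr -!(J_cst _ x).
by apply/andP; split; apply: J_le; rewrite //; try exact: ct_cst; move=> t /fM; rewrite ler_norml => /andP[].
Qed.

Lemma J_opp f x : continuous f -> J f (- x) = - J (fun t => f (- t)) x.
Proof.
move=> cf; apply: oppr_inj; rewrite opprK.
apply: (@J_unique (fun t => f (- t)) (fun x => - J f (- x))).
- by move=> y; apply: continuous_comp; [exact: opp_continuous|exact: cf].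
- move=> y; rewrite -[f (- y)]opprK; apply: is_deriveN.
  rewrite -[X in is_derive _ _ _ X]mulrN1.
  apply: (@is_derive1_comp _ (J f) -%R _ _ (-1)); first exact: is_derive_J.
- by rewrite oppr0 J0 oppr0.
Qed.

Lemma J_bound_abs f x M : continuous f -> (forall t, `|t| <= `|x| -> `|f t| <= M) ->
  `|J f x| <= M * `|x|.
Proof.
move=> cf fM; have [x0|x0] := leP 0 x.
  rewrite (ger0_norm x0); apply: J_bound => // t /andP[t0 tx].
  by apply: fM; rewrite !ger0_norm.
rewrite -[x in J f x]opprK J_opp// normrN (ltr0_norm x0); apply: J_bound.
- by move=> y; apply: continuous_comp; [exact: opp_continuous|exact: cf].
- by rewrite oppr_ge0 ltW.
- by move=> t /andP[t0 tx]; apply: fM; rewrite normrN ger0_norm// ltr0_norm.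
Qed.

Lemma J_sub f x y : continuous f -> J f (x + y) - J f x = J (fun t => f (x + t)) y.
Proof.
move=> cf.
apply: (@J_unique (fun t => f (x + t)) (fun y => J f (x + y) - J f x)).
- move=> z; apply: continuous_comp; last exact: cf.
  by apply: cvgD; [exact: cvg_cst|exact: cvg_id].
- move=> z; rewrite -[X in is_derive _ _ _ X]subr0; apply: is_deriveB.
  rewrite -[X in is_derive _ _ _ X]mulr1; apply: (@is_derive1_comp _ (J f) (fun y => x + y)).
    exact: is_derive_J.
  by have := is_derive_affine 1 x z; under eq_fun do rewrite mul1r.
- by rewrite addr0 subrr.
Qed.

End Primitive.

Global Opaque J.

Ltac cont_ext := fail.
(** Structural proof of continuity. [cont_ext] is the extension point: it is
    redefined each time an operator is shown to preserve joint continuity. The last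
    branch eta-expands the function so that the patterns apply to it. *)
Ltac cont_step :=
  match goal with
  | H : continuous ?f |- continuous ?f => exact H
  | |- continuous (fun _ => ?c) => exact: ct_cst
  | |- continuous (fun z => z) => exact: ct_id
  | |- continuous (fun z => @GRing.add _ (@?f z) (@?g z)) => refine (@ct_add _ _ f g _ _)
  | |- continuous (fun z => @GRing.opp _ (@?f z)) => refine (@ct_opp _ _ f _)
  | |- continuous (fun z => @GRing.mul _ (@?f z) (@?g z)) => refine (@ct_mul _ _ f g _ _)
  | |- continuous (fun z => (@?f z, @?g z)) => refine (@ct_pair _ _ _ f g _ _)
  | H : continuous ?f |- continuous (fun z => ?f (@?g z)) => refine (@ct_comp _ _ _ f g H _)
  | |- continuous (fun z => fst (@?g z)) => refine (@ct_comp _ _ _ _ g ct_fst _)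
  | |- continuous (fun z => snd (@?g z)) => refine (@ct_comp _ _ _ _ g ct_snd _)
  | |- _ => cont_ext
  | |- continuous ?f =>
    lazymatch f with (fun _ => _) => fail | _ => change (continuous (fun z => f z)) end
  end.
Ltac cont := repeat (cbn beta iota delta [fst snd]; cont_step).

(** * Primitives depending on a parameter *)

Section Param.
Context {R : realType}.
Implicit Types (f g : R -> R) (x y a b M : R).

(** The form in which derivatives of integrals come out: a remainder that is small
    compared to the increment. *)
Lemma is_derive_remainder f x d : (forall e, 0 < e -> exists2 r, 0 < r & forall h, `|h| < r ->
   `|f (x + h) - f x - d * h| <= e * `|h|) -> is_derive x 1 f d.
Proof.
move=> H.
have : h^-1 *: (f (h *: 1 + x) - f x) @[h --> 0^'] --> d.
  apply/cvgrPdist_le => e e0.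
  have [r r0 Hr] := H e e0.
  near=> h.
  have h0 : h != 0 by near: h; exact: nbhs_dnbhs_neq.
  have hr : `|h| < r by near: h; exact: dnbhs0_lt.
  have := Hr h hr.
  rewrite -(ler_pM2l (_ : 0 < `|h|^-1)) ?invr_gt0 ?normr_gt0// mulrCA mulVf ?normr_eq0// mulr1.
  apply: le_trans; rewrite -normfV -normrM distrC.
  rewrite [X in _ <= `|X|](_ : _ = h^-1 *: (f (h *: 1 + x) - f x) - d)//.
  by rewrite /GRing.scale/= mulr1 (addrC h x) mulrBr mulrCA mulVf// mulr1.
move=> c; apply: DeriveDef; first by apply/cvg_ex; exists d.
exact: cvg_lim.
Unshelve. all: end_near. Qed.

(** Compactness of the segment turns joint continuity into uniform closeness; every
    exchange of [J] with a limit below rests on it. *)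
Lemma near_uniform_segment {S : topologicalType} (F : S * R -> R) (s0 : S) M e : continuous F -> 0 < e ->
  \forall s \near s0, forall t, `|t| <= M -> `|F (s, t) - F (s0, t)| < e.
Proof.
move=> cF e0.
have K : compact `[- M, M] by exact: segment_compact.
move/compact_near_coveringP : K => /(_ _ (nbhs s0) (fun s t => `|F (s, t) - F (s0, t)| < e)).
move=> H; have {}H : \forall s \near s0, `[- M, M] `<=` (fun t => `|F (s, t) - F (s0, t)| < e).
  apply: H => t _.
  have cG : continuous (fun z : R * S => F (z.2, z.1) - F (s0, z.1)) by cont.
  have /cvgrPdist_lt/(_ e e0) := cG (t, s0).
  by apply: filterS => -[t' s]/=; rewrite subrr sub0r normrN.
apply: filterS H => s Hs t tM; apply: Hs.
by rewrite /= in_itv/= -ler_norml.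
Qed.

(** The parameter ranges over any topological space so that the lemma can be
    iterated: nested primitives are continuous in all their free variables. *)
Lemma ct_J {S : topologicalType} (F : S * R -> R) : continuous F ->
  continuous (fun z : S * R => J (fun t => F (z.1, t)) z.2).
Proof.
move=> cF [s0 x0].
have cFs s : continuous (fun t => F (s, t)) by cont.
apply/cvgrPdist_le => e e0; rewrite /=.
have c1 := continuous_J _ (cFs s0).
have M0 : 0 < `|x0| + 1 by rewrite ltr_wpDl.
have e2 : 0 < e / 2 by rewrite divr_gt0.
have e1 : 0 < e / 2 / (`|x0| + 1) by rewrite divr_gt0.
have n1 := near_uniform_segment F s0 (`|x0| + 1) _ cF e1.
have := c1 x0 => /cvgrPdist_le/(_ _ e2) n2.
have n3 : \forall x \near x0, `|x| <= `|x0| + 1.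
  have := @norm_continuous _ R x0 => /cvgrPdist_le/(_ _ ltr01).
  apply: filterS => x; rewrite distrC => /(le_trans (ler_norm _)).
  by rewrite lerBlDl.
near=> z.
have z1 : forall t, `|t| <= `|x0| + 1 -> `|F (z.1, t) - F (s0, t)| < e / 2 / (`|x0| + 1).
  by near: z; exact: (@cvg_fst _ _ (nbhs s0) (nbhs x0) _ _ n1).
have z2 : `|J (fun t => F (s0, t)) x0 - J (fun t => F (s0, t)) z.2| <= e / 2.
  by near: z; exact: (@cvg_snd _ _ (nbhs s0) (nbhs x0) _ _ n2).
have z3 : `|z.2| <= `|x0| + 1.
  by near: z; exact: (@cvg_snd _ _ (nbhs s0) (nbhs x0) _ _ n3).
rewrite -(subrKA (J (fun t => F (s0, t)) z.2)) (le_trans (ler_normD _ _))//.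
rewrite [leRHS](splitr e) lerD//.
rewrite -JB//; apply: (@le_trans _ _ (e / 2 / (`|x0| + 1) * `|z.2|)).
  apply: J_bound_abs; first by cont.
  by move=> t tz; rewrite distrC ltW// z1// (le_trans tz).
by rewrite -mulrA ler_piMr ?(ltW e2)// ler_pdivrMl// mulr1.
Unshelve. all: end_near. Qed.

Lemma ct_J_param {S : topologicalType} (F : S -> R -> R) (b : S -> R) :
  continuous (fun z : S * R => F z.1 z.2) -> continuous b ->
  continuous (fun s => J (F s) (b s)).
Proof.
move=> cF cb.
have /= := ct_J (fun z : S * R => F z.1 z.2) cF => cJ.
exact: (ct_comp cJ (ct_pair ct_id cb)).
Qed.

Ltac cont_ext ::=
  match goal with |- continuous (fun z => J (@?F z) (@?b z)) => refine (@ct_J_param _ F b _ _) end.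

(** The increment of [H] is itself a primitive of [H1], so the remainder is
    controlled by the uniform closeness of [H1] to its value at [x]. *)
Lemma derive_under_J (H H1 : R * R -> R) x y : continuous H -> continuous H1 ->
  (forall s x, is_derive x 1 (fun x => H (s, x)) (H1 (s, x))) ->
  is_derive x 1 (fun x => J (fun s => H (s, x)) y) (J (fun s => H1 (s, x)) y).
Proof.
move=> cH cH1 dH; apply: is_derive_remainder => e e0.
have M0 : 0 < `|y| + 1 by rewrite ltr_wpDl.
have e1 : 0 < e / (`|y| + 1) by rewrite divr_gt0.
have := @near_uniform_segment R (fun z => H1 (z.2, x + z.1)) 0 (`|y| + 1) _ _ e1.
have c2 : continuous (fun z : R * R => H1 (z.2, x + z.1)) by cont.
move=> /(_ c2)/nbhs_ballP[r/= r0 Hr]; exists r => // h hr.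
have cHx z : continuous (fun s => H (s, z)) by cont.
have cH1x z : continuous (fun s => H1 (s, z)) by cont.
have cH1s s : continuous (fun x => H1 (s, x)) by cont.
rewrite mulrC -JZ// -!JB//; try by cont.
have -> : (fun t => H (t, x + h) - H (t, x) - h * H1 (t, x)) =
  (fun t => J (fun r => H1 (t, x + r) - H1 (t, x)) h).
  apply/funext => s; rewrite JB ?J_cst//; last 2 first.
  - by cont.
  - by cont.
  rewrite (mulrC h); congr (_ - _).
  apply: (@J_unique _ (fun r => H1 (s, x + r)) (fun h => H (s, x + h) - H (s, x))).
  - by cont.
  - move=> z; rewrite -[X in is_derive _ _ _ X]subr0; apply: is_deriveB.
    rewrite -[X in is_derive _ _ _ X]mulr1; apply: (@is_derive1_comp _ (fun x => H (s, x)) (fun y => x + y)).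
    by have := is_derive_affine 1 x z; under eq_fun do rewrite mul1r.
  - by rewrite addr0 subrr.
apply: (@le_trans _ _ (e / (`|y| + 1) * `|h| * `|y|)).
  apply: J_bound_abs.
    apply: ct_J_param => /=; first by cont.
    by cont.
  move=> s sy; apply: J_bound_abs; first by cont.
  move=> t th; have := Hr t; rewrite /ball/= sub0r normrN addr0.
  by move=> /(_ (le_lt_trans th hr) s) /=; move=> K; apply/ltW/K; rewrite ler_wpDr.
rewrite mulrAC ler_wpM2r// -mulrA ler_piMr ?(ltW e0)//.
by rewrite ler_pdivrMl// mulr1 ler_wpDr.
Qed.

(** Cutting the integral at [x] separates the two dependences on the variable: the
    fixed bound is [derive_under_J], the moving bound only needs continuity of [H]
    at the diagonal point. *)
Lemma derive_under_J_diag (H H1 : R * R -> R) x : continuous H -> continuous H1 ->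
  (forall s x, is_derive x 1 (fun x => H (s, x)) (H1 (s, x))) ->
  is_derive x 1 (fun x => J (fun s => H (s, x)) x) (H (x, x) + J (fun s => H1 (s, x)) x).
Proof.
move=> cH cH1 dH.
have cHx z : continuous (fun s => H (s, z)) by cont.
have -> : (fun x => J (fun s => H (s, x)) x) =
  (fun z => J (fun s => H (s, z)) x + J (fun s => H (x + s, z)) (z - x)).
  apply/funext => z; rewrite -(J_sub (fun s => H (s, z)))// (addrC x) subrK; lra.
(* The fixed range [0, x] is [derive_under_J]; the integral from x to z is compared
   with z - x times the value of [H] at (x, x). *)
rewrite addrC; apply: is_deriveD; first exact: derive_under_J.
apply: is_derive_remainder => e e0.
have c2 : continuous (fun z : R * R => H (x + z.2, x + z.1)) by cont.
have c3 : continuous (fun z : R * R => H (x + z.1, x + z.2)) by cont.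
have /cvgrPdist_le/(_ e e0)/nbhs_ballP[r/= r0 Hr] := c3 (0, 0).
exists r => // h hr.
rewrite subrr J0 subr0 (addrC x h) addrK.
rewrite -J_cst -JB; last 2 first.
- by cont.
- by cont.
apply: J_bound_abs; first by cont.
move=> t th; have := Hr (t, h); rewrite /= !addr0 distrC (addrC h); apply; split => /=.
  by rewrite /ball/= sub0r normrN (le_lt_trans th).
by rewrite /ball/= sub0r normrN.
Qed.

Lemma J_swap (F : R * R -> R) x y : continuous F ->
  J (fun s => J (fun t => F (s, t)) x) y = J (fun t => J (fun s => F (s, t)) y) x.
Proof.
move=> cF; apply: (@J_unique _ (fun t => J (fun s => F (s, t)) y) (fun x => J (fun s => J (fun t => F (s, t)) x) y)).
- by apply: ct_J_param => /=; cont.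
- move=> z; apply: (derive_under_J (fun w => J (fun t => F (w.1, t)) w.2)) => //.
  + by apply: ct_J_param => /=; cont.
  + by move=> s w /=; apply: is_derive_J; cont.
- under eq_fun do rewrite J0; by rewrite J_cst mul0r.
Qed.

(** Two parametrisations of the integral over a triangle, by rows and by the lines
    of constant sum. Comparing derivatives replaces the change of variables. *)
Lemma J_conv (F : R * R -> R) x : continuous F ->
  J (fun s => J (fun t => F (s, t)) (x - s)) x = J (fun w => J (fun s => F (s, w - s)) w) x.
Proof.
move=> cF; apply: (@J_unique _ (fun w => J (fun s => F (s, w - s)) w) (fun x => J (fun s => J (fun t => F (s, t)) (x - s)) x)).
- by apply: ct_J_param => /=; cont.
- move=> z; rewrite -[X in is_derive _ _ _ X]add0r.
  have {1}<- : J (fun t => F (z, t)) (z - z) = 0 by rewrite subrr J0.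
  apply: (derive_under_J_diag (fun w => J (fun t => F (w.1, t)) (w.2 - w.1)) (fun w => F (w.1, w.2 - w.1))).
  + by apply: ct_J_param => /=; cont.
  + by cont.
  + move=> s w /=; rewrite -[X in is_derive _ _ _ X]mulr1.
    apply: (@is_derive1_comp _ (J (fun t => F (s, t))) (fun w => w - s)).
      by apply: is_derive_J; cont.
    have := is_derive_affine 1 (- s) w; congr (is_derive _ _ _ _).
    by apply/funext => v; rewrite mul1r addrC.
- by rewrite J0.
Qed.

(** The formula of Cauchy for repeated integration. *)
Lemma JJ_conv (f : R -> R) x : continuous f ->
  J (fun s => (x - s) * f s) x = J (J f) x.
Proof.
move=> cf; have := J_conv (fun z => f z.1) x => /=.
move=> <-; last by cont.
by congr J; apply/funext => s; rewrite J_cst mulrC.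
Qed.

End Param.

Ltac cont_ext ::=
  match goal with |- continuous (fun z => J (@?F z) (@?b z)) => refine (@ct_J_param _ _ F b _ _) end.

(** * The terms of the transmutation series *)

Section Transmutation.
Context {R : realType}.
Implicit Types (f g p q phi psi m : R -> R) (x y a b M : R) (n : nat).

(** The solution of the wave equation with zero position and velocity [phi], at time
    [h] and point [y], by the formula of d'Alembert. *)
Definition window (h : R) (phi : R -> R) (y : R) : R := 2^-1 * (J phi (y + h) - J phi (y - h)).

Lemma windowE h phi y : window h phi y = 2^-1 * (J phi (y + h) - J phi (y - h)).
Proof. by []. Qed.

(** The part of order [n] in [p] of the transmutation of [phi]. Each step of the
    recursion lets [phi] propagate freely during the time x - x', multiplies by [-
    p] and passes the result on with the remaining time x'. Only the values of [phi]
    on [-x, x] are used. *)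
Fixpoint transm_term (p : R -> R) n (phi : R -> R) (x : R) : R :=
  if n is n'.+1 then - J (fun x' => transm_term p n' (fun y => p y * window (x - x') phi y) x') x
  else phi x.

Lemma ct_window {S : topologicalType} (F : S * R -> R) (h b : S -> R) : continuous F ->
  continuous h -> continuous b -> continuous (fun s => window (h s) (fun y => F (s, y)) (b s)).
Proof.
move=> cF ch cb; rewrite /window.
by cont.
Qed.

Ltac cont_ext ::=
  match goal with
  | |- continuous (fun z => J (@?F z) (@?b z)) => refine (@ct_J_param _ _ F b _ _)
  | |- continuous (fun z => window (@?h z) (@?F z) (@?b z)) =>
    refine (@ct_window _ (fun w => F (fst w) (snd w)) h b _ _ _)
  end.

Lemma ct_transm_term p n : continuous p -> forall {S : topologicalType} (F : S * R -> R),
  continuous F -> continuous (fun z : S * R => transm_term p n (fun y => F (z.1, y)) z.2).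
Proof.
move=> cp; elim: n => [|n IH] S F cF /=; first by cont.
apply: ct_opp; apply: ct_J_param; last by cont.
pose F' := fun w : (S * R) * R => p w.2 * window w.1.2 (fun y => F (w.1.1, y)) w.2.
have cF' : continuous F' by rewrite /F'; cont.
have := IH _ F' cF' => cP /=.
exact: (@ct_comp _ _ _ _ (fun z : (S * R) * R => ((z.1.1, z.1.2 - z.2), z.2)) cP
   ltac:(cont)).
Qed.

Lemma ct_transm_term_param p n {S : topologicalType} (F : S * R -> R) (b : S -> R) : continuous p ->
  continuous F -> continuous b -> continuous (fun s => transm_term p n (fun y => F (s, y)) (b s)).
Proof.
move=> cp cF cb; have cP := ct_transm_term p n cp F cF.
exact: (ct_comp cP (ct_pair ct_id cb)).
Qed.

Ltac cont_ext ::=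
  match goal with
  | |- continuous (fun z => J (@?F z) (@?b z)) => refine (@ct_J_param _ _ F b _ _)
  | |- continuous (fun z => window (@?h z) (@?F z) (@?b z)) =>
    refine (@ct_window _ (fun w => F (fst w) (snd w)) h b _ _ _)
  | |- continuous (fun z => transm_term ?p ?n (@?F z) (@?b z)) =>
    refine (@ct_transm_term_param p n _ (fun w => F (fst w) (snd w)) b _ _ _)
  end.

Lemma ct_transm_term1 p n phi : continuous p -> continuous phi -> continuous (transm_term p n phi).
Proof.
by move=> cp cphi; cont.
Qed.

Lemma window_linear h a phi b psi y : continuous phi -> continuous psi ->
  window h (fun t => a * phi t + b * psi t) y = a * window h phi y + b * window h psi y.
Proof.
move=> cphi cpsi; rewrite /window !JD ?JZ//; try (by cont).
ring.
Qed.

Lemma transm_term_linear p n a phi b psi x : continuous p -> continuous phi -> continuous psi ->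
  transm_term p n (fun t => a * phi t + b * psi t) x = a * transm_term p n phi x + b * transm_term p n psi x.
Proof.
move=> cp; elim: n phi psi x => [//|n IH] phi psi x cphi cpsi /=.
have -> : (fun x' => transm_term p n (fun y => p y * window (x - x') (fun t => a * phi t + b * psi t) y) x') =
  (fun x' => a * transm_term p n (fun y => p y * window (x - x') phi y) x' +
    b * transm_term p n (fun y => p y * window (x - x') psi y) x').
  apply/funext => x'; rewrite -IH.
  - by congr (transm_term _ _ _ _); apply/funext => y; rewrite window_linear//; ring.
  - by cont.
  - by cont.
rewrite JD ?JZ//; try (by cont).
by rewrite !mulrN -opprD.
Qed.

(** Linearity under an integral sign; the integrated wave equation produces
    functions of this form as arguments of the operator. *)
Lemma transm_term_J p n (psi : R * R -> R) h x : continuous p -> continuous psi ->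
  transm_term p n (fun y => J (fun s => psi (s, y)) h) x = J (fun s => transm_term p n (fun y => psi (s, y)) x) h.
Proof.
move=> cp; elim: n psi x => [//|n IH] psi x cpsi /=.
have cpsi' : continuous (fun z : R * R => psi (z.2, z.1)) by cont.
rewrite JN; last by cont.
apply: f_equal.
rewrite -(J_swap (fun z => transm_term p n (fun y => p y * window (x - z.1) (fun t => psi (z.2, t)) y) z.1)); last by cont.
apply: eqJ => x' /=.
rewrite -(IH (fun z => p z.2 * window (x - x') (fun t => psi (z.1, t)) z.2)); last by cont.
congr (transm_term _ _ _ _); apply/funext => y /=.
rewrite JZ; last by cont.
congr (_ * _); rewrite /window JZ; last by cont.
congr (_ * _).
apply: (etrans _ (esym (JB (fun t => J (fun t0 => psi (t, t0)) (y + (x - x')))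
  (fun t => J (fun t0 => psi (t, t0)) (y - (x - x'))) h _ _))); [|by cont|by cont].
have E w : J (fun y0 => J (fun s => psi (s, y0)) h) w = J (fun t => J (fun t0 => psi (t, t0)) w) h.
  exact: (J_swap (fun z => psi (z.2, z.1)) h w cpsi').
exact: (f_equal2 (fun a b => a - b) (E _) (E _)).
Qed.

(** The wave equation for [window]: two derivatives in [h] amount to applying it to
    the second derivative [m] of [phi]. The integrated form suits profiles that are
    only known as double primitives. *)
Lemma window_ode A B phi m : continuous m -> (forall x, phi x = A + B * x + J (J m) x) ->
  forall h y, window h phi y = h * phi y + J (J (fun h' => window h' m y)) h.
Proof.
move=> cm phiE h y.
have cJm := continuous_J _ cm.
have cphi : continuous phi.
  have cJJm := continuous_J _ cJm.
  by rewrite (_ : phi = fun x => A + B * x + J (J m) x); [cont|exact/funext].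
have dphi x : is_derive x 1 phi (B + J m x).
  rewrite (_ : phi = fun x => (A + B * x) + J (J m) x); last exact/funext.
  by apply: is_deriveD; [exact: is_derive_affine|exact: is_derive_J].
have cQ : continuous (fun h' => window h' m y).
  by cont.
have dcomp f df (c : R) (h0 : R) : (forall x, is_derive x 1 f (df x)) ->
   is_derive h0 1 (fun h => f (y + c * h)) (df (y + c * h0) * c).
  move=> df'; apply: (@is_derive1_comp _ f (fun h => y + c * h)) => //.
  exact: is_derive_affine.
have g1 h' : 2^-1 * (phi (y + h') + phi (y - h')) = phi y + J (fun h' => window h' m y) h'.
  apply: (@eq_is_derive _ (fun h' => 2^-1 * (phi (y + h') + phi (y - h')))
    (fun h' => phi y + J (fun h' => window h' m y) h') (fun h' => window h' m y)).
  - move=> x; rewrite /window.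
    apply: is_deriveZ.
    apply: (is_derive_ext (is_deriveD (dcomp _ _ 1 x dphi) (dcomp _ _ (-1) x dphi))).
      by move=> z /=; rewrite -[LHS]/(_ + _) /= mul1r mulN1r.
    by rewrite mul1r mulN1r mulr1 mulrN1; lra.
  - move=> x; rewrite -[X in is_derive _ _ _ X]add0r; apply: is_deriveD.
    exact: is_derive_J.
  - by rewrite J0 addr0 subr0 addr0; field.
rewrite /window.
apply: (@eq_is_derive _ (fun h => 2^-1 * (J phi (y + h) - J phi (y - h)))
   (fun h => h * phi y + J (J (fun h' : R => window h' m y)) h)
   (fun h' => 2^-1 * (phi (y + h') + phi (y - h')))).
- move=> x; apply: is_deriveZ.
  have dJ (z : R) : is_derive z 1 (J phi) (phi z) by exact: is_derive_J.
  apply: (is_derive_ext (is_deriveB (dcomp _ _ 1 x dJ) (dcomp _ _ (-1) x dJ))).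
    by move=> z /=; rewrite -[LHS]/(_ - _) /= mul1r mulN1r.
  by rewrite mul1r mulN1r mulr1 mulrN1 opprK.
- move=> x; rewrite g1; apply: is_deriveD; last first.
    by apply: is_derive_J; exact: continuous_J.
  have := is_derive_affine (phi y) 0 x.
  by under eq_fun do rewrite add0r mulrC.
- by rewrite !addr0 subr0 subrr !mulr0 mul0r J0 addr0.
Qed.

Lemma JJ_oppD f g x : continuous f -> continuous g ->
  J (J (fun y => - g y - f y)) x = - (J (J f) x + J (J g) x).
Proof.
move=> cf cg; have cJf := continuous_J _ cf; have cJg := continuous_J _ cg.
rewrite -JD// -JN; last by cont.
apply: eqJ => w; rewrite JD ?JN//; [lra|by cont|by cont].
Qed.

(** Summed over [n], the terms in [p y * phi y] shift the order by one; this is what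
    conjugates the operator with potential [p] to the free one. In the proof,
    [window_ode] is inserted into the recursion: the part linear in [h] becomes a
    double primitive by [JJ_conv] and the rest a double primitive by [J_conv] used
    twice. *)
Lemma transm_term_ode p n A B phi m : continuous p -> continuous m ->
  (forall x, phi x = A + B * x + J (J m) x) ->
  forall x, transm_term p n.+1 phi x = J (J (fun y => transm_term p n.+1 m y - transm_term p n (fun y => p y * phi y) y)) x.
Proof.
move=> cp cm phiE x.
have cJm := continuous_J _ cm.
have cphi : continuous phi.
  have cJJm := continuous_J _ cJm.
  by rewrite (_ : phi = fun x => A + B * x + J (J m) x); [cont|exact/funext].
have cpphi : continuous (fun y => p y * phi y) by cont.
pose G z := transm_term p n (fun y => p y * window z.2 m y) z.1.
have cG : continuous G.
  by rewrite /G; cont.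
have step h x' : transm_term p n (fun y => p y * window h phi y) x' =
    h * transm_term p n (fun y => p y * phi y) x' + J (J (fun h' => G (x', h'))) h.
  have -> : (fun y => p y * window h phi y) =
    (fun y => h * (p y * phi y) + 1 * (J (fun s => J (fun h' => p y * window h' m y) s) h)).
    apply/funext => y; rewrite (window_ode _ _ _ _ cm phiE) mul1r mulrDr mulrCA; congr (_ + _).
    rewrite -JZ; last by cont.
    by apply: eqJ => s; rewrite JZ//; cont.
  rewrite transm_term_linear ?mul1r//; last by cont.
  congr (_ + _).
  rewrite (transm_term_J p n (fun z => J (fun h' => p z.2 * window h' m z.2) z.1))//; last by cont.
  apply: eqJ => s /=.
  by apply: (transm_term_J p n (fun z => p z.2 * window z.1 m z.2)) => //; cont.
rewrite /=.
under eq_fun do rewrite step.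
have cPp : continuous (transm_term p n (fun y => p y * phi y)) by exact: ct_transm_term1.
have cJG : continuous (fun z : R * R => J (fun h' => G (z.1, h')) z.2).
  by cont.
rewrite JD; last 2 first.
- by cont.
- by cont.
have E : J (fun s => J (J (fun h' => G (s, h'))) (x - s)) x =
    J (J (fun w => J (fun s => G (s, w - s)) w)) x.
  apply: (etrans (J_conv (fun z => J (fun h' => G (z.1, h')) z.2) x cJG)).
  by apply: eqJ => w; exact: J_conv.
apply: (etrans (f_equal -%R (f_equal2 +%R (JJ_conv _ x cPp) E))).
pose Gc y := J (fun s => G (s, y - s)) y.
have cGc : continuous Gc by rewrite /Gc; cont.
exact: (esym (JJ_oppD _ _ x cPp cGc)).
Qed.

End Transmutation.

Global Opaque window.
Ltac cont_ext ::=
  match goal with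
  | |- continuous (fun z => J (@?F z) (@?b z)) => refine (@ct_J_param _ _ F b _ _)
  | |- continuous (fun z => window (@?h z) (@?F z) (@?b z)) =>
    refine (@ct_window _ _ (fun w => F (fst w) (snd w)) h b _ _ _)
  | |- continuous (fun z => transm_term ?p ?n (@?F z) (@?b z)) =>
    refine (@ct_transm_term_param _ p n _ (fun w => F (fst w) (snd w)) b _ _ _)
  end.

(** * Geometric bounds for the terms *)

Section TransBound.
Context {R : realType}.
Implicit Types (f g p q phi psi m : R -> R) (x y a b M B d F h : R) (n : nat).

Lemma window_bound h phi y M : continuous phi -> 0 <= h ->
  (forall t, y - h <= t <= y + h -> `|phi t| <= M) -> `|window h phi y| <= M * h.
Proof.
move=> cphi h0 phiM.
have E : window h phi y = 2^-1 * J (fun t => phi ((y - h) + t)) (h + h).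
  rewrite -J_sub// windowE; apply: f_equal; apply: f_equal2 => //.
  by apply: f_equal; ring.
rewrite E normrM ger0_norm ?invr_ge0// ler_pdivrMl//.
apply: (@le_trans _ _ (M * (h + h))); last by rewrite le_eqVlt; apply/orP; left; apply/eqP; ring.
apply: J_bound; first by cont.
  by rewrite addr_ge0.
move=> t /andP[t0 th]; apply: phiM; apply/andP; split; lra.
Qed.

(** A step of the recursion integrates once over a length at most [d] and once, with
    weight 1/2, over a window of length at most [2 * d]; together with the potential
    this is the factor [B * d ^+ 2]. *)
Lemma transm_term_bound p n B d phi x M : continuous p -> continuous phi ->
  (forall y, `|y| <= d -> `|p y| <= B) -> 0 <= x <= d ->
  (forall y, `|y| <= x -> `|phi y| <= M) -> `|transm_term p n phi x| <= M * (B * d ^+ 2) ^+ n.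
Proof.
move=> cp cphi pB.
have B0 y : `|y| <= d -> 0 <= B by move=> /pB; exact: le_trans.
elim: n phi x M cphi => [|n IH] phi x M cphi /andP[x0 xd] phiM /=.
  by rewrite expr0 mulr1 phiM// ger0_norm.
have {}B0 : 0 <= B by apply: (B0 x); rewrite ger0_norm.
have M0 : 0 <= M by apply: le_trans (phiM x _); rewrite // ger0_norm.
have d0 : 0 <= d by exact: le_trans xd.
rewrite normrN; apply: (@le_trans _ _ ((B * (M * d)) * (B * d ^+ 2) ^+ n * x)).
  apply: J_bound => //; first by cont.
  move=> t /andP[t0 tx]; apply: IH.
  - by cont.
  - by rewrite t0 (le_trans tx).
  - move=> y yt; rewrite normrM ler_pM//.
      by apply: pB; rewrite (le_trans yt)// (le_trans tx).
    apply: (@le_trans _ _ (M * (x - t))).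
      apply: window_bound => //; first by rewrite subr_ge0.
      move=> s /andP[s1 s2]; apply: phiM; rewrite ler_norml.
      move: yt; rewrite ler_norml => /andP[y1 y2]; apply/andP; split; lra.
    by rewrite ler_wpM2l//; lra.
have -> : M * (B * d ^+ 2) ^+ n.+1 = (B * (M * d)) * (B * d ^+ 2) ^+ n * d.
  by rewrite exprS; ring.
apply: ler_wpM2l => //; rewrite mulr_ge0// ?mulr_ge0//.
by rewrite exprn_ge0// mulr_ge0// sqr_ge0.
Qed.

(** Telescoping: replacing [p] by [q] in the outermost factor costs [F], in the
    inner term it is the induction hypothesis. A ratio [B * d ^+ 2] of at most 1/4
    leaves room for both contributions within a factor 1/2 per step. *)
Lemma transm_term_diff p q n B d F phi x M : continuous p -> continuous q -> continuous phi ->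
  (forall y, `|y| <= d -> `|p y| <= B) -> (forall y, `|y| <= d -> `|q y| <= B) ->
  (forall y, `|y| <= d -> `|p y - q y| <= F) ->
  B * d ^+ 2 <= 4^-1 -> 0 <= x <= d ->
  (forall y, `|y| <= x -> `|phi y| <= M) ->
  `|transm_term p n phi x - transm_term q n phi x| <= 4 * 2^-1 ^+ n * (F * d ^+ 2 * M).
Proof.
move=> cp cq cphi pB qB pqF Bd.
elim: n phi x M cphi => [|n IH] phi x M cphi /andP[x0 xd] phiM /=.
  have M0 : 0 <= M by apply: le_trans (phiM x _); rewrite // ger0_norm.
  have F0 : 0 <= F by apply: le_trans (pqF x _); rewrite // ger0_norm.
  rewrite subrr normr0 expr0 mulr1.
  exact: mulr_ge0 (ler0n _ 4) (mulr_ge0 (mulr_ge0 F0 (sqr_ge0 d)) M0).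
have B0 : 0 <= B by apply: le_trans (pB x _); rewrite // ger0_norm.
have M0 : 0 <= M by apply: le_trans (phiM x _); rewrite // ger0_norm.
have F0 : 0 <= F by apply: le_trans (pqF x _); rewrite // ger0_norm.
have d0 : 0 <= d by exact: le_trans xd.
have e0 : 0 <= 2^-1 ^+ n :> R by rewrite exprn_ge0// invr_ge0.
rewrite -opprD normrN -JB; [|by cont|by cont].
apply: (@le_trans _ _ ((4 * 2^-1 ^+ n * (F * d ^+ 2 * (B * (M * d))) + (F * (M * d)) * 2^-1 ^+ n) * x)).
  apply: J_bound => //; first by cont.
  move=> t /andP[t0 tx].
  have Qb y : `|y| <= t -> `|window (x - t) phi y| <= M * d.
    move=> yt; apply: (@le_trans _ _ (M * (x - t))).
      apply: window_bound => //; first by rewrite subr_ge0.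
      move=> s /andP[s1 s2]; apply: phiM; rewrite ler_norml.
      move: yt; rewrite ler_norml => /andP[y1 y2]; apply/andP; split; lra.
    by rewrite ler_wpM2l//; lra.
  have td : 0 <= t <= d by rewrite t0 (le_trans tx).
  have yd y : `|y| <= t -> `|y| <= d by move=> yt; rewrite (le_trans yt)// (le_trans tx).
  have -> : transm_term p n (fun y => p y * window (x - t) phi y) t - transm_term q n (fun y => q y * window (x - t) phi y) t =
    (transm_term p n (fun y => p y * window (x - t) phi y) t - transm_term q n (fun y => p y * window (x - t) phi y) t) +
    transm_term q n (fun y => 1 * (p y * window (x - t) phi y) + (- 1) * (q y * window (x - t) phi y)) t.
    by rewrite transm_term_linear//; [lra|cont|cont].
  apply: (le_trans (ler_normD _ _)); apply: lerD.
    apply: IH => //; first by cont.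
    by move=> y yt; rewrite normrM ler_pM ?Qb// pB// yd.
  apply: (@le_trans _ _ (F * (M * d) * (B * d ^+ 2) ^+ n)).
    apply: transm_term_bound => //; first by cont.
    move=> y yt; rewrite mul1r mulN1r -mulrBl normrM ler_pM ?Qb// pqF// yd//.
  rewrite ler_wpM2l ?mulr_ge0//; apply: lerXn2r; rewrite ?nnegrE ?invr_ge0//.
    by rewrite mulr_ge0// sqr_ge0.
  by lra.
(* It remains to see that 4 (B d^2) + 1 is at most 2. *)
set E := 2^-1 ^+ n in e0 *.
apply: (@le_trans _ _ ((4 * E * (F * d ^+ 2 * (B * (M * d))) + (F * (M * d)) * E) * d)).
  apply: ler_wpM2l => //; apply: addr_ge0; rewrite !mulr_ge0 ?sqr_ge0//.
rewrite (exprS (2^-1 : R) n) -/E.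
have -> : (4 * E * (F * d ^+ 2 * (B * (M * d))) + F * (M * d) * E) * d =
   E * (F * d ^+ 2 * M) * (4 * (B * d ^+ 2) + 1) by ring.
have -> : 4 * (2^-1 * E) * (F * d ^+ 2 * M) = E * (F * d ^+ 2 * M) * 2 by field.
by rewrite ler_wpM2l ?mulr_ge0 ?sqr_ge0//; lra.
Qed.

(** The starting index allows the head of the series to be split off, which is where
    the quadratic smallness of [transm_near_id] comes from. *)
Lemma geo_series (u : R^nat) (K : R) (N0 : nat) : (forall j, (N0 <= j)%N -> `|u j| <= K * 2^-1 ^+ j) ->
  cvgn (series u) /\ forall N, (N0 <= N)%N -> `|limn (series u) - series u N| <= K * 2 * 2^-1 ^+ N.
Proof.
move=> uK.
have K0 : 0 <= K.
  have := le_trans (normr_ge0 _) (uK N0 (leqnn _)).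
  by rewrite pmulr_lge0// exprn_gt0// invr_gt0.
have B N k : (N0 <= N)%N -> `|series u (N + k)%N - series u N| <= K * 2 * 2^-1 ^+ N - K * 2 * 2^-1 ^+ (N + k).
  move=> NN; elim: k => [|k IH]; first by rewrite addn0 !subrr normr0.
  rewrite addnS seriesSr.
  rewrite addrAC; apply: (le_trans (ler_normD _ _)).
  apply: (le_trans (lerD IH (uK (N + k)%N _))); first by rewrite (leq_trans NN)// leq_addr.
  rewrite exprS; set E := 2^-1 ^+ (N + k); lra.
have B' N k : (N0 <= N)%N -> `|series u (N + k)%N - series u N| <= K * 2 * 2^-1 ^+ N.
  move=> /(B _ k) /le_trans; apply; rewrite gerBl mulr_ge0 ?mulr_ge0// exprn_ge0// invr_ge0//.
have cv : cvgn (series u).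
  apply/cauchy_cvgP/cauchy_ballP => e e0.
  have D0 : 0 < K * 4 + 1 by lra.
  have e1 : 0 < e / (K * 4 + 1) by rewrite divr_gt0.
  have half1 : `|2^-1 : R| < 1 by rewrite ger0_norm ?invr_ge0// invf_lt1// ltr1n.
  have /cvgrPdist_lt/(_ _ e1)[N _ HN] := @cvg_expr R 2^-1 half1.
  near_simpl.
  exists ([set n | (maxn N N0 <= n)%N], [set n | (maxn N N0 <= n)%N]) => /=.
    by split; exists (maxn N N0).
  move=> [n m]/= [nN mN].
  have key k : (maxn N N0 <= k)%N -> `|series u k - series u (maxn N N0)| < e / 2.
    move=> kN; rewrite -(subnKC kN); apply: (le_lt_trans (B' _ _ (leq_maxr _ _))).
    have := HN (maxn N N0) (leq_maxl _ _); rewrite /= sub0r normrN ger0_norm ?exprn_ge0 ?invr_ge0//.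
    set E := 2^-1 ^+ _.
    rewrite ltr_pdivlMr// => H.
    have E0 : 0 < E by rewrite exprn_gt0// invr_gt0.
    by nra.
  rewrite /ball/= -(subrKA (series u (maxn N N0))) (le_lt_trans (ler_normD _ _))//.
  by rewrite (splitr e) ltrD ?key// distrC key.
split => // N NN.
apply: (@ler_cvg_to _ eventually _ _ (fun n => `|series u n - series u N|) (fun=> K * 2 * 2^-1 ^+ N)).
- by apply: cvg_norm; apply: cvgB => //; exact: cvg_cst.
- exact: cvg_cst.
- near=> n.
  have nN : (N <= n)%N by near: n; exists N.
  by rewrite -(subnKC nN); exact: B'.
Unshelve. all: end_near. Qed.

Lemma small_eq0 (z K : R) : (forall N, `|z| <= K * 2^-1 ^+ N) -> z = 0.
Proof.
move=> H; apply/eqP; rewrite -normr_le0.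
have half1 : `|2^-1 : R| < 1 by rewrite ger0_norm ?invr_ge0// invf_lt1// ltr1n.
apply: (@ler_cvg_to _ eventually _ _ (fun=> `|z|) (fun n => K * 2^-1 ^+ n)).
- exact: cvg_cst.
- by rewrite -[X in _ --> X](mulr0 K); apply: cvgM; [exact: cvg_cst|exact: cvg_expr].
- by near=> n; exact: H.
Unshelve. all: end_near. Qed.

End TransBound.

(** * The transmutation operator *)

Section TDef.
Context {R : realType}.
Implicit Types (f p q phi psi m : R -> R) (x y a b M B d F : R) (n N : nat).

Lemma ct_max {S : topologicalType} {f g : S -> R} : continuous f -> continuous g ->
  continuous (fun z => Num.max (f z) (g z)).
Proof. by move=> cf cg z; apply: (@continuous_max _ _ f g); [exact: cf|exact: cg]. Qed.

Lemma ct_min {S : topologicalType} {f g : S -> R} : continuous f -> continuous g ->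
  continuous (fun z => Num.min (f z) (g z)).
Proof. by move=> cf cg z; apply: (@continuous_min _ _ f g); [exact: cf|exact: cg]. Qed.

Lemma ct_norm {S : topologicalType} {f : S -> R} : continuous f ->
  continuous (fun z => `|f z|).
Proof. by move=> cf z; apply: cvg_norm; exact: cf. Qed.

(** Composing with this projection extends functions that are continuous on a
    segment to continuous functions on the line. *)
Definition clamp a b x : R := Num.max a (Num.min x b).

Lemma ct_clamp a b : continuous (clamp a b).
Proof. by apply: ct_max; [cont|apply: ct_min; cont]. Qed.

Lemma clamp_itv a b x : a <= b -> a <= clamp a b x <= b.
Proof. by move=> ab; rewrite /clamp le_max lexx/= ge_max ab ge_min lexx orbT. Qed.

Lemma clamp_id a b x : a <= x <= b -> clamp a b x = x.
Proof. by move=> /andP[ax xb]; rewrite /clamp min_l// max_r. Qed.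

Lemma JJ_addE (f g h : R -> R) x : continuous f -> continuous g -> (forall w, h w = f w + g w) ->
  J (J f) x + J (J g) x = J (J h) x.
Proof.
move=> cf cg hE; rewrite -JD; [|exact: continuous_J|exact: continuous_J].
by apply: eqJ => w; rewrite -JD//; apply: eqJ.
Qed.

Lemma JJ_bound f x d M : continuous f -> 0 <= x <= d -> (forall t, 0 <= t <= x -> `|f t| <= M) ->
  `|J (J f) x| <= M * d * d.
Proof.
move=> cf /andP[x0 xd] fM.
have M0 : 0 <= M by apply: le_trans (fM 0 _); rewrite // lexx.
apply: (@le_trans _ _ (M * d * x)).
  apply: J_bound => //; first by cont.
  move=> t /andP[t0 tx]; apply: (@le_trans _ _ (M * t)).
    by apply: J_bound => // s /andP[s0 st]; apply: fM; rewrite s0 (le_trans st).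
  by rewrite ler_wpM2l// (le_trans tx).
by rewrite ler_wpM2l// mulr_ge0// (le_trans x0).
Qed.

Lemma dist_sub_le (a b c e u v : R) : `|c - a| <= u -> `|e - b| <= v -> `|a - b - (c - e)| <= u + v.
Proof.
by rewrite !ler_norml => /andP[? ?] /andP[? ?]; apply/andP; split; lra.
Qed.

Lemma dist_add_le (a c e l u v : R) : `|a - (l + c)| <= u -> `|c - e| <= v -> `|a - (l + e)| <= u + v.
Proof.
by rewrite !ler_norml => /andP[? ?] /andP[? ?]; apply/andP; split; lra.
Qed.

Lemma JJ_subE (f g : R -> R) x : continuous f -> continuous g ->
  J (J (fun w => f w - g w)) x = J (J f) x - J (J g) x.
Proof.
move=> cf cg; rewrite -JB; [|exact: continuous_J|exact: continuous_J].
by apply: eqJ => w; rewrite -JB//; apply: eqJ.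
Qed.

Lemma cont_bounded phi d : continuous phi -> exists2 M : R, 0 <= M & forall y, `|y| <= d -> `|phi y| <= M.
Proof.
move=> cphi; have [d0|d0] := leP 0 d; last first.
  by exists 0 => // y yd; have := le_lt_trans (le_trans (normr_ge0 y) yd) d0; rewrite ltxx.
have dd : - d <= d by lra.
have cn : {within `[- d, d], continuous (fun x => `|phi x|)}.
  by apply: continuous_subspaceT; exact: ct_norm.
have [c _ H] := EVT_max dd cn.
exists `|phi c| => // y yd; apply: H.
by rewrite in_itv/= -ler_norml.
Qed.

(** The argument is clamped to [0, d], the only place where the bound on [p] makes
    the series converge, so that the sum is continuous on the line. *)
Definition transm p d phi x : R := limn (series (fun j => transm_term p j phi (clamp 0 d x))).

Section Fixed.
Variables (p : R -> R) (B d : R).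
Hypotheses (cp : continuous p) (pB : forall y, `|y| <= d -> `|p y| <= B)
  (Bd : B * d ^+ 2 <= 4^-1) (d0 : 0 <= d).

Lemma bound_ge0 : 0 <= B.
Proof. by apply: le_trans (pB 0 _); rewrite // normr0. Qed.

Lemma transm_term_geo phi M n x : continuous phi -> (forall y, `|y| <= d -> `|phi y| <= M) ->
  0 <= x <= d -> `|transm_term p n phi x| <= M * 2^-1 ^+ n.
Proof.
move=> cphi phiM /andP[x0 xd].
have M0 : 0 <= M by apply: le_trans (phiM 0 _); rewrite // normr0.
apply: (@le_trans _ _ (M * (B * d ^+ 2) ^+ n)).
  apply: transm_term_bound; rewrite // ?x0 ?xd// => y yx; apply: phiM; exact: le_trans xd.
rewrite ler_wpM2l//; apply: lerXn2r; rewrite ?nnegrE ?invr_ge0//.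
  by rewrite mulr_ge0 ?bound_ge0// sqr_ge0.
by apply: (le_trans Bd); lra.
Qed.

Lemma transm_approx phi M : continuous phi -> (forall y, `|y| <= d -> `|phi y| <= M) ->
  forall x, 0 <= x <= d -> cvgn (series (fun j => transm_term p j phi x)) /\
  forall N, `|transm p d phi x - series (fun j => transm_term p j phi x) N| <= M * 2 * 2^-1 ^+ N.
Proof.
move=> cphi phiM x xd; rewrite /transm clamp_id//.
have [|cv H] := @geo_series _ (fun j => transm_term p j phi x) M 0%N.
  by move=> j _; exact: transm_term_geo.
by split => // N; exact: H.
Qed.

Lemma transm_clamp phi x : transm p d phi x = transm p d phi (clamp 0 d x).
Proof. by rewrite /transm (@clamp_id 0 d (clamp 0 d x))// clamp_itv. Qed.

Lemma transm_bound phi M x : continuous phi -> (forall y, `|y| <= d -> `|phi y| <= M) ->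
  `|transm p d phi x| <= 2 * M.
Proof.
move=> cphi phiM; rewrite transm_clamp.
have [_ /(_ 0%N)] := transm_approx _ _ cphi phiM _ (clamp_itv _ _ x d0).
by rewrite expr0 mulr1 /series/= big_geq// subr0 mulrC.
Qed.

Lemma ct_series phi n : continuous phi -> continuous (fun y => series (fun j => transm_term p j phi y) n).
Proof.
move=> cphi; elim: n => [|n IH].
  rewrite (_ : (fun y => _) = fun=> 0); first by cont.
  by apply/funext => y; rewrite /series/= big_geq.
rewrite (_ : (fun y => _) = fun y => series (fun j => transm_term p j phi y) n + transm_term p n phi y).
  by cont.
by apply/funext => y; rewrite seriesSr.
Qed.

(** Uniform limit of continuous partial sums. *)
Lemma ct_transm phi : continuous phi -> continuous (transm p d phi).
Proof.
move=> cphi x0; have [M M0 phiM] := cont_bounded phi d cphi.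
apply/cvgrPdist_le => e e0.
have e3 : 0 < e / 3 / (M * 2 + 1) by rewrite divr_gt0 ?divr_gt0//; lra.
have half1 : `|2^-1 : R| < 1 by rewrite ger0_norm ?invr_ge0// invf_lt1// ltr1n.
have /cvgrPdist_lt/(_ _ e3)[N _ HN] := @cvg_expr R 2^-1 half1.
have {}HN : M * 2 * 2^-1 ^+ N <= e / 3.
  have := HN N (leqnn _); rewrite /= sub0r normrN ger0_norm ?exprn_ge0 ?invr_ge0//.
  have M1 : 0 < M * 2 + 1 by lra.
  have E0 : 0 < 2^-1 ^+ N :> R by rewrite exprn_gt0// invr_gt0.
  move: E0; set E := 2^-1 ^+ N => E0.
  by rewrite ltr_pdivlMr// => /ltW; apply: le_trans; nra.
have A x : `|transm p d phi x - series (fun j => transm_term p j phi (clamp 0 d x)) N| <= e / 3.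
  rewrite transm_clamp; apply: le_trans HN.
  by have [_] := transm_approx _ _ cphi phiM _ (clamp_itv _ _ x d0).
have cs : continuous (fun x => series (fun j => transm_term p j phi (clamp 0 d x)) N).
  have c1 := ct_series phi N cphi; have c2 := ct_clamp 0 d.
  exact: (ct_comp c1 c2).
have e30 : 0 < e / 3 by rewrite divr_gt0.
have /cvgrPdist_le/(_ _ e30) := cs x0.
apply: filterS => x Hx.
have A0 := A x0; have A1 := A x.
move: A0 A1 Hx; rewrite !ler_distl => /andP[a1 a2] /andP[a3 a4] /andP[a5 a6].
apply/andP; split; lra.
Qed.

Lemma transm_linear phi psi a b x : continuous phi -> continuous psi ->
  transm p d (fun t => a * phi t + b * psi t) x = a * transm p d phi x + b * transm p d psi x.
Proof.
move=> c1 c2; rewrite (transm_clamp _ x) (transm_clamp phi) (transm_clamp psi).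
have xd := clamp_itv 0 d x d0; set y := clamp 0 d x in xd *.
have [M1 _ H1] := cont_bounded phi d c1; have [M2 _ H2] := cont_bounded psi d c2.
have [v1 _] := transm_approx _ _ c1 H1 _ xd; have [v2 _] := transm_approx _ _ c2 H2 _ xd.
rewrite /transm (clamp_id _ _ _ xd); apply/cvg_lim => //.
have -> : series (fun j => transm_term p j (fun t => a * phi t + b * psi t) y) =
  (fun n => a * series (fun j => transm_term p j phi y) n + b * series (fun j => transm_term p j psi y) n).
  apply/funext => n; rewrite /series/= !mulr_sumr -big_split/=.
  by apply: eq_bigr => j _; rewrite transm_term_linear.
by apply: cvgD; apply: cvgM => //; exact: cvg_cst.
Qed.

(** Only the terms of order at least 1 contribute, hence the factor [B * d ^+ 2]. *)
Lemma transm_near_id phi M x : continuous phi -> (forall y, `|y| <= d -> `|phi y| <= M) ->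
  0 <= x <= d -> `|transm p d phi x - phi x| <= M * (4 * (B * d ^+ 2)).
Proof.
move=> cphi phiM /andP[x0 xd].
have M0 : 0 <= M by apply: le_trans (phiM 0 _); rewrite // normr0.
have t0 : 0 <= B * d ^+ 2 by rewrite mulr_ge0 ?bound_ge0// sqr_ge0.
have Hj j : (1 <= j)%N -> `|transm_term p j phi x| <= 4 * (M * (B * d ^+ 2)) * 2^-1 ^+ j.
  case: j => // j _; apply: (@le_trans _ _ (M * (B * d ^+ 2) ^+ j.+1)).
    apply: transm_term_bound; rewrite // ?x0 ?xd// => y yx; apply: phiM; exact: le_trans xd.
  have H : (B * d ^+ 2) ^+ j <= 2^-1 ^+ j.
    by apply: lerXn2r; rewrite ?nnegrE ?invr_ge0//; apply: (le_trans Bd); lra.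
  have e0 : 0 <= (B * d ^+ 2) ^+ j by rewrite exprn_ge0.
  rewrite (exprS (2^-1 : R) j) (exprS (B * d ^+ 2) j); move: H e0; set E := 2^-1 ^+ j; set G := (_ * _) ^+ j => H e0.
  apply: (@le_trans _ _ (M * (B * d ^+ 2) * E)).
    by rewrite mulrA ler_wpM2l// mulr_ge0.
  have : 0 <= M * (B * d ^+ 2) * E by rewrite !mulr_ge0 ?bound_ge0 ?sqr_ge0//; lra.
  have -> : 4 * (M * (B * d ^+ 2)) * (2^-1 * E) = 2 * (M * (B * d ^+ 2) * E) by field.
  by move=> Z0; rewrite ler_peMl// ler1n.
have [_ /(_ 1%N (leqnn _))] := geo_series _ _ _ Hj.
rewrite /transm clamp_id ?x0// {2}/series/= big_nat1/= expr1.
by move/le_trans; apply; rewrite le_eqVlt; apply/orP; left; apply/eqP; field.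
Qed.

(** In derivatives: (T phi)'' = T (phi'' - p phi), with the Cauchy data of [phi]
    kept at 0. The partial sums satisfy it up to one missing term, by
    [transm_term_ode]. *)
Lemma transm_ode A C phi m : continuous m -> (forall x, phi x = A + C * x + J (J m) x) ->
  forall x, 0 <= x <= d ->
  transm p d phi x = A + C * x + J (J (fun y => transm p d m y - transm p d (fun y => p y * phi y) y)) x.
Proof.
move=> cm phiE x /andP[x0 xd].
have cJm := continuous_J _ cm.
have cphi : continuous phi.
  have cJJm := continuous_J _ cJm.
  by rewrite (_ : phi = fun x => A + C * x + J (J m) x); [cont|exact/funext].
have cpphi : continuous (fun y => p y * phi y) by cont.
pose S f N y := series (fun j => transm_term p j f y) N.
have cS f N : continuous f -> continuous (S f N) by exact: ct_series.
have SE N y : S phi N.+1 y = A + C * y + J (J (fun z => S m N.+1 z - S (fun y => p y * phi y) N z)) y.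
  elim: N y => [|N IH] y.
    rewrite /S/= {1}/series/= big_nat1/= phiE; apply: f_equal.
    apply: (f_equal2 (fun f y => J f y)) => //; apply/funext => z; apply: eqJ => w.
    by rewrite /series/= big_nat1 big_geq// subr0.
  have e1 : S phi N.+2 y = S phi N.+1 y + transm_term p N.+1 phi y by rewrite /S seriesSr.
  apply: (etrans e1); apply: (etrans (f_equal2 +%R (IH y) (transm_term_ode p N A C phi m cp cm phiE y))).
  rewrite -addrA; apply: f_equal.
  have c1 := cS m N.+1 cm; have c2 := cS _ N cpphi.
  apply: JJ_addE; [by cont|by cont|move=> w].
  have e2 : S m N.+2 w = S m N.+1 w + transm_term p N.+1 m w := seriesSr _ _.
  have e3 : S (fun y => p y * phi y) N.+1 w = S (fun y => p y * phi y) N w +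
     transm_term p N (fun y => p y * phi y) w := seriesSr _ _.
  by rewrite e2 e3 opprD addrACA.
have [M1 M10 H1] := cont_bounded phi d cphi.
have [M2 M20 H2] := cont_bounded m d cm.
have [M3 M30 H3] := cont_bounded _ d cpphi.
apply/eqP; rewrite -subr_eq0; apply/eqP.
apply: (@small_eq0 _ _ (M1 * 2 + (M2 * 2 + M3 * 2) * d * d)) => N.
have [_ /(_ N.+1) B1] := transm_approx _ _ cphi H1 x (introT andP (conj x0 xd)).
have c1 := cS m N.+1 cm; have c2 := cS _ N cpphi.
have c3 := ct_transm m cm; have c4 := ct_transm _ cpphi.
have B2 : `|J (J (fun y => S m N.+1 y - S (fun y => p y * phi y) N y - (transm p d m y - transm p d (fun y => p y * phi y) y))) x|
    <= (M2 * 2 + M3 * 2) * 2^-1 ^+ N * d * d.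
  apply: JJ_bound; [by cont|by rewrite x0 xd|].
  move=> s /andP[s0 st].
  have sd : 0 <= s <= d by rewrite s0 (le_trans st).
  have [_ /(_ N.+1) C1] := transm_approx _ _ cm H2 s sd.
  have [_ /(_ N) C2] := transm_approx _ _ cpphi H3 s sd.
  move: C1; rewrite exprS => C1.
  have C1' : `|transm p d m s - S m N.+1 s| <= M2 * 2 * 2^-1 ^+ N.
    apply: (le_trans C1); have : 0 <= M2 * 2 * 2^-1 ^+ N by rewrite !mulr_ge0 ?exprn_ge0 ?invr_ge0//.
    set E := 2^-1 ^+ N; set Z := M2 * 2 * E; have -> : M2 * 2 * (2^-1 * E) = Z / 2 by rewrite /Z; field.
    by lra.
  rewrite -/(S _ _ _) in C2.
  by rewrite mulrDl; exact: dist_sub_le.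
rewrite -/(S phi N.+1 x) SE exprS in B1.
have cA : continuous (fun y => S m N.+1 y - S (fun y => p y * phi y) N y) by cont.
have cB : continuous (fun y => transm p d m y - transm p d (fun y => p y * phi y) y) by cont.
rewrite (JJ_subE _ _ x cA cB) in B2.
apply: (le_trans (dist_add_le _ _ _ _ _ _ B1 B2)).
have : 0 <= M1 * 2^-1 ^+ N by rewrite mulr_ge0// exprn_ge0// invr_ge0.
move: (2^-1 ^+ N) => E E0.
have -> : M1 * 2 * (2^-1 * E) + (M2 * 2 + M3 * 2) * E * d * d =
   M1 * E + (M2 * 2 + M3 * 2) * d * d * E by field.
by rewrite -subr_ge0 (_ : _ - _ = M1 * E)//; ring.
Qed.

End Fixed.

(** The factor [F] on the right makes the difference of the two potentials small
    against itself in [local_step]. *)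
Lemma transm_diff p q B d F phi M x : continuous p -> continuous q -> continuous phi ->
  (forall y, `|y| <= d -> `|p y| <= B) -> (forall y, `|y| <= d -> `|q y| <= B) ->
  (forall y, `|y| <= d -> `|p y - q y| <= F) ->
  B * d ^+ 2 <= 4^-1 -> 0 <= d ->
  (forall y, `|y| <= d -> `|phi y| <= M) ->
  `|transm p d phi x - transm q d phi x| <= 8 * (F * d ^+ 2 * M).
Proof.
move=> cp cq cphi pB qB pqF Bd d0 phiM.
rewrite (transm_clamp p d d0 phi x) (transm_clamp q d d0 phi x).
have /andP[x0 xd] := clamp_itv 0 d x d0; move: x0 xd; set y := clamp 0 d x => x0 xd.
have xd' : 0 <= y <= d by rewrite x0.
have [v1 _] := transm_approx p B d cp pB Bd d0 phi M cphi phiM y xd'.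
have [v2 _] := transm_approx q B d cq qB Bd d0 phi M cphi phiM y xd'.
have Hj j : (0 <= j)%N -> `|transm_term p j phi y - transm_term q j phi y| <= 4 * (F * d ^+ 2 * M) * 2^-1 ^+ j.
  move=> _; rewrite mulrAC; apply: (transm_term_diff p q j B d F phi y M) => // z zy.
  by apply: phiM; apply: le_trans xd.
have [_ /(_ 0%N (leqnn _))] := geo_series _ _ _ Hj.
have -> : series (fun j => transm_term p j phi y - transm_term q j phi y) = (fun n => series (fun j => transm_term p j phi y) n - series (fun j => transm_term q j phi y) n).
  by apply/funext => n; rewrite /series/= sumrB.
have -> : limn (fun n => series (fun j => transm_term p j phi y) n - series (fun j => transm_term q j phi y) n) = transm p d phi y - transm q d phi y.
  by rewrite /transm (clamp_id _ _ _ xd'); apply/cvg_lim => //; apply: cvgB.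
rewrite /series/= !big_geq// subrr subr0 expr0 mulr1 => /le_trans; apply.
by rewrite le_eqVlt; apply/orP; left; apply/eqP; ring.
Qed.
End TDef.

Global Opaque transm_term transm.

(** * Functions with slowly growing exponential moments *)

Section Laplace.
Context {R : realType}.
Implicit Types (f g : R -> R) (x y a b M d k s t : R) (n N j : nat).

Lemma ct_expR {S : topologicalType} {f : S -> R} : continuous f -> continuous (fun z => expR (f z)).
Proof. move=> cf; have c : continuous (@expR R) by exact: continuous_expR. exact: (ct_comp c cf). Qed.

Ltac cont_ext ::=
  match goal with
  | |- continuous (fun z => expR (@?f z)) => refine (@ct_expR _ f _)
  | |- continuous (fun z => J (@?F z) (@?b z)) => refine (@ct_J_param _ _ F b _ _)
  end.

(** The remainder of the exponential series at [x] is dominated by the one at [Z],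
    term by term. *)
Lemma exp_rem x (Z : R) N : `|x| <= Z ->
  `|expR x - series (exp_coeff x) N| <= expR Z - series (exp_coeff Z) N.
Proof.
move=> xZ.
have cx := is_cvg_series_exp_coeff x; have cZ := is_cvg_series_exp_coeff Z.
apply: (@ler_cvg_to _ eventually _ _ (fun m => `|series (exp_coeff x) m - series (exp_coeff x) N|)
  (fun m => series (exp_coeff Z) m - series (exp_coeff Z) N)).
- by apply: cvg_norm; apply: cvgB; [exact: cx|exact: cvg_cst].
- by apply: cvgB; [exact: cZ|exact: cvg_cst].
- near=> m.
  have nm : (N <= m)%N by near: m; exists N.
  rewrite !sub_series_geq//; apply: (le_trans (ler_norm_sum _ _ _)).
  apply: ler_sum => j _; rewrite /exp_coeff/= normrM normrX normfV (ger0_norm (ler0n _ _)).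
  by rewrite ler_wpM2r ?invr_ge0// lerXn2r ?nnegrE// (le_trans _ xZ).
Unshelve. all: end_near. Qed.

Lemma exp_series_le x N : 0 <= x -> series (exp_coeff x) N <= expR x.
Proof.
move=> x0; rewrite -subr_ge0; apply: le_trans (exp_rem x x N _); last by rewrite ger0_norm.
exact: normr_ge0.
Qed.

Lemma J_norm_le f h x : continuous f -> continuous h -> 0 <= x ->
  (forall t, 0 <= t <= x -> `|f t| <= h t) -> `|J f x| <= J h x.
Proof.
move=> cf ch x0 fh; rewrite ler_norml -JN//; apply/andP; split; apply: J_le => //.
- by cont.
- by move=> t /fh; rewrite ler_norml => /andP[].
- by move=> t /fh; rewrite ler_norml => /andP[].
Qed.

Lemma J_expR c x : c != 0 -> J (fun y => expR (c * y)) x = (expR (c * x) - 1) / c.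
Proof.
move=> c0; apply/esym.
apply: (@J_unique _ (fun y => expR (c * y)) (fun x => (expR (c * x) - 1) / c)).
- by cont.
- move=> y.
  have D : is_derive y 1 (fun y => expR (c * y)) (expR (c * y) * c).
    apply: (@is_derive1_comp _ expR (fun y => c * y)).
    by have := is_derive_affine c 0 y; under eq_fun do rewrite add0r.
  have D2 := is_deriveZ c^-1 (is_deriveB D (is_derive_cst (1:R) y 1)).
  apply: (is_derive_ext D2).
    by move=> z; rewrite -[LHS]/(c^-1 * (expR (c * z) - 1)) mulrC.
  by rewrite subr0 -[LHS]/(c^-1 * (expR (c * y) * c)); field.
- by rewrite mulr0 expR0 subrr mul0r.
Qed.

Lemma expR_opp_le x : expR (- expR x) <= expR (- x).
Proof.
rewrite ler_expR lerN2; apply: (@le_trans _ _ (1 + x)); first by lra.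
exact: expR_ge1Dx.
Qed.

Lemma expR_opp_ge x : 1 - expR (- expR x) <= expR x.
Proof. by have := expR_ge1Dx (- expR x); lra. Qed.

(** Expanding exp (- exp (k (s - y))) in powers of exp (k (s - y)) writes a
    mollified step as a combination of the exponentials exp (j k (s - y)), j > 0.
    Their integrals against [g] carry a factor exp (- j k t) that beats the assumed
    growth, and the bounds add up to an exponential series again. *)
Lemma Laplace_partial g d k t (C : R) s : continuous g -> 0 < k -> 
  (forall j, (0 < j)%N -> `|J (fun y => expR (j%:R * k * (d - y)) * g y) d| <= C * expR (t / 2 * (j%:R * k))) ->
  s = d - t ->
  forall N, `|J (fun y => (1 - series (exp_coeff (- expR (k * (s - y)))) N.+1) * g y) d|
    <= C * (series (exp_coeff (expR (- (k * t / 2)))) N.+1 - 1).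
Proof.
move=> cg k0 H sE; elim=> [|N IH].
  have e1 (x : R) : series (exp_coeff x) 1%N = 1.
    by rewrite /series/= big_nat1 /exp_coeff/= expr0 fact0 invr1 mulr1.
  rewrite e1 subrr mulr0.
  have -> : (fun y => (1 - series (exp_coeff (- expR (k * (s - y)))) 1%N) * g y) = fun=> 0.
    by apply/funext => y; rewrite e1 subrr mul0r.
  by rewrite J_cst mul0r normr0.
have E z : series (exp_coeff z) N.+2 = series (exp_coeff z) N.+1 + z ^+ N.+1 / (N.+1)`!%:R :> R.
  by rewrite seriesSr.
have cs : continuous (fun y => series (exp_coeff (- expR (k * (s - y)))) N.+1).
  elim: (N.+1) => [|n IHn].
    rewrite (_ : (fun y => _) = fun=> 0); first by cont.
    by apply/funext => y; rewrite /series/= big_geq.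
  rewrite (_ : (fun y => _) = fun y => series (exp_coeff (- expR (k * (s - y)))) n
     + (-1) ^+ n * expR (n%:R * (k * (s - y))) / n`!%:R).
    by cont.
  apply/funext => y; rewrite seriesSr; apply: f_equal; rewrite /exp_coeff/=.
  by rewrite (exprNn (expR _)) expRM_natl.
(* The factor exp (- (N + 1) k t) comes from s = d - t. *)
pose c : R := (-1) ^+ N.+1 / (N.+1)`!%:R * expR (- (N.+1%:R * k * t)).
have -> : J (fun y => (1 - series (exp_coeff (- expR (k * (s - y)))) N.+2) * g y) d =
  J (fun y => (1 - series (exp_coeff (- expR (k * (s - y)))) N.+1) * g y) d
  - c * J (fun y => expR (N.+1%:R * k * (d - y)) * g y) d.
  rewrite -JZ; last by cont.
  rewrite -JB; [|by cont|by cont].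
  apply: eqJ => y; rewrite E (exprNn (expR _)) -expRM_natl.
  have -> : expR (N.+1%:R * (k * (s - y))) = expR (- (N.+1%:R * k * t)) * expR (N.+1%:R * k * (d - y)).
    by rewrite -expRD; apply: f_equal; rewrite sE; ring.
  rewrite /c; field; by rewrite pnatr_eq0 -lt0n fact_gt0.
apply: (le_trans (ler_normB _ _)).
have -> : C * (series (exp_coeff (expR (- (k * t / 2)))) N.+2 - 1) =
  C * (series (exp_coeff (expR (- (k * t / 2)))) N.+1 - 1) + C * (expR (- (k * t / 2)) ^+ N.+1 / (N.+1)`!%:R).
  by rewrite E; ring.
apply: lerD => //.
rewrite normrM /c normrM normrM normrX normrN1 expr1n mul1r normfV (ger0_norm (ler0n _ _)) ger0_norm ?expR_ge0//.
have f0 : 0 < (N.+1)`!%:R :> R by rewrite ltr0n fact_gt0.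
apply: (@le_trans _ _ ((N.+1)`!%:R^-1 * expR (- (N.+1%:R * k * t)) * (C * expR (t / 2 * (N.+1%:R * k))))).
  by apply: ler_wpM2l; [rewrite mulr_ge0 ?invr_ge0 ?expR_ge0|exact: H].
rewrite -expRM_natl.
have -> : expR (N.+1%:R * - (k * t / 2)) = expR (- (N.+1%:R * k * t)) * expR (t / 2 * (N.+1%:R * k)).
  by rewrite -expRD; apply: f_equal; field.
by rewrite le_eqVlt; apply/orP; left; apply/eqP; field; rewrite gt_eqF.
Qed.

(** For fixed [k] the series of [Laplace_partial] converges uniformly on the
    segment. *)
Lemma Laplace_full g d k t (C : R) s : continuous g -> 0 < k -> 0 <= d -> 0 <= C ->
  (forall j, (0 < j)%N -> `|J (fun y => expR (j%:R * k * (d - y)) * g y) d| <= C * expR (t / 2 * (j%:R * k))) ->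
  s = d - t -> 0 <= s ->
  `|J (fun y => (1 - expR (- expR (k * (s - y)))) * g y) d|
    <= C * (expR (expR (- (k * t / 2))) - 1).
Proof.
move=> cg k0 d0 C0 H sE s0.
have [M M0 gM] := cont_bounded g d cg.
set w := expR (- (k * t / 2)).
have w0 : 0 <= w by exact: expR_ge0.
pose Z := expR (k * s).
pose rho N : R := expR Z - series (exp_coeff Z) N.
have rho0 : (fun N => M * d * rho N.+1) @ \oo --> (0 : R).
  rewrite -(mulr0 (M * d)); apply: cvgM; first exact: cvg_cst.
  rewrite -[X in _ --> X](subrr (expR Z)); apply: cvgB; first exact: cvg_cst.
  have cZ := is_cvg_series_exp_coeff Z.
  have : series (exp_coeff Z) @ \oo --> expR Z by exact: cZ.
  by rewrite -(cvg_shiftS (series (exp_coeff Z))).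
have key N : `|J (fun y => (1 - expR (- expR (k * (s - y)))) * g y) d| <=
   C * (expR w - 1) + M * d * rho N.+1.
  have cs : continuous (fun y => series (exp_coeff (- expR (k * (s - y)))) N.+1).
    elim: (N.+1) => [|n IHn].
      rewrite (_ : (fun y => _) = fun=> 0); first by cont.
      by apply/funext => y; rewrite /series/= big_geq.
    rewrite (_ : (fun y => _) = fun y => series (exp_coeff (- expR (k * (s - y)))) n
       + (-1) ^+ n * expR (n%:R * (k * (s - y))) / n`!%:R).
      by cont.
    apply/funext => y; rewrite seriesSr; apply: f_equal; rewrite /exp_coeff/=.
    by rewrite (exprNn (expR _)) expRM_natl.
  have -> : J (fun y => (1 - expR (- expR (k * (s - y)))) * g y) d =
    J (fun y => (1 - series (exp_coeff (- expR (k * (s - y)))) N.+1) * g y) d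
    - J (fun y => (expR (- expR (k * (s - y))) - series (exp_coeff (- expR (k * (s - y)))) N.+1) * g y) d.
    rewrite -JB; [|by cont|by cont].
    by apply: eqJ => y; ring.
  apply: (le_trans (ler_normB _ _)); apply: lerD.
    apply: (le_trans (Laplace_partial g d k t C s cg k0 H sE N)).
    by rewrite ler_wpM2l// lerD2r exp_series_le.
  apply: (@le_trans _ _ (rho N.+1 * M * d)); last first.
    by rewrite le_eqVlt; apply/orP; left; apply/eqP; ring.
  apply: J_bound => //; first by cont.
  move=> y /andP[y0 yd]; rewrite normrM ler_pM//; last by rewrite gM// ger0_norm.
  apply: exp_rem; rewrite normrN ger0_norm ?expR_ge0// ler_expR ler_wpM2l ?gerBl ?(ltW k0)//.
apply: (@ler_cvg_to _ eventually _ _ (fun=> `|J (fun y => (1 - expR (- expR (k * (s - y)))) * g y) d|)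
   (fun N => C * (expR w - 1) + M * d * rho N.+1)).
- exact: cvg_cst.
- rewrite -[X in _ --> X]addr0; apply: cvgD; [exact: cvg_cst|exact: rho0].
- by near=> N; exact: key.
Unshelve. all: end_near. Qed.

(** As [k] grows, 1 - exp (- exp (k (s - y))) tends to the indicator function of y <
    s; the error is at most exp (- k |y - s|), of integral O(1 / k). *)
Lemma step_approx g d k M s : continuous g -> 0 < k -> 0 <= s <= d ->
  (forall y, 0 <= y <= d -> `|g y| <= M) ->
  `|J (fun y => (1 - expR (- expR (k * (s - y)))) * g y) d - J g s| <= 2 * M / k.
Proof.
move=> cg k0 /andP[s0 sd] gM.
have M0 : 0 <= M by apply: le_trans (gM 0 _); rewrite // lexx (le_trans s0).
have kn : k != 0 by rewrite gt_eqF.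
pose th y := (1 - expR (- expR (k * (s - y)))).
have cth : continuous th by rewrite /th; cont.
have -> : J (fun y => th y * g y) d - J g s = J (fun y => (th y - 1) * g y) s +
   J (fun y => th (s + y) * g (s + y)) (d - s).
  have cc : continuous (fun y => th y * g y) by cont.
  rewrite -(J_sub (fun y => th y * g y))// subrKC.
  have -> : J (fun y => (th y - 1) * g y) s = J (fun y => th y * g y) s - J g s.
    by rewrite -JB; [apply: eqJ => y; ring|cont|cont].
  ring.
apply: (le_trans (ler_normD _ _)).
have -> : 2 * M / k = M / k + M / k by field.
apply: lerD.
  apply: (@le_trans _ _ (J (fun y => M * expR (- (k * s)) * expR (k * y)) s)).
    apply: J_norm_le => //; [by cont|by cont|].
    move=> y /andP[y0 ys]; rewrite normrM mulrC -mulrA -expRD; apply: ler_pM => //.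
      by apply: gM; rewrite y0 (le_trans ys).
    rewrite /th addrC addrA addNr add0r normrN ger0_norm ?expR_ge0//.
    apply: (le_trans (expR_opp_le _)); rewrite ler_expR; lra.
  rewrite JZ; last by cont.
  rewrite J_expR// -mulrA ler_wpM2l// mulrA ler_pdivrMr// mulVf//.
  rewrite mulrBr -expRD addNr expR0 mulr1; have := expR_ge0 (- (k * s)); lra.
apply: (@le_trans _ _ (J (fun y => M * expR (- k * y)) (d - s))).
  apply: J_norm_le => //; [by cont|by cont|by lra|].
  move=> y /andP[y0 ys]; rewrite normrM mulrC; apply: ler_pM => //.
    by apply: gM; apply/andP; split; lra.
  have e1 : expR (- expR (k * (s - (s + y)))) <= 1.
    by rewrite -[leRHS]expR0 ler_expR oppr_le0 expR_ge0.
  rewrite /th ger0_norm; last by lra.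
  apply: (le_trans (expR_opp_ge _)); rewrite ler_expR; lra.
rewrite JZ; last by cont.
rewrite J_expR ?oppr_eq0// ler_wpM2l//.
rewrite invrN mulrN -mulNr opprB ler_pdivrMr// mulVf//.
Qed.

Lemma J_eq0 g d : continuous g -> (forall x, 0 < x < d -> J g x = 0) ->
  forall x, 0 < x < d -> g x = 0.
Proof.
move=> cg Jg0 x /andP[x0 xd].
have D : is_derive x 1 (J g) (g x) by exact: is_derive_J.
have D0 : is_derive x 1 (J g) 0.
  apply: (@near_eq_is_derive _ _ _ (fun=> 0)).
  near=> y; rewrite Jg0//; apply/andP; split; near: y.
    exact: lt_nbhsr.
  exact: lt_nbhsl.
by have := @derive_val _ _ _ _ _ _ _ D; rewrite (@derive_val _ _ _ _ _ _ _ D0).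
Unshelve. all: end_near. Qed.

Lemma expR_ge_pow x n : 0 <= x -> x ^+ n <= n`!%:R * expR x.
Proof.
move=> x0; have := exp_series_le x n.+1 x0.
have f0 : 0 < n`!%:R :> R by rewrite ltr0n fact_gt0.
rewrite mulrC -ler_pdivrMr//; apply: le_trans.
rewrite seriesSr lerDr /series/= sumr_ge0// => j _.
by rewrite exp_coeff_ge0.
Qed.

Lemma closure_le f d K : continuous f -> 0 < d -> (forall x, 0 < x < d -> `|f x| <= K) ->
  forall x, 0 <= x <= d -> `|f x| <= K.
Proof.
move=> cf d0 H x /andP[x0 xd]; rewrite leNgt; apply/negP => Kf.
have e0 : 0 < `|f x| - K by rewrite subr_gt0.
have /cvgrPdist_lt/(_ _ e0)/nbhs_ballP[r /= r0 Hr] := ct_norm cf x.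
pose s := Num.min 1 (r / d).
have s0 : 0 < s by rewrite lt_min ltr01 divr_gt0.
have s1 : s <= 1 by rewrite ge_min lexx.
have sr : s * d <= r by rewrite -ler_pdivlMr// ge_min lexx orbT.
pose y := x + s * (d / 2 - x).
have yy : 0 < y < d by rewrite /y; apply/andP; split; nra.
have xy : `|x - y| < r.
  have sd : s * d > 0 by rewrite mulr_gt0.
  rewrite /y opprD addrA subrr sub0r normrN ltr_norml; apply/andP; split; nra.
have := Hr y xy; rewrite /= ltr_norml => /andP[_].
by have := H y yy; lra.
Qed.

(** Growth slower than every exponential leaves no room for the part of [g] near 0,
    which the weight amplifies most. The proof is real: the primitive of [g] at [s]
    is the limit of the integrals of [g] against mollified steps, and these are
    controlled by [Laplace_full]. *)
Lemma Laplace_unique g d k0 : continuous g -> 0 < d -> 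
  (forall e, 0 < e -> exists C, forall k, (k0 : R) <= k ->
     `|J (fun y => expR (k * (d - y)) * g y) d| <= C * expR (e * k)) ->
  forall x, 0 < x < d -> g x = 0.
Proof.
move=> cg d0 H.
have [M M0 gM] := cont_bounded g d cg.
have Jg0 s : 0 < s < d -> J g s = 0.
  move=> /andP[s0 sd].
  pose t := d - s.
  have t0 : 0 < t by rewrite subr_gt0.
  have [C HC] := H (t / 2) ltac:(lra).
  pose C1 := Num.max C 0.
  have C10 : 0 <= C1 by rewrite le_max lexx orbT.
  have CC1 : C <= C1 by rewrite le_max lexx.
  pose m := Num.max k0 1.
  have m1 : 1 <= m by rewrite le_max lexx orbT.
  have mk0 : k0 <= m by rewrite le_max lexx.
  have sE : s = d - t by rewrite /t; ring.
  have B k : m <= k -> `|J g s| <= C1 * (expR (expR (- (k * t / 2))) - 1) + 2 * M / k.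
    move=> mk.
    have k_gt0 : 0 < k by lra.
    have kk0 j : (0 < j)%N -> k0 <= j%:R * k.
      move=> j0; have j1 : 1 <= j%:R :> R by rewrite ler1n.
      apply: (@le_trans _ _ k); first by lra.
      by rewrite ler_peMl// ltW.
    have F : `|J (fun y => (1 - expR (- expR (k * (s - y)))) * g y) d| <= C1 * (expR (expR (- (k * t / 2))) - 1).
      apply: (Laplace_full g d k t C1 s) => //; [exact: ltW| |exact: ltW].
      move=> j j0; apply: (le_trans (HC _ (kk0 j j0))).
      by rewrite ler_wpM2r ?expR_ge0.
    have sd' : 0 <= s <= d by rewrite !ltW.
    have gM' y : 0 <= y <= d -> `|g y| <= M.
      by move=> /andP[y0 yd]; apply: gM; rewrite ger0_norm.
    have S := step_approx g d k M s cg k_gt0 sd' gM'.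
    rewrite -[J g s](subKr (J (fun y => (1 - expR (- expR (k * (s - y)))) * g y) d)).
    by apply: (le_trans (ler_normB _ _)); apply: lerD.
  apply/eqP; rewrite -normr_le0 leNgt; apply/negP => z0.
  move: z0 B; move: (`|J g s|) => z z0 B.
  pose K : R := C1 * (4 / t) + 2 * M.
  have K0 : 0 <= K.
    by apply: addr_ge0; apply: mulr_ge0 => //; apply: divr_ge0 => //; exact: ltW.
  (* The second bound makes w at most 1/2, hence exp w - 1 <= 2 w; the third
     contradicts the positivity of z. *)
  pose k := Num.max m (Num.max (4 / t) ((K + 1) / z)).
  have mk : m <= k by rewrite le_max lexx.
  have tk : 4 / t <= k by rewrite !le_max lexx orbT.
  have zk : (K + 1) / z <= k by rewrite !le_max lexx !orbT.
  have k_gt0 : 0 < k by lra.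
  have := B k mk; apply/negP; rewrite -ltNge.
  have kt : 4 <= k * t by rewrite -ler_pdivrMr.
  have w2 : expR (- (k * t / 2)) <= 2 / (k * t).
    rewrite expRN -[leRHS]invf_div lef_pV2 ?posrE ?expR_gt0 ?divr_gt0 ?mulr_gt0//.
    by apply: le_trans (expR_ge1Dx _); lra.
  have w1 : expR (- (k * t / 2)) <= 2^-1.
    by apply: (le_trans w2); rewrite ler_pdivrMr ?mulr_gt0//; lra.
  have w0 := expR_gt0 (- (k * t / 2)).
  set w := expR (- (k * t / 2)) in w0 w1 w2 *.
  have ew : expR w - 1 <= 2 * w.
    have := expR_ge1Dx (- w); rewrite expRN => h1.
    have e0 := expR_gt0 w.
    have : (1 - w) * expR w <= 1 by rewrite -ler_pdivlMr// div1r.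
    have : 1 <= expR w by rewrite -[leLHS]expR0 ler_expR ltW.
    by nra.
  apply: (@le_lt_trans _ _ (K / k)).
    have -> : K / k = C1 * (4 / t / k) + 2 * M / k by rewrite /K; ring.
    rewrite lerD2r ler_wpM2l//; apply: (le_trans ew).
    rewrite (_ : 4 / t / k = 2 * (2 / (k * t))); first by lra.
    by field; rewrite gt_eqF//= gt_eqF.
  rewrite ltr_pdivrMr//; rewrite ler_pdivrMr// in zk.
  by rewrite mulrC; lra.
move=> x /andP[x0 xd].
by apply: (J_eq0 g d) => //; rewrite x0.
Qed.

End Laplace.

Ltac cont_ext ::=
  match goal with
  | |- continuous (fun z => expR (@?f z)) => refine (@ct_expR _ _ f _)
  | |- continuous (fun z => J (@?F z) (@?b z)) => refine (@ct_J_param _ _ F b _ _)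
  | |- continuous (fun z => window (@?h z) (@?F z) (@?b z)) =>
    refine (@ct_window _ _ (fun w => F (fst w) (snd w)) h b _ _ _)
  | |- continuous (fun z => transm_term ?p ?n (@?F z) (@?b z)) =>
    refine (@ct_transm_term_param _ p n _ (fun w => F (fst w) (snd w)) b _ _ _)
  end.

(** * One local step *)

Section Local.
Context {R : realType}.

(** By linearity and [transm_bound]: the operator does not see values outside [-d,
    d]. *)
Lemma transm_local_eq (p : R -> R) (B d : R) (phi psi : R -> R) (x : R) :
  continuous p -> (forall y, `|y| <= d -> `|p y| <= B) -> B * d ^+ 2 <= 4^-1 -> 0 <= d ->
  continuous phi -> continuous psi -> (forall y, `|y| <= d -> phi y = psi y) ->
  transm p d phi x = transm p d psi x.
Proof.
move=> cp pB Bd d0 cphi cpsi E; apply/eqP; rewrite -subr_eq0 -normr_le0.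
have -> : transm p d phi x - transm p d psi x = transm p d (fun t => 1 * phi t + (-1) * psi t) x.
  by rewrite (transm_linear p B d)// mul1r mulN1r.
rewrite -(mulr0 (2 : R)); apply: (transm_bound p B d) => //; first by cont.
by move=> y yd; rewrite E// mul1r mulN1r subrr normr0.
Qed.

(** Transmutation moves the potential out of the equation of the profile: it stays
    only in the source [transm p d a] and in a remainder of the same size as the
    given one. *)
Lemma transm_profile (p a v rho : R -> R) (B d A C k eta : R) :
  continuous p -> (forall y, `|y| <= d -> `|p y| <= B) -> B * d ^+ 2 <= 4^-1 -> 0 <= d ->
  continuous a -> continuous v -> continuous rho ->
  (forall x, `|x| <= d -> `|rho x| <= eta) ->
  (forall x, `|x| <= d ->
    v x = A + C * x + J (J (fun y => (k ^+ 2 + p y) * v y - k ^+ 2 * a y)) x + rho x) ->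
  exists2 r : R -> R, continuous r /\ (forall x, 0 <= x <= d -> `|r x| <= 3 * eta) &
  forall x, 0 <= x <= d -> transm p d v x = A + C * x +
    J (J (fun y => k ^+ 2 * (transm p d v y - transm p d a y))) x + r x.
Proof.
move=> cp pB Bd d0 ca cv crho rhoB vE.
have cT f : continuous f -> continuous (transm p d f) by exact: (ct_transm p B d).
have TLx := transm_linear p B d cp pB Bd d0.
pose m y := (k ^+ 2 + p y) * v y - k ^+ 2 * a y.
have cm : continuous m by rewrite /m; cont.
pose phi x := A + C * x + J (J m) x.
have cJm := continuous_J _ cm; have cJJm := continuous_J _ cJm.
have cphi : continuous phi by rewrite /phi; cont.
have cTv := cT _ cv; have cTa := cT _ ca; have cTr := cT _ crho.
have cTpr : continuous (transm p d (fun y => p y * rho y)) by apply: cT; cont.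
have eta0 : 0 <= eta by apply: le_trans (rhoB 0 _); rewrite // normr0.
exists (fun x => J (J (transm p d (fun y => p y * rho y))) x + transm p d rho x).
  split; first by apply: ct_add; [exact: (continuous_J _ (continuous_J _ cTpr))|exact: cTr].
  move=> x xd.
  have B0 : 0 <= B by apply: le_trans (pB 0 _); rewrite // normr0.
  have b1 : `|transm p d rho x| <= 2 * eta by exact: (transm_bound p B d).
  have b2 : `|J (J (transm p d (fun y => p y * rho y))) x| <= (2 * (B * eta)) * d * d.
    apply: JJ_bound => // t _; apply: (transm_bound p B d) => //; first by cont.
    by move=> y yd; rewrite normrM ler_pM// ?pB ?rhoB.
  apply: (le_trans (ler_normD _ _)); apply: (le_trans (lerD b2 b1)).
  have -> : 2 * (B * eta) * d * d = (B * d ^+ 2) * (2 * eta) by ring.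
  have : (B * d ^+ 2) * (2 * eta) <= 4^-1 * (2 * eta) by rewrite ler_wpM2r// mulr_ge0.
  by lra.
move=> x xd.
have vphi y : transm p d v y = transm p d phi y + transm p d rho y.
  rewrite -[transm p d phi y]mul1r -[transm p d rho y]mul1r -TLx//.
  apply: (transm_local_eq p B d) => //; first by cont.
  by move=> z zd; rewrite vE// !mul1r.
rewrite vphi addrA; apply: (f_equal2 +%R) => //.
apply: (etrans (transm_ode p B d cp pB Bd d0 A C phi m cm (fun=> erefl) x xd)).
rewrite -[RHS]addrA; apply: f_equal.
have cTva : continuous (fun y => k ^+ 2 * (transm p d v y - transm p d a y)) by cont.
apply: (etrans _ (esym (JJ_addE _ _ (fun y => k ^+ 2 * (transm p d v y - transm p d a y) + transm p d (fun y => p y * rho y) y) x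
  cTva cTpr (fun=> erefl)))).
apply: eqJ => w; apply: eqJ => y.
rewrite -[transm p d m y]mul1r -[X in _ - X]mul1r -mulNr -TLx//; last by cont.
have -> : k ^+ 2 * (transm p d v y - transm p d a y) + transm p d (fun y => p y * rho y) y =
  1 * transm p d (fun t => k ^+ 2 * v t + (- k ^+ 2) * a t) y + 1 * transm p d (fun y => p y * rho y) y.
  by rewrite TLx//; ring.
rewrite -TLx//; [|by cont|by cont].
apply: (transm_local_eq p B d) => //; [by cont|by cont|].
move=> z zd; rewrite /m.
have -> : phi z = v z - rho z by rewrite vE// /phi -/m addrK.
ring.
Qed.

(** The weight exp (k (d - y)) solves the homogeneous equation, so pairing it with
    Z'' = k^2 (Z - g) leaves the boundary terms Z'(d) + k Z(d), where Z'(d) is k^2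
    times the integral of Z - g. None of them grows exponentially. *)
Lemma cauchy_zero (Z g r : R -> R) (d k : R) : continuous Z -> continuous g -> continuous r ->
  k != 0 -> 0 <= d ->
  (forall x, 0 <= x <= d -> Z x = J (J (fun y => k ^+ 2 * (Z y - g y))) x + r x) ->
  J (fun y => expR (k * (d - y)) * g y) d =
  J (fun y => expR (k * (d - y)) * r y) d - J (fun y => Z y - g y) d - (Z d - r d) / k.
Proof.
move=> cZ cg cr k0 d0 ZE.
pose h y := k ^+ 2 * (Z y - g y).
have ch : continuous h by rewrite /h; cont.
have cJh := continuous_J _ ch; have cJJh := continuous_J _ cJh.
pose u x := expR (k * (d - x)) * (J h x + k * J (J h) x).
pose u' x := expR (k * (d - x)) * (h x - k ^+ 2 * J (J h) x).
have cu' : continuous u' by rewrite /u'; cont.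
have du (x : R) : is_derive x 1 u (u' x).
  have D1 : is_derive x 1 (fun x => expR (k * (d - x))) (expR (k * (d - x)) * - k).
    apply: (@is_derive1_comp _ expR (fun x => k * (d - x))).
    apply: (is_derive_ext (is_derive_affine (- k) (k * d) x)) => //.
    by move=> z; ring.
  have D2 : is_derive x 1 (fun x => J h x + k * J (J h) x) (h x + k * J h x).
    apply: is_deriveD; first exact: is_derive_J.
    by apply: is_deriveZ; exact: is_derive_J.
  apply: (is_derive_ext (is_deriveM D1 D2)) => //.
  rewrite /u' -![_ *: _]/(_ * _); ring.
have E := @J_unique _ u' (fun x => u x - u 0) cu'.
have {}E : u d - u 0 = J u' d.
  apply: E; last by rewrite subrr.
  by move=> x; rewrite -[u' x]subr0; apply: is_deriveB.
have u0 : u 0 = 0 by rewrite /u !J0 mulr0 addr0 mulr0.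
have ud : u d = J h d + k * J (J h) d by rewrite /u subrr mulr0 expR0 mul1r.
have JhE : J h d = k ^+ 2 * J (fun y => Z y - g y) d by rewrite JZ//; cont.
have JJhE : J (J h) d = Z d - r d.
  have := ZE d; rewrite lexx d0 => /(_ isT) ->; by rewrite addrK.
have u'E : J u' d = k ^+ 2 * (J (fun y => expR (k * (d - y)) * r y) d - J (fun y => expR (k * (d - y)) * g y) d).
  rewrite -JB; [|by cont|by cont].
  rewrite -JZ; last by cont.
  apply: eq_J_ge0 => // t td; rewrite /u'.
  have -> : J (J h) t = Z t - r t by rewrite ZE// addrK.
  by rewrite /h; ring.
move: E; rewrite u0 subr0 ud JhE JJhE u'E => E.
have k2 : k ^+ 2 != 0 by rewrite expf_neq0.
apply: (mulfI k2).
set X := J (fun y => expR (k * (d - y)) * g y) d in E *.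
set Y := J (fun y => expR (k * (d - y)) * r y) d in E *.
set W := J (fun y => Z y - g y) d in E *.
have -> : k ^+ 2 * (Y - W - (Z d - r d) / k) = k ^+ 2 * Y - (k ^+ 2 * W + k * (Z d - r d)) by field.
by rewrite E; ring.
Qed.

(** The Cauchy problem v'' = (k^2 + p) v - k^2 a with data [A], [C] at 0, in
    integrated form since the remainder [rho] is merely continuous. *)
Definition ode_data (p a v rho : R -> R) (A C k d eta : R) :=
  [/\ continuous v, continuous rho,
   (forall x, `|x| <= d -> `|rho x| <= eta) &
   (forall x, `|x| <= d ->
    v x = A + C * x + J (J (fun y => (k ^+ 2 + p y) * v y - k ^+ 2 * a y)) x + rho x)].

(** With equal Cauchy data the two transmuted profiles differ by a [Z] to which
    [cauchy_zero] applies, with g = T_p a - T_q a. Polynomial growth in [k] and the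
    remainder exp (- d k), which compensates the weight, bound the weighted integral
    of [g] by a multiple of exp (e k) for every e > 0. *)
Lemma transform_init_eq (p q a : R -> R) (B d k0 K : R) (N : nat) :
  continuous p -> continuous q -> continuous a ->
  (forall y, `|y| <= d -> `|p y| <= B) -> (forall y, `|y| <= d -> `|q y| <= B) ->
  B * d ^+ 2 <= 4^-1 -> 0 < d ->
  (forall k, k0 <= k -> exists v w rho sig, exists A C : R,
     [/\ ode_data p a v rho A C k d (expR (- (d * k))),
         ode_data q a w sig A C k d (expR (- (d * k))) &
         forall x, `|x| <= d -> `|v x| <= K * k ^+ N /\ `|w x| <= K * k ^+ N]) ->
  forall x, 0 < x < d -> transm p d a x = transm q d a x.
Proof.
move=> cp cq ca pB qB Bd d0 H.
have dd0 := ltW d0.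
pose g x := transm p d a x - transm q d a x.
have cTa1 := ct_transm p B d cp pB Bd dd0 a ca.
have cTa2 := ct_transm q B d cq qB Bd dd0 a ca.
have cg : continuous g by rewrite /g; cont.
have [G G0 gG] := cont_bounded g d cg.
have [H0 H00 aH0] := cont_bounded a d ca.
suff S : forall x, 0 < x < d -> g x = 0.
  by move=> x /S /eqP; rewrite subr_eq0 => /eqP.
apply: (@Laplace_unique _ g d (Num.max k0 1) cg d0) => e e0.
pose K' := Num.max K 0.
have K'0 : 0 <= K' by rewrite le_max lexx orbT.
have KK' : K <= K' by rewrite le_max lexx.
(* The three summands answer to the remainder, the mean of Z - g and the boundary term
   in [cauchy_zero]; k^N is bounded by N! / e^N times exp (e k). *)
exists (6 * d + d * (4 * (K' * (N`!%:R / e ^+ N)) + G) + (4 * (K' * (N`!%:R / e ^+ N)) + 6)).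
move=> k; rewrite ge_max => /andP[kk0 k1].
have k_gt0 : 0 < k by lra.
have [v [w [rho [sig [A [C [[cv cr rB vE] [cw cs sB wE] vwB]]]]]]] := H k kk0.
set eta := expR (- (d * k)) in rB sB.
have eta0 : 0 <= eta by exact: expR_ge0.
have eta1 : eta <= 1 by rewrite /eta -[leRHS]expR0 ler_expR oppr_le0 mulr_ge0// ltW.
have [r1 [cr1 r1B] z1E] := transm_profile p a v rho B d A C k eta cp pB Bd dd0 ca cv cr rB vE.
have [r2 [cr2 r2B] z2E] := transm_profile q a w sig B d A C k eta cq qB Bd dd0 ca cw cs sB wE.
have cTv := ct_transm p B d cp pB Bd dd0 v cv.
have cTw := ct_transm q B d cq qB Bd dd0 w cw.
pose Z x := transm p d v x - transm q d w x.
pose r x := r1 x - r2 x.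
have cZ : continuous Z by rewrite /Z; cont.
have cr' : continuous r by rewrite /r; cont.
have rB' x : 0 <= x <= d -> `|r x| <= 6 * eta.
  move=> xd; apply: (le_trans (ler_normB _ _)); have := r1B x xd; have := r2B x xd; lra.
have ZB x : 0 <= x <= d -> `|Z x| <= 4 * (K' * k ^+ N).
  move=> xd; apply: (le_trans (ler_normB _ _)).
  have kN : 0 <= k ^+ N by rewrite exprn_ge0// ltW.
  have h1 : `|transm p d v x| <= 2 * (K' * k ^+ N).
    apply: (transm_bound p B d) => // y yd; have [h _] := vwB y yd.
    by apply: (le_trans h); rewrite ler_wpM2r.
  have h2 : `|transm q d w x| <= 2 * (K' * k ^+ N).
    apply: (transm_bound q B d) => // y yd; have [_ h] := vwB y yd.
    by apply: (le_trans h); rewrite ler_wpM2r.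
  by lra.
have ZE x : 0 <= x <= d -> Z x = J (J (fun y => k ^+ 2 * (Z y - g y))) x + r x.
  move=> xd; rewrite /Z z1E// z2E//.
  have -> : J (J (fun y => k ^+ 2 * (Z y - g y))) x =
    J (J (fun y => k ^+ 2 * (transm p d v y - transm p d a y))) x - J (J (fun y => k ^+ 2 * (transm q d w y - transm q d a y))) x.
    rewrite -JJ_subE; [|by cont|by cont].
    by apply: eqJ => s; apply: eqJ => t; rewrite /Z /g; ring.
  rewrite /r; move: (J (J _) x) (J (J _) x) => X1 X2; lra.
rewrite (cauchy_zero Z g r d k cZ cg cr' _ dd0 ZE) ?gt_eqF//.
have kN : k ^+ N <= (N`!%:R / e ^+ N) * expR (e * k).
  have ek0 : 0 <= e * k by apply: mulr_ge0; exact: ltW.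
  have := expR_ge_pow (e * k) N ek0.
  have eN : 0 < e ^+ N by rewrite exprn_gt0.
  by rewrite exprMn mulrC -ler_pdivlMr// mulrAC.
have ek1 : 1 <= expR (e * k).
  by rewrite -[leLHS]expR0 ler_expR; apply: mulr_ge0; exact: ltW.
set X := N`!%:R / e ^+ N in kN *.
set E := expR (e * k) in kN ek1 *.
have KX : K' * k ^+ N <= K' * X * E by rewrite -mulrA ler_wpM2l.
have KN0 : 0 <= K' * k ^+ N by rewrite mulr_ge0// exprn_ge0// ltW.
have b1 : `|J (fun y => expR (k * (d - y)) * r y) d| <= 6 * d * E.
  apply: (@le_trans _ _ (6 * d)); last by rewrite ler_peMr// mulr_ge0.
  apply: J_bound => //; first by cont.
  move=> t /andP[t0 td]; rewrite normrM ger0_norm ?expR_ge0//.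
  apply: (@le_trans _ _ (expR (k * (d - t)) * (6 * eta))).
    by apply: ler_wpM2l; [exact: expR_ge0|apply: rB'; rewrite t0].
  rewrite mulrCA -[leRHS]mulr1 ler_wpM2l// /eta -expRD -expR0 ler_expR.
  have : 0 <= k * t by rewrite mulr_ge0// ltW.
  by lra.
have b2 : `|J (fun y => Z y - g y) d| <= d * (4 * (K' * X) + G) * E.
  apply: (@le_trans _ _ ((4 * (K' * k ^+ N) + G) * d)).
    apply: J_bound => //; first by cont.
    move=> t td; apply: (le_trans (ler_normB _ _)); apply: lerD; first exact: ZB.
    by apply: gG; case/andP: td => t0 td; rewrite ger0_norm.
  rewrite mulrC -[leRHS]mulrA; apply: ler_wpM2l => //.
  rewrite [leRHS]mulrDl; apply: lerD; first by rewrite -mulrA ler_wpM2l.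
  by rewrite ler_peMr.
have b3 : `|(Z d - r d) / k| <= (4 * (K' * X) + 6) * E.
  rewrite normrM normfV (ger0_norm (ltW k_gt0)) ler_pdivrMr//.
  apply: (@le_trans _ _ (4 * (K' * k ^+ N) + 6 * eta)).
    have ddd : 0 <= d <= d by rewrite lexx dd0.
    by apply: (le_trans (ler_normB _ _)); apply: lerD; [exact: ZB|exact: rB'].
  apply: (@le_trans _ _ ((4 * (K' * X) + 6) * E)).
    rewrite [leRHS]mulrDl; apply: lerD; first by rewrite -mulrA ler_wpM2l.
    by rewrite ler_wpM2l// (le_trans eta1).
  have KX0 : 0 <= K' * X by rewrite mulr_ge0// divr_ge0// exprn_ge0// ltW.
  rewrite ler_peMr// mulr_ge0 ?expR_ge0//; apply: addr_ge0 => //; exact: mulr_ge0.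
apply: (le_trans (ler_normB _ _)); rewrite [leRHS]mulrDl; apply: lerD => //; rewrite [leRHS]mulrDl.
by apply: (le_trans (ler_normB _ _)); apply: lerD.
Qed.

(** Two derivatives of T_p a = T_q a give T_p (a'' - p a) = T_q (a'' - q a), that is
    T_p (f a) = (T_p - T_q) (a'' - q a) with f = p - q. The left side is f a up to
    an error of order d^2 sup |f|, by [transm_near_id], and the right side is itself
    of that order, by [transm_diff]. As [a] is at least [am], sup |f| <= sup |f| /
    2. *)
Lemma local_step (p q a a2 : R -> R) (a0 a1 B d Ma Mb am : R) :
  continuous p -> continuous q -> continuous a2 ->
  (forall x, a x = a0 + a1 * x + J (J a2) x) ->
  (forall y, `|y| <= d -> `|p y| <= B) -> (forall y, `|y| <= d -> `|q y| <= B) ->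
  (forall y, `|y| <= d -> `|a y| <= Ma) ->
  (forall y, `|y| <= d -> `|a2 y - q y * a y| <= Mb) ->
  (forall y, 0 <= y <= d -> am <= `|a y|) -> 0 < am ->
  (forall y, - d <= y <= 0 -> p y = q y) ->
  B * d ^+ 2 <= 4^-1 -> 0 < d ->
  (4 * B * Ma + 8 * Mb) * d ^+ 2 <= am / 2 ->
  (forall x, 0 < x < d -> transm p d a x = transm q d a x) ->
  forall x, 0 <= x <= d -> p x = q x.
Proof.
move=> cp cq ca2 aE pB qB aMa bMb aam am0 pq Bd d0 small TE.
have dd0 := ltW d0.
have cJa2 := continuous_J _ ca2; have cJJa2 := continuous_J _ cJa2.
have ca : continuous a.
  by rewrite (_ : a = fun x => a0 + a1 * x + J (J a2) x); [cont|exact/funext].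
pose f x := p x - q x.
have cf : continuous f by rewrite /f; cont.
have cTp g : continuous g -> continuous (transm p d g) by exact: (ct_transm p B d).
have cTq g : continuous g -> continuous (transm q d g) by exact: (ct_transm q B d).
have TLp := transm_linear p B d cp pB Bd dd0.
pose b y := a2 y - q y * a y.
have cb : continuous b by rewrite /b; cont.
pose h y := (transm p d a2 y - transm p d (fun y => p y * a y) y) - (transm q d a2 y - transm q d (fun y => q y * a y) y).
have c1 := cTp _ ca2; have c2 := cTq _ ca2.
have c3 : continuous (transm p d (fun y => p y * a y)) by apply: cTp; cont.
have c4 : continuous (transm q d (fun y => q y * a y)) by apply: cTq; cont.
have ch : continuous h by rewrite /h; cont.
have h0 : forall x, 0 < x < d -> h x = 0.
  apply: J_eq0 => //; apply: J_eq0 => //; first by cont.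
  move=> x /[dup] xd /TE; case/andP: xd => x0 xd.
  have xd' : 0 <= x <= d by rewrite !ltW.
  have ep := transm_ode p B d cp pB Bd dd0 a0 a1 a a2 ca2 aE x xd'.
  have eq := transm_ode q B d cq qB Bd dd0 a0 a1 a a2 ca2 aE x xd'.
  move=> E; have /addrI {}E := etrans (etrans (esym ep) E) eq.
  have k1 : continuous (fun y => transm p d a2 y - transm p d (fun y => p y * a y) y) by cont.
  have k2 : continuous (fun y => transm q d a2 y - transm q d (fun y => q y * a y) y) by cont.
  apply: (etrans (JJ_subE _ _ x k1 k2)).
  by apply/eqP; rewrite subr_eq0; apply/eqP.
have TLq := transm_linear q B d cq qB Bd dd0.
have key x : 0 < x < d -> transm p d (fun y => f y * a y) x = transm p d b x - transm q d b x.
  move=> /h0; rewrite /h => E.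
  have cfa : continuous (fun y => f y * a y) by cont.
  have cpa : continuous (fun y => p y * a y) by cont.
  have cqa : continuous (fun y => q y * a y) by cont.
  have e1 : transm p d (fun y => f y * a y) x + 1 * transm p d (fun y => 1 * a2 y + (-1) * (p y * a y)) x = transm p d b x.
    rewrite -[transm p d (fun y => f y * a y) x]mul1r -TLp//; last by cont.
    apply: (transm_local_eq p B d) => //; first by cont.
    by move=> z _; rewrite /f /b; ring.
  have e2 : transm q d b x = transm q d a2 x - transm q d (fun y => q y * a y) x.
    rewrite -[transm q d a2 x]mul1r -[X in _ - X]mul1r -mulNr -TLq//.
    apply: (transm_local_eq q B d) => //; first by cont.
    by move=> z _; rewrite /b; ring.
  rewrite TLp// mul1r mulN1r mul1r in e1.
  by rewrite -e1 e2; lra.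
have [F0 F00 fF0] := cont_bounded f d cf.
have dd : - d <= d by lra.
have cn : {within `[- d, d], continuous (fun x => `|f x|)}.
  by apply: continuous_subspaceT; exact: ct_norm.
have [c cd Hc] := EVT_max dd cn.
set F := `|f c| in Hc.
have fF y : `|y| <= d -> `|f y| <= F.
  by move=> yd; apply: Hc; rewrite in_itv/= -ler_norml.
have Ma0 : 0 <= Ma by apply: le_trans (aMa 0 _); rewrite // normr0.
have F0' : 0 <= F by rewrite /F.
have fB x : 0 < x < d -> `|f x| <= F / 2.
  move=> /[dup] xd /andP[x0 xd'].
  have x0d : 0 <= x <= d by rewrite !ltW.
  have b1 : `|transm p d (fun y => f y * a y) x - f x * a x| <= F * Ma * (4 * (B * d ^+ 2)).
    apply: (transm_near_id p B d) => //; first by cont.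
    by move=> y yd; rewrite normrM ler_pM// ?fF ?aMa.
  have b2 : `|transm p d b x - transm q d b x| <= 8 * (F * d ^+ 2 * Mb) by exact: (transm_diff p q B d F).
  rewrite key// in b1.
  have b3 : `|f x * a x| <= F * Ma * (4 * (B * d ^+ 2)) + 8 * (F * d ^+ 2 * Mb).
    rewrite -[f x * a x](subKr (transm p d b x - transm q d b x)) (le_trans (ler_normB _ _))//.
    by rewrite addrC; exact: lerD.
  have b4 : F * Ma * (4 * (B * d ^+ 2)) + 8 * (F * d ^+ 2 * Mb) <= F * (am / 2).
    have -> : F * Ma * (4 * (B * d ^+ 2)) + 8 * (F * d ^+ 2 * Mb) = F * ((4 * B * Ma + 8 * Mb) * d ^+ 2) by ring.
    by rewrite ler_wpM2l.
  have := le_trans b3 b4; rewrite normrM => b5.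
  have b6 : `|f x| * am <= `|f x| * `|a x| by rewrite ler_wpM2l// aam.
  rewrite -(ler_pM2r am0); apply: (le_trans b6); apply: (le_trans b5); lra.
have fB' : forall x, 0 <= x <= d -> `|f x| <= F / 2 by exact: closure_le.
have fN x : - d <= x <= 0 -> f x = 0 by move=> /pq E; rewrite /f E subrr.
have : F <= F / 2.
  move: cd; rewrite in_itv/= => /andP[c1' c2'].
  have [c0|c0] := leP 0 c; first by apply: fB'; rewrite c0.
  by rewrite {1}/F fN ?normr0 ?divr_ge0// c1' ltW.
move=> FF; have F00' : F = 0 by lra.
move=> x /andP[x0 xd]; have := fF x; rewrite ger0_norm// => /(_ xd).
by rewrite F00' normr_le0 subr_eq0 => /eqP.
Qed.

End Local.

(** * Continuation along the interval *)

Section Reduced.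
Context {R : realType}.

Lemma JJ_shift (f : R -> R) (c y : R) : continuous f ->
  J (J f) (c + y) = J (J f) c + J f c * y + J (J (fun t => f (c + t))) y.
Proof.
move=> cf; have cJf := continuous_J _ cf.
have E := J_sub (J f) c y cJf.
have -> : J (J f) (c + y) = J (J f) c + J (fun t => J f (c + t)) y by rewrite -E; ring.
rewrite -[RHS]addrA; apply: f_equal.
have cs : continuous (fun t => f (c + t)) by cont.
rewrite -J_cst -JD; [|by cont|exact: continuous_J].
by apply: eqJ => t; rewrite -J_sub//; ring.
Qed.

(** Integration gains the factor [lam] in the norm weighted by exp (- lam x). *)
Lemma J_exp_bound (f : R -> R) (M lam x : R) : continuous f -> 0 < lam -> 0 <= x ->
  (forall t, 0 <= t <= x -> `|f t| <= M * expR (lam * t)) ->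
  `|J f x| <= M / lam * expR (lam * x).
Proof.
move=> cf lam0 x0 fM.
have M0 : 0 <= M.
  have := fM 0; rewrite lexx x0 mulr0 expR0 mulr1 => /(_ isT); exact: le_trans.
apply: (@le_trans _ _ (J (fun t => M * expR (lam * t)) x)).
  by apply: J_norm_le => //; cont.
rewrite JZ; last by cont.
rewrite J_expR ?gt_eqF// -[leRHS]mulrA ler_wpM2l// mulrC ler_wpM2l ?invr_ge0 ?(ltW lam0)//.
by lra.
Qed.

(** In the norm weighted by exp (- 2 k x) two integrations gain (2 k)^2, which
    against the bound 2 k^2 on [h] makes the double primitive a contraction of ratio
    1/2. *)
Lemma gronwall (h Y r : R -> R) (c k eta : R) : continuous h -> continuous Y ->
  0 <= c -> 0 < k -> (forall x, 0 <= x <= c -> `|h x| <= 2 * k ^+ 2) ->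
  (forall x, 0 <= x <= c -> `|r x| <= eta) ->
  (forall x, 0 <= x <= c -> Y x = J (J (fun y => h y * Y y)) x + r x) ->
  forall x, 0 <= x <= c -> `|Y x| <= 2 * eta * expR (2 * k * x).
Proof.
move=> ch cY c0 k0 hk rB YE.
have k20 : 0 < 2 * k by lra.
pose G x := `|Y x| * expR (- (2 * k * x)).
have cG : continuous G.
  have cn := ct_norm cY.
  by rewrite /G; cont.
have [xs xsc Hs] := EVT_max c0 (continuous_subspaceT cG : {within `[0, c], continuous G}).
move: xsc; rewrite in_itv/= => xsc.
have GE x : `|Y x| = G x * expR (2 * k * x).
  by rewrite /G -mulrA -expRD addNr expR0 mulr1.
have GB x : 0 <= x <= c -> `|Y x| <= G xs * expR (2 * k * x).
  by move=> xc; rewrite GE ler_wpM2r ?expR_ge0// Hs// in_itv.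
have G0 : 0 <= G xs by rewrite /G mulr_ge0 ?expR_ge0.
have eta0 : 0 <= eta by apply: le_trans (rB 0 _); rewrite // lexx.
suff GS : G xs <= 2 * eta.
  by move=> x xc; apply: (le_trans (GB x xc)); rewrite ler_wpM2r ?expR_ge0.
have chY : continuous (fun y => h y * Y y) by cont.
have B1 : `|J (J (fun y => h y * Y y)) xs| <=
    (2 * k ^+ 2 * G xs) / (2 * k) / (2 * k) * expR (2 * k * xs).
  case/andP: (xsc) => xs0 xsc'.
  apply: J_exp_bound => //; first exact: continuous_J.
  move=> t /andP[t0 tx]; apply: J_exp_bound => //.
  move=> s /andP[s0 st]; have sc : 0 <= s <= c by rewrite s0 (le_trans st)// (le_trans tx).
  by rewrite normrM -mulrA ler_pM ?hk ?GB.
have e0 := expR_gt0 (2 * k * xs).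
have := YE xs xsc => YE'.
have := GE xs; rewrite YE' => E.
have B2 : G xs * expR (2 * k * xs) <= 2^-1 * (G xs * expR (2 * k * xs)) + eta.
  rewrite -[leLHS]E; apply: (le_trans (ler_normD _ _)); apply: lerD; last exact: rB.
  apply: (le_trans B1); rewrite le_eqVlt; apply/orP; left; apply/eqP.
  by field; rewrite gt_eqF.
have e1 : 1 <= expR (2 * k * xs).
  rewrite -[leLHS]expR0 ler_expR mulr_ge0 ?(ltW k20)//; by case/andP: xsc.
have B3 : G xs * expR (2 * k * xs) <= 2 * eta by lra.
apply: le_trans B3; by rewrite ler_peMr.
Qed.

(** The rate [4 * l * k] of the remainders is chosen to survive the loss exp (2 k c)
    of [gronwall] and polynomial factors when the origin is moved. *)
Definition ode_pair (p q a : R -> R) (l k K : R) (N : nat) :=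
  exists v w rho sig : R -> R, exists A C : R,
  [/\ [/\ continuous v, continuous w, continuous rho & continuous sig],
      forall x, 0 <= x <= l ->
        v x = A + C * x + J (J (fun y => (k ^+ 2 + p y) * v y - k ^+ 2 * a y)) x + rho x,
      forall x, 0 <= x <= l ->
        w x = A + C * x + J (J (fun y => (k ^+ 2 + q y) * w y - k ^+ 2 * a y)) x + sig x,
      forall x, 0 <= x <= l -> `|rho x| <= expR (- (4 * l * k)) /\ `|sig x| <= expR (- (4 * l * k)) &
      forall x, 0 <= x <= l -> `|v x| <= K * k ^+ N /\ `|w x| <= K * k ^+ N].

(** The new Cauchy data are the values at [c] of the double primitive and of its
    derivative. *)
Lemma recentre (m v rho : R -> R) (A C c l x : R) : continuous m ->
  (forall x, 0 <= x <= l -> v x = A + C * x + J (J m) x + rho x) ->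
  0 <= c + x <= l ->
  v (c + x) = (A + C * c + J (J m) c) + (C + J m c) * x
    + J (J (fun y => m (c + y))) x + rho (c + x).
Proof.
move=> cm vE xl; apply: (etrans (vE _ xl)).
apply: (etrans (f_equal2 +%R (f_equal2 +%R erefl (JJ_shift m c x cm)) erefl)).
move: (J (J m) c) (J m c) (J (J (fun t => m (c + t))) x) => X1 X2 X3; ring.
Qed.

(** On [0, c] both profiles solve the same equation, so [gronwall] makes their
    Cauchy data at [c] almost equal. The first profile keeps its own data, the
    second one takes them too and absorbs the difference in its remainder. *)
Lemma ode_pair_local (p q a : R -> R) (B c d l k K : R) (N : nat) :
  continuous p -> continuous q -> continuous a ->
  (forall y, `|y| <= l -> `|p y| <= B) ->
  0 < d -> d <= c -> c + d <= l -> B <= k ^+ 2 -> 0 < k -> 102 <= l * k ->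
  (forall x, 0 <= x <= c -> p x = q x) ->
  ode_pair p q a l k K N ->
  exists v w rho sig : R -> R, exists A C : R,
     [/\ ode_data (fun x => p (c + x)) (fun x => a (c + x)) v rho A C k d (expR (- (d * k))),
         ode_data (fun x => q (c + x)) (fun x => a (c + x)) w sig A C k d (expR (- (d * k))) &
         forall x, `|x| <= d -> `|v x| <= K * k ^+ N /\ `|w x| <= K * k ^+ N].
Proof.
move=> cp cq ca pB d0 dc cdl Bk k0 lk pq [v [w [rho [sig [A [C [[cv cw cr cs] vE wE rsB vwB]]]]]]].
have l0 : 0 < l by lra.
have k2 : 0 <= k ^+ 2 by rewrite sqr_ge0.
set eta := expR (- (4 * l * k)) in rsB.
have eta0 : 0 <= eta by exact: expR_ge0.
have itv x : `|x| <= d -> 0 <= c + x <= l.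
  by rewrite ler_norml => /andP[x1 x2]; apply/andP; split; lra.
have c0 : 0 <= c by lra.
pose Y x := v x - w x.
have cY : continuous Y by rewrite /Y; cont.
pose mv y := (k ^+ 2 + p y) * v y - k ^+ 2 * a y.
pose mw y := (k ^+ 2 + q y) * w y - k ^+ 2 * a y.
have cmv : continuous mv by rewrite /mv; cont.
have cmw : continuous mw by rewrite /mw; cont.
have hk x : 0 <= x <= c -> `|k ^+ 2 + p x| <= 2 * k ^+ 2.
  move=> /andP[x0 xc]; apply: (le_trans (ler_normD _ _)); rewrite (ger0_norm k2).
  have := pB x; rewrite ger0_norm// => /(_ ltac:(lra)); lra.
have mE x : 0 <= x <= c -> mv x - mw x = (k ^+ 2 + p x) * Y x.
  by move=> xc; rewrite /mv /mw -(pq x xc) /Y; ring.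
have YE x : 0 <= x <= c -> Y x = J (J (fun y => (k ^+ 2 + p y) * Y y)) x + (rho x - sig x).
  move=> /andP[x0 xc].
  have xl : 0 <= x <= l by apply/andP; split; lra.
  have -> : J (J (fun y => (k ^+ 2 + p y) * Y y)) x = J (J mv) x - J (J mw) x.
    apply: (etrans _ (JJ_subE mv mw x cmv cmw)); apply: eq_J_ge0 => // t /andP[t0 tx]; apply: eq_J_ge0 => // s /andP[s0 st].
    by rewrite mE// s0/=; lra.
  rewrite {1}/Y vE// wE// -/mv -/mw; move: (J (J mv) x) (J (J mw) x) => X1 X2; ring.
have rB x : 0 <= x <= c -> `|rho x - sig x| <= 2 * eta.
  move=> /andP[x0 xc]; have [|r1 r2] := rsB x; first by apply/andP; split; lra.
  by apply: (le_trans (ler_normB _ _)); lra.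
have ch : continuous (fun x => k ^+ 2 + p x) by cont.
have YB := gronwall _ Y _ c k (2 * eta) ch cY c0 k0 hk rB YE.
pose Z := 2 * k ^+ 2 * (4 * eta * expR (2 * k * c)).
have mB x : 0 <= x <= c -> `|mw x - mv x| <= Z.
  move=> xc; rewrite distrC mE// normrM /Z ler_pM ?hk//.
  apply: (le_trans (YB x xc)); rewrite mulrA (_ : 2 * 2 = 4 :> R); last by ring.
  rewrite ler_wpM2l ?mulr_ge0// ler_expR ler_wpM2l//; first by lra.
  by case/andP: xc.
pose dA := J (J mw) c - J (J mv) c.
pose dC := J mw c - J mv c.
have dAB : `|dA| <= Z * c * c.
  rewrite /dA -JJ_subE//; apply: JJ_bound => //; [by cont|by rewrite c0 lexx].
have dCB : `|dC| <= Z * c.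
  by rewrite /dC -JB//; apply: J_bound => //; cont.
have etad : eta <= expR (- (d * k)).
  by rewrite /eta ler_expR lerN2; apply: ler_wpM2r; lra.
exists (fun x => v (c + x)), (fun x => w (c + x)), (fun x => rho (c + x)),
  (fun x => sig (c + x) + dA + dC * x), (A + C * c + J (J mv) c), (C + J mv c).
split.
- split; [by cont|by cont| |].
  + by move=> x /itv xl; have [r1 _] := rsB _ xl; exact: le_trans etad.
  + by move=> x /itv xl; exact: (recentre mv v rho A C c l x).
- split; [by cont|by cont| |].
  + move=> x xd; have xl := itv x xd; have [_ r2] := rsB _ xl.
    have Z0 : 0 <= Z by rewrite /Z; apply: mulr_ge0; [exact: mulr_ge0|apply: mulr_ge0; [exact: mulr_ge0|exact: expR_ge0]].
    apply: (@le_trans _ _ (eta + Z * c * c + Z * c * d)).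
      apply: (le_trans (ler_normD _ _)); apply: lerD.
        by apply: (le_trans (ler_normD _ _)); exact: lerD.
      by rewrite normrM ler_pM.
    have lk0 : 0 <= l * k by lra.
    have Zb : Z <= 8 * k ^+ 2 * expR (- (2 * l * k)).
      rewrite /Z /eta; set e := expR (- (4 * l * k)).
      have -> : 2 * k ^+ 2 * (4 * e * expR (2 * k * c)) = 8 * k ^+ 2 * (e * expR (2 * k * c)) by ring.
      apply: ler_wpM2l; first exact: mulr_ge0.
      rewrite /e -expRD ler_expR.
      have : c * k <= l * k by rewrite ler_wpM2r ?(ltW k0)//; lra.
      by lra.
    have cl : c <= l by lra.
    have cdl2 : c * c + c * d <= 2 * l ^+ 2 by nra.
    have b1 : Z * c * c + Z * c * d <= 16 * (l * k) ^+ 2 * expR (- (2 * l * k)).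
      have -> : Z * c * c + Z * c * d = Z * (c * c + c * d) by ring.
      have -> : 16 * (l * k) ^+ 2 * expR (- (2 * l * k)) = (8 * k ^+ 2 * expR (- (2 * l * k))) * (2 * l ^+ 2) by ring.
      by apply: ler_pM => //; nra.
    have b2 : eta <= expR (- (2 * l * k)) by rewrite /eta ler_expR; lra.
    (* Since exp z >= z^3 / 6, it suffices that z >= 6 * (1 + 16) = 102. *)
    have b3 : 1 + 16 * (l * k) ^+ 2 <= expR (l * k).
      have := expR_ge_pow (l * k) 3 lk0; rewrite (_ : 3`! = 6)//.
      have h2 : 1 <= (l * k) ^+ 2 by rewrite exprn_ege1//; lra.
      have h3 : 102 * (l * k) ^+ 2 <= (l * k) ^+ 3 by rewrite (exprS _ 2) ler_wpM2r// sqr_ge0.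
      by lra.
    have e2 := expR_ge0 (- (2 * l * k)).
    rewrite -addrA; apply: (@le_trans _ _ ((1 + 16 * (l * k) ^+ 2) * expR (- (2 * l * k)))).
      by rewrite mulrDl mul1r; exact: lerD.
    apply: (@le_trans _ _ (expR (l * k) * expR (- (2 * l * k)))).
      by rewrite ler_wpM2r.
    rewrite -expRD ler_expR.
    have : d * k <= l * k by rewrite ler_wpM2r ?(ltW k0)//; lra.
    by lra.
  + move=> x /itv xl; apply: (etrans (recentre mw w sig A C c l x cmw wE xl)).
    rewrite /dA /dC; move: (J (J _) x) (J (J mv) c) (J (J mw) c) (J mv c) (J mw c) => X1 X2 X3 X4 X5; ring.
- by move=> x /itv xl; exact: vwB.
Qed.

(** Moving the origin to [c] makes the potentials agree on [- d, 0], the side where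
    [local_step] needs it, and leaves [0, d] as the unknown part. *)
Lemma extend_agreement (p q a a2 : R -> R) (a0 a1 B c d l k0 K Ma Mb am : R) (N : nat) :
  continuous p -> continuous q -> continuous a2 ->
  (forall x, a x = a0 + a1 * x + J (J a2) x) ->
  (forall y, `|y| <= l -> `|p y| <= B) -> (forall y, `|y| <= l -> `|q y| <= B) ->
  (forall y, `|y| <= l -> `|a y| <= Ma) ->
  (forall y, `|y| <= l -> `|a2 y - q y * a y| <= Mb) ->
  0 < am -> (forall y, 0 <= y <= l -> am <= `|a y|) ->
  0 < d -> d <= c -> d <= l - c ->
  B * d ^+ 2 <= 4^-1 -> (4 * B * Ma + 8 * Mb) * d ^+ 2 <= am / 2 ->
  (forall x, 0 <= x <= c -> p x = q x) ->
  (forall k, k0 <= k -> ode_pair p q a l k K N) ->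
  forall x, 0 <= x <= c + d -> p x = q x.
Proof.
move=> cp cq ca2 aE pB qB aMa bMb am0 aam d0 dc dlc Bd Dd pqc H.
have ca : continuous a.
  have cJa2 := continuous_J _ ca2; have cJJa2 := continuous_J _ cJa2.
  by rewrite (_ : a = fun x => a0 + a1 * x + J (J a2) x); [cont|exact/funext].
have [l0 cdl] : 0 < l /\ c + d <= l by split; lra.
have B0 : 0 <= B by apply: le_trans (pB 0 _); rewrite // normr0 ltW.
pose sh (f : R -> R) x := f (c + x).
have csh f : continuous f -> continuous (sh f) by move=> ?; rewrite /sh; cont.
have itv y : - d <= y <= d -> 0 <= c + y <= l.
  by move=> /andP[y1 y2]; apply/andP; split; lra.
have yl y : `|y| <= d -> `|c + y| <= l.
  by rewrite ler_norml => /itv/andP[y1 y2]; rewrite ger0_norm.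
have TE : forall x, 0 < x < d -> transm (sh p) d (sh a) x = transm (sh q) d (sh a) x.
  apply: (@transform_init_eq _ (sh p) (sh q) (sh a) B d
     (* B + 1 <= k gives B <= k^2, and 102 <= l k is the threshold of [ode_pair_local]. *)
     (Num.max k0 (Num.max (B + 1) (102 / l))) K N).
  - exact: csh.
  - exact: csh.
  - exact: csh.
  - by move=> y /yl; exact: pB.
  - by move=> y /yl; exact: qB.
  - exact: Bd.
  - exact: d0.
  - move=> k; rewrite !ge_max => /andP[kk0 /andP[kB kl]].
    have k1 : 1 <= k by clear -B0 kB; lra.
    have kp : 0 < k by clear -k1; lra.
    have Bk : B <= k ^+ 2 by clear -B0 kB k1; nra.
    have lk : 102 <= l * k by rewrite mulrC -ler_pdivrMr.
    exact: (ode_pair_local p q a B c d l k K N cp cq ca pB d0 dc cdl Bk kp lk pqc (H k kk0)).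
have pqd : forall x, 0 <= x <= d -> sh p x = sh q x.
  apply: (local_step (sh p) (sh q) (sh a) (sh a2)
    (a0 + a1 * c + J (J a2) c) (a1 + J a2 c) B d Ma Mb am (csh _ cp) (csh _ cq) (csh _ ca2)).
  - move=> y; rewrite /sh aE JJ_shift//.
    by move: (J (J a2) c) (J a2 c) (J _ y) => X1 X2 X3; ring.
  - by move=> y /yl; exact: pB.
  - by move=> y /yl; exact: qB.
  - by move=> y /yl; exact: aMa.
  - by move=> y /yl; exact: bMb.
  - move=> y /andP[y0 yd]; apply: aam; apply: itv; apply/andP; split => //.
    by clear -d0 y0; lra.
  - exact: am0.
  - move=> y /andP[y1 y2]; apply: pqc; have /itv/andP[y3 _] : - d <= y <= d.
      by rewrite y1; clear -d0 y2; lra.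
    by rewrite y3 gerDl.
  - exact: Bd.
  - exact: d0.
  - exact: Dd.
  - exact: TE.
move=> x /andP[x0 xcd]; have [xc|cx] := leP x c; first by apply: pqc; rewrite x0.
have := pqd (x - c); rewrite /sh subrKC => -> //.
by clear -cx xcd; apply/andP; split; lra.
Qed.

(** The supremum [c] of the points up to which the potentials agree is positive, and
    by [extend_agreement] it cannot be smaller than [l]. *)
Lemma reduced_unique (p q a a2 : R -> R) (a0 a1 l k0 K eps0 : R) (N : nat) :
  continuous p -> continuous q -> continuous a2 ->
  (forall x, a x = a0 + a1 * x + J (J a2) x) ->
  0 < eps0 < l -> (forall x, 0 <= x <= eps0 -> p x = q x) ->
  (forall x, 0 <= x <= l -> a x != 0) ->
  (forall k, k0 <= k -> ode_pair p q a l k K N) ->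
  forall x, 0 <= x <= l -> p x = q x.
Proof.
move=> cp cq ca2 aE /andP[eps00 eps0l] pqe a_neq0 H.
have l0 : 0 < l by lra.
have cJa2 := continuous_J _ ca2; have cJJa2 := continuous_J _ cJa2.
have ca : continuous a.
  by rewrite (_ : a = fun x => a0 + a1 * x + J (J a2) x); [cont|exact/funext].
pose E := [set c : R | 0 <= c <= l /\ forall x, 0 <= x <= c -> p x = q x].
have Ee : E eps0 by split=> //; rewrite !ltW.
have hsE : has_sup E.
  by split; [exists eps0|exists l => c [/andP[]]].
pose c := sup E.
have ec : eps0 <= c by apply: sup_upper_bound.
have cl : c <= l by apply: sup_le_ub; [exists eps0|move=> x [/andP[]]].
have pqc' x : 0 < x < c -> p x = q x.
  move=> /andP[x0 xc].
  have cx0 : 0 < c - x by rewrite subr_gt0.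
  have [e [_ Ee'] xe] := sup_adherent cx0 hsE.
  by apply: Ee'; rewrite (ltW x0)/=; apply: ltW; move: xe; rewrite -/c; lra.
have cf : continuous (fun x => p x - q x) by cont.
have pqc x : 0 <= x <= c -> p x = q x.
  move=> xc.
  have : `|p x - q x| <= 0.
    apply: (closure_le (fun x => p x - q x) c 0 cf) => //; first by lra.
    by move=> y yc; rewrite pqc'// subrr normr0.
  by rewrite normr_le0 subr_eq0 => /eqP.
have [lc|cl'] := leP l c.
  by move=> x /andP[x0 xl]; apply: pqc; rewrite x0 (le_trans xl).
exfalso.
have cub x : E x -> x <= c by exact: sup_upper_bound.
clearbody c.
have [B1 B10 pB] := cont_bounded p l cp.
have [B2 B20 qB] := cont_bounded q l cq.
pose B := B1 + B2.
have {}pB y : `|y| <= l -> `|p y| <= B by move=> /pB; rewrite /B; lra.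
have {}qB y : `|y| <= l -> `|q y| <= B by move=> /qB; rewrite /B; lra.
have B0 : 0 <= B by rewrite /B; lra.
clearbody B; clear B1 B2 B10 B20.
have [Ma Ma0 aMa] := cont_bounded a l ca.
have cb : continuous (fun y => a2 y - q y * a y) by cont.
have [Mb Mb0 bMb] := cont_bounded _ l cb.
have cn : {within `[0, l], continuous (fun x => `|a x|)}.
  by apply: continuous_subspaceT; exact: ct_norm.
have [xm xml Hm] := EVT_min (ltW l0) cn.
pose am := `|a xm|.
have am0 : 0 < am by rewrite normr_gt0; apply: a_neq0; move: xml; rewrite in_itv.
have aam y : 0 <= y <= l -> am <= `|a y| by move=> yl; apply: Hm; rewrite in_itv.
clearbody am; clear xml Hm cn xm.
pose D := 4 * B * Ma + 8 * Mb.
have D0 : 0 <= D by rewrite /D addr_ge0 ?mulr_ge0.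
(* The first two bounds keep [c - d, c + d] in [0, l]; d <= 1 bounds d^2 by d, and the
   last two then give B d^2 <= 1/4 and D d^2 <= am / 2. *)
pose d := Num.min (Num.min c (l - c)) (Num.min 1 (Num.min (4 * (B + 1))^-1 (am / (2 * (D + 1))))).
have [dc dlc d1 dB dD] : [/\ d <= c, d <= l - c, d <= 1, d <= (4 * (B + 1))^-1 &
    d <= am / (2 * (D + 1))].
  by split; rewrite /d ?ge_min ?lexx ?orbT.
have d0 : 0 < d.
  rewrite /d !lt_min; do ! (apply/andP; split); rewrite ?invr_gt0 ?divr_gt0//; lra.
clearbody d.
have d2 : d ^+ 2 <= d by rewrite expr2 ler_piMr// ltW.
have Bd : B * d ^+ 2 <= 4^-1.
  apply: (@le_trans _ _ (B * (4 * (B + 1))^-1)).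
    by rewrite ler_wpM2l// (le_trans d2).
  by rewrite ler_pdivrMr; lra.
have Dd : D * d ^+ 2 <= am / 2.
  apply: (@le_trans _ _ (D * (am / (2 * (D + 1))))).
    by rewrite ler_wpM2l// (le_trans d2).
  rewrite mulrA ler_pdivrMr; last by lra.
  by rewrite (_ : am / 2 * (2 * (D + 1)) = am * (D + 1)); [lra|field].
rewrite /D in Dd; clear D D0 dD.
suff : c + d <= c by rewrite gerDl leNgt d0.
apply: cub; split; first by apply/andP; split; lra.
exact: (extend_agreement p q a a2 a0 a1 B c d l k0 K Ma Mb am N).
Qed.

End Reduced.

(** * Smooth functions and bumps *)

Section Smooth.
Context {R : realType}.
Implicit Types (f g phi : R -> R) (n m k : nat).

(** Carrying the derivatives as witnesses turns closure under sums, products and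
    substitutions into structural inductions. The base case asks for derivability,
    so the index [n] stands for n + 1 derivatives. *)
Fixpoint derivable_upto n f : Prop :=
  if n is n'.+1 then exists2 g, (forall x, is_derive x (1 : R) f (g x)) & derivable_upto n' g
  else forall x : R, derivable f x 1.

Definition smooth f := forall n, derivable_upto n f.

Lemma derivable_upto_ext n f g : f =1 g -> derivable_upto n f -> derivable_upto n g.
Proof. by move=> /funext ->. Qed.

Lemma derivable_uptoW n f : derivable_upto n.+1 f -> derivable_upto n f.
Proof.
elim: n f => [|n IH] f [g fg].
  by move=> _ x; have [] := fg x.
by move=> /IH Dg; exists g.
Qed.

Lemma derivable_upto_cst n (c : R) : derivable_upto n (fun=> c).
Proof.
elim: n c => [|n IH] c /=; first by move=> x; exact: derivable_cst.
by exists (fun=> 0) => // x; exact: is_derive_cst.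
Qed.

Lemma derivable_upto_add n f g : derivable_upto n f -> derivable_upto n g -> derivable_upto n (fun x => f x + g x).
Proof.
elim: n f g => [|n IH] f g /=; first by move=> df dg x; apply: derivableD.
move=> [f' ff' Df] [g' gg' Dg]; exists (fun x => f' x + g' x); last exact: IH.
by move=> x; apply: is_deriveD.
Qed.

Lemma derivable_upto_mul n f g : derivable_upto n f -> derivable_upto n g -> derivable_upto n (fun x => f x * g x).
Proof.
elim: n f g => [|n IH] f g; first by move=> /= df dg x; apply: derivableM.
move=> Df Dg; have Df1 := derivable_uptoW _ _ Df; have Dg1 := derivable_uptoW _ _ Dg.
case: Df => f' ff' Df; case: Dg => g' gg' Dg.
exists (fun x => f x * g' x + g x * f' x); last first.
  by apply: derivable_upto_add; apply: IH.
move=> x; apply: (is_derive_ext (is_deriveM (ff' x) (gg' x))) => //.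
Qed.

Lemma derivable_upto_affine n f (c d : R) : derivable_upto n f -> derivable_upto n (fun x => f (d + c * x)).
Proof.
elim: n f => [|n IH] f /=.
  move=> df x; have D := is_derive_affine c d x.
  by have [] := @is_derive1_comp _ f (fun y => d + c * y) x _ _ (derivableP (df (d + c * x))) D.
move=> [g fg Dg]; exists (fun x => g (d + c * x) * c).
  move=> x; apply: (@is_derive1_comp _ f (fun x => d + c * x)) => //.
  exact: is_derive_affine.
by apply: derivable_upto_mul; [exact: IH|exact: derivable_upto_cst].
Qed.

Lemma derivable_upto_derive1n n k f : (k <= n)%N -> derivable_upto n f -> forall x, derivable (derive1n k f) x 1.
Proof.
elim: n k f => [|n IH] k f.
  by rewrite leqn0 => /eqP ->.
case: k => [_ Df x|k].
  by case: Df => g fg _; have [] := fg x.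
rewrite ltnS => kn [g fg Dg]; rewrite derive1Sn.
have -> : f^`()%classic = g.
  by apply/funext => x; rewrite derive1E; exact: derive_val.
exact: IH.
Qed.

Lemma smooth_derivable f : smooth f -> forall k x, derivable (derive1n k f) x 1.
Proof. by move=> sf k; apply: (derivable_upto_derive1n k). Qed.

Lemma smooth_continuous f : smooth f -> continuous f.
Proof.
by move=> sf x; apply: differentiable_continuous; apply/derivable1_diffP; exact: (sf 0%N).
Qed.

Lemma derive1n_upto n f : (forall k x, derivable (derive1n k f) x 1) -> derivable_upto n f.
Proof.
elim: n f => [|n IH] f df; first exact: (df 0%N).
exists (f^`()%classic).
  by move=> x; rewrite derive1E; apply: derivableP; exact: (df 0%N).
by apply: IH => k x; rewrite -derive1Sn.
Qed.

Lemma test_smooth b phi : test_function b phi -> smooth phi.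
Proof. by move=> [H _] n; exact: derive1n_upto. Qed.

Lemma smooth_deriv f : smooth f -> smooth (f^`()%classic).
Proof.
move=> sf n; have [g fg Dg] := sf n.+1.
have -> : f^`()%classic = g => //.
by apply/funext => x; rewrite derive1E; exact: derive_val.
Qed.

Lemma smooth_J f : smooth f -> smooth (J f).
Proof.
move=> sf; have cf := smooth_continuous _ sf; case=> [|n].
  by move=> x; have [] := is_derive_J f x cf.
by exists f; [move=> x; exact: is_derive_J|exact: sf].
Qed.

(** The classical function exp (- 1 / x) extended by 0. The powers of 1 / x are
    included because differentiation only raises them, which makes smoothness an
    induction. *)
Definition flat m (x : R) : R := if 0 < x then x ^- m * expR (- x^-1) else 0.

Lemma flat_bound m (x : R) : `|flat m x| <= (m.+2)`!%:R * `|x| ^+ 2.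
Proof.
rewrite /flat; case: ifPn => [x0|_]; last by rewrite normr0 mulr_ge0// exprn_ge0.
rewrite ger0_norm ?mulr_ge0 ?invr_ge0 ?exprn_ge0 ?expR_ge0 ?(ltW x0)// (gtr0_norm x0).
have x1 : 0 <= x^-1 by rewrite invr_ge0 ltW.
have := expR_ge_pow x^-1 m.+2 x1; rewrite expRN -ler_pdivrMr ?expR_gt0//.
rewrite -addn2 exprD exprVn => H.
rewrite -ler_pdivrMr ?exprn_gt0// -exprVn.
by move: H; rewrite addn2 !exprVn; apply: le_trans; rewrite mulrAC.
Qed.

Lemma is_derive_flat m (x : R) : is_derive x 1 (flat m) (flat m.+2 x - m%:R * flat m.+1 x).
Proof.
have [x0|x0|x0] := ltrgtP 0 x.
- have D1 : is_derive x 1 (fun y : R => y ^- m * expR (- y^-1)) (flat m.+2 x - m%:R * flat m.+1 x).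
    have xn : x != 0 by rewrite gt_eqF.
    have Dinv : is_derive x 1 (fun y : R => y^-1) (- x ^- 2).
      by apply: is_derive_eq; first exact: is_deriveV; rewrite -[_ *: _]/(_ * _) mulr1.
    have De : is_derive x 1 (fun y : R => expR (- y^-1)) (expR (- x^-1) * - (- x ^- 2)).
      by apply: (@is_derive1_comp _ expR (fun y => - y^-1)); apply: is_deriveN.
    have Dm : is_derive x 1 (fun y : R => (y^-1) ^+ m) (m%:R * x^-1 ^+ m.-1 * (- x ^- 2)).
      have EX k (y : R) : ((@GRing.inv R : R -> R) ^+ k) y = y^-1 ^+ k.
        by elim: k => // k IH; rewrite exprS [in RHS]exprS -IH.
      apply: (is_derive_ext (is_deriveX m Dinv)); first by move=> y; exact: EX.
      by rewrite -[_ *: _]/(_ * _) mulr_natl.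
    apply: (is_derive_ext (is_deriveM Dm De)).
      by move=> y /=; rewrite -[LHS]/(_ * _) exprVn.
    rewrite /flat x0 -![_ *: _]/(_ * _) !exprVn.
    case: m {Dm} => [|m]; first by rewrite !mul0r subr0 expr0; field.
    rewrite /= -!exprVn !exprS; move: (x^-1) (x^-1 ^+ m) (expR _) => y z w; ring.
  apply: near_eq_is_derive D1; near=> y; rewrite /flat ifT//; near: y; exact: lt_nbhsr.
- have -> : flat m.+2 x - m%:R * flat m.+1 x = 0.
    by rewrite /flat ltNge (ltW x0)/= mulr0 subr0.
  apply: (@near_eq_is_derive _ _ _ (fun=> 0)).
    near=> y; rewrite /flat ifF//; apply/negbTE; rewrite -leNgt ltW//; near: y; exact: lt_nbhsl.
- have -> : flat m.+2 x - m%:R * flat m.+1 x = 0.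
    by rewrite /flat -x0 ltxx mulr0 subr0.
  apply: is_derive_remainder => e e0; rewrite -x0.
  have f0 : 0 < (m.+2)`!%:R :> R by rewrite ltr0n fact_gt0.
  exists (e / (m.+2)`!%:R) => [|h hr]; first by rewrite divr_gt0.
  have -> : flat m 0 = 0 by rewrite /flat ltxx.
  rewrite add0r subr0 mul0r subr0; apply: (le_trans (flat_bound m h)).
  rewrite expr2 mulrA ler_wpM2r//.
  by rewrite mulrC -ler_pdivlMr// ltW.
Unshelve. all: end_near. Qed.

Lemma smooth_flat m : smooth (flat m).
Proof.
move=> n; elim: n m => [|n IH] m; first by move=> x; have [] := is_derive_flat m x.
exists (fun x => flat m.+2 x + (- m%:R) * flat m.+1 x).
  by move=> x; rewrite mulNr; exact: is_derive_flat.
by apply: derivable_upto_add => //; apply: derivable_upto_mul => //; exact: derivable_upto_cst.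
Qed.

(** Smooth approximations of the indicator function of ]x1, x2[ from below, for
    large [n]; identities tested against them pass to integrals over intervals. *)
Definition bump n (x1 x2 x : R) : R := flat 0 (n%:R * (x - x1)) * flat 0 (n%:R * (x2 - x)).

Lemma smooth_bump n x1 x2 : smooth (bump n x1 x2).
Proof.
move=> k; apply: derivable_upto_mul.
  apply: (@derivable_upto_ext _ (fun x => flat 0 (- (n%:R * x1) + n%:R * x))).
    by move=> x /=; apply: f_equal; ring.
  by apply: derivable_upto_affine; exact: smooth_flat.
apply: (@derivable_upto_ext _ (fun x => flat 0 (n%:R * x2 + (- n%:R) * x))).
  by move=> x /=; apply: f_equal; ring.
by apply: derivable_upto_affine; exact: smooth_flat.
Qed.

Lemma flat0_itv (x : R) : 0 <= flat 0 x <= 1.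
Proof.
rewrite /flat; case: ifPn => [x0|_]; last by rewrite lexx ler01.
rewrite expr0 invr1 mul1r expR_ge0/= -[leRHS]expR0 ler_expR oppr_le0 invr_ge0 ltW//.
Qed.

Lemma bump_itv n x1 x2 x : 0 <= bump n x1 x2 x <= 1.
Proof.
rewrite /bump; have /andP[a0 a1] := flat0_itv (n%:R * (x - x1)).
have /andP[b0 b1] := flat0_itv (n%:R * (x2 - x)).
by rewrite mulr_ge0//= -[leRHS]mulr1 ler_pM.
Qed.

Lemma bump_out n x1 x2 x : ~~ (x1 < x < x2) -> bump n x1 x2 x = 0.
Proof.
rewrite negb_and -!leNgt => /orP[xx|xx]; rewrite /bump /flat.
  by rewrite ltNge mulr_ge0_le0 ?subr_le0//= mul0r.
by rewrite (ltNge _ (n%:R * (x2 - x))) mulr_ge0_le0 ?subr_le0//= mulr0.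
Qed.

Lemma bump_gt0 n x1 x2 x : (0 < n)%N -> x1 < x < x2 -> 0 < bump n x1 x2 x.
Proof.
move=> n0 /andP[h1 h2].
have h1' : 0 < n%:R * (x - x1) by rewrite mulr_gt0 ?ltr0n ?subr_gt0.
have h2' : 0 < n%:R * (x2 - x) by rewrite mulr_gt0 ?ltr0n ?subr_gt0.
rewrite /bump /flat h1' h2'.
by rewrite !expr0 !invr1 !mul1r mulr_gt0// expR_gt0.
Qed.

Lemma bump_cvg x1 x2 x : (fun n => bump n x1 x2 x) @ \oo --> (((x1 < x < x2)%R : bool)%:R : R).
Proof.
have [xx|xx] := boolP (x1 < x < x2); last first.
  by rewrite (_ : (fun n => _) = fun=> 0); [exact: cvg_cst|apply/funext => n; exact: bump_out].
have E (y : R) : 0 < y -> (fun n => flat 0 (n%:R * y)) @ \oo --> (1 : R).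
  move=> y0; rewrite -cvg_shiftS/=.
  rewrite (_ : (fun n => _) = fun n => expR (- (y^-1 * (n.+1%:R^-1)))); last first.
    apply/funext => n; rewrite /flat pmulr_rgt0 ?ltr0n// y0 expr0 invr1 mul1r.
    by rewrite invfM mulrC.
  suff : (fun n => expR (- (y^-1 * (n.+1%:R^-1)))) @ \oo --> expR (- (y^-1 * 0)) by rewrite mulr0 oppr0 expR0.
  apply: continuous_cvg; first exact: continuous_expR.
  apply: cvgN; apply: cvgM; first exact: cvg_cst.
  exact: cvg_harmonic.
move: xx => /andP[h1 h2]; rewrite -[X in _ --> X](mulr1 (1:R)).
by apply: cvgM; apply: E; rewrite subr_gt0.
Qed.

End Smooth.

(** * Integrable functions and Fubini on products of sets *)

Set Implicit Arguments.
Unset Strict Implicit.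

Section AE.
Context d (T : measurableType d) (R : realType) (mu : {measure set T -> \bar R}).
Implicit Types P Q S : T -> Prop.

Lemma aeS P Q : (forall x, P x -> Q x) -> {ae mu, forall x, P x} -> {ae mu, forall x, Q x}.
Proof. exact: (@filterS _ _ (ae_filter_ringOfSetsType mu)). Qed.

Lemma aeS2 P Q S : (forall x, P x -> Q x -> S x) ->
  {ae mu, forall x, P x} -> {ae mu, forall x, Q x} -> {ae mu, forall x, S x}.
Proof. exact: (@filterS2 _ _ (ae_filter_ringOfSetsType mu)). Qed.

Lemma ae_forall P : (forall x, P x) -> {ae mu, forall x, P x}.
Proof. by move=> p; apply: (@aeS (fun=> True)) => //; exact: (@filterT _ _ (ae_filter_ringOfSetsType mu)). Qed.

End AE.

Section L1.
Context {R : realType}.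
Notation leb := (@lebesgue_measure R).
Notation mR := (measurableTypeR R).
Notation mset A := (measurable (A : set mR)).
Notation mfun A f := (measurable_fun (A : set mR) (f : mR -> R)).
Implicit Types (A B : set R) (f g : R -> R).

Definition L1 A f := leb.-integrable A (EFin \o f).
Definition Int A f : R := (\int[leb]_(x in A) f x)%R.

Lemma L1_add A f g : mset A -> L1 A f -> L1 A g -> L1 A (fun x => f x + g x).
Proof. by move=> mA f1 g1; have := integrableD mA f1 g1. Qed.

Lemma L1_opp A f : mset A -> L1 A f -> L1 A (fun x => - f x).
Proof. by move=> mA f1; have := integrableN f1. Qed.

Lemma L1_sub A f g : mset A -> L1 A f -> L1 A g -> L1 A (fun x => f x - g x).
Proof. by move=> mA f1 g1; apply: L1_add => //; exact: L1_opp. Qed.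

Lemma L1_scale A (c : R) f : mset A -> L1 A f -> L1 A (fun x => c * f x).
Proof. by move=> mA f1; have := integrableZl mA c f1. Qed.

Lemma L1_meas A f : L1 A f -> mfun A f.
Proof. by move=> /integrableP[/measurable_EFinP]. Qed.

Lemma L1_le A f g : mset A -> mfun A f ->
  (forall x, A x -> `|f x| <= `|g x|) -> L1 A g -> L1 A f.
Proof.
move=> mA mf fg g1; apply: (le_integrable mA _ _ g1).
  exact/measurable_EFinP.
by move=> x Ax /=; rewrite lee_fin; exact: fg.
Qed.

Lemma L1_norm A f : mset A -> L1 A f -> L1 A (fun x => `|f x|).
Proof. by move=> mA f1; have := integrable_abse f1. Qed.

Lemma L1_mul A h g (M : R) : mset A -> mfun A h ->
  (forall x, A x -> `|h x| <= M) -> L1 A g -> L1 A (fun x => h x * g x).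
Proof.
move=> mA mh hM g1.
apply: (@L1_le A _ (fun x => M * g x)) => //.
- by apply: measurable_funM => //; exact: L1_meas.
- move=> x Ax; rewrite !normrM ler_wpM2r //.
  by apply: (le_trans (hM x Ax)); exact: ler_norm.
- exact: L1_scale.
Qed.

Lemma L1_subset A B f : mset A -> mset B -> A `<=` B -> L1 B f -> L1 A f.
Proof. by move=> mA mB AB; exact: integrableS. Qed.

Lemma L1_cst A (c : R) : mset A -> (leb A < +oo)%E -> L1 A (fun=> c).
Proof.
move=> mA fA; apply/integrableP; split; first exact: measurable_cst.
by rewrite integral_cst //= lte_mul_pinfty.
Qed.

Lemma L1_bounded A f (M : R) : mset A -> (leb A < +oo)%E -> mfun A f ->
  (forall x, A x -> `|f x| <= M) -> L1 A f.
Proof.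
move=> mA fA mf fM; apply: (@L1_le A _ (fun=> M)) => //; last exact: L1_cst.
by move=> x Ax; apply: (le_trans (fM x Ax)); exact: ler_norm.
Qed.

Lemma IntD A f g : mset A -> L1 A f -> L1 A g ->
  Int A (fun x => f x + g x) = Int A f + Int A g.
Proof. by move=> mA f1 g1; exact: RintegralD. Qed.

Lemma IntZ A (c : R) f : mset A -> L1 A f ->
  Int A (fun x => c * f x) = c * Int A f.
Proof. by move=> mA f1; exact: RintegralZl. Qed.

Lemma IntN A f : mset A -> L1 A f -> Int A (fun x => - f x) = - Int A f.
Proof.
move=> mA f1; have := @IntZ _ (-1) _ mA f1; rewrite mulN1r => <-.
by apply: eq_Rintegral => x _; rewrite mulN1r.
Qed.

Lemma IntB A f g : mset A -> L1 A f -> L1 A g ->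
  Int A (fun x => f x - g x) = Int A f - Int A g.
Proof. by move=> mA f1 g1; exact: RintegralB. Qed.

Lemma eq_Int A f g : (forall x, A x -> f x = g x) -> Int A f = Int A g.
Proof. by move=> fg; apply: eq_Rintegral => x; rewrite inE; exact: fg. Qed.

Lemma EInt A f : L1 A f -> mset A -> (\int[leb]_(x in A) (f x)%:E)%E = (Int A f)%:E.
Proof. by move=> f1 mA; rewrite /Int /Rintegral fineK //; exact: integrable_fin_num. Qed.

Lemma Int_le A f g : mset A -> L1 A f -> L1 A g ->
  (forall x, A x -> f x <= g x) -> Int A f <= Int A g.
Proof. by move=> mA f1 g1 fg; apply: le_Rintegral. Qed.

Lemma Int_norm A f : mset A -> L1 A f -> `|Int A f| <= Int A (fun x => `|f x|).
Proof. by move=> mA f1; exact: le_normr_Rintegral. Qed.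

Lemma Int_ge0 A f : (forall x, A x -> 0 <= f x) -> 0 <= Int A f.
Proof. by move=> f0; apply: Rintegral_ge0. Qed.

Lemma aeI_set A (P Q : R -> Prop) :
  {ae leb, forall x, A x -> P x} -> {ae leb, forall x, A x -> Q x} ->
  {ae leb, forall x, A x -> P x /\ Q x}.
Proof.
by apply: aeS2 => x px qx Ax; split; [exact: px|exact: qx].
Qed.

Lemma ae_Int A f g : mset A -> mfun A f -> mfun A g ->
  {ae leb, forall x, A x -> f x = g x} -> Int A f = Int A g.
Proof.
move=> mA mf mg fg; rewrite /Int /Rintegral; congr fine.
apply: ae_eq_integral => //; [exact/measurable_EFinP|exact/measurable_EFinP|].
by move: fg; apply: aeS => x h Ax /=; rewrite h.
Qed.

End L1.

Section Fubini.
Context {R : realType}.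
Notation leb := (@lebesgue_measure R).
Notation mR := (measurableTypeR R).
Notation mset A := (measurable (A : set mR)).
Notation mfun A f := (measurable_fun (A : set mR) (f : mR -> R)).
Variables (A B : set R).
Hypotheses (mA : mset A) (mB : mset B).
Implicit Types (u h : R * R -> R).

Definition L1p (A B : set R) u := (leb \x leb)%E.-integrable
  ((A : set mR) `*` (B : set mR)) (EFin \o u).

(** Extension by 0, to apply theorems on integrals over the whole plane. *)
Definition zext (A B : set R) u := (EFin \o u) \_ ((A : set mR) `*` (B : set mR)).

Let mAB : measurable ((A : set mR) `*` (B : set mR)).
Proof. exact: measurableX. Qed.

Local Notation ext := (zext A B).

Lemma zext_int u : L1p A B u -> (leb \x leb)%E.-integrable setT (ext u).
Proof. by move=> u1; apply/(integrable_mkcond _ mAB). Qed.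

Lemma zextE u (x : mR) : A x -> (fun y => ext u (x, y)) = (fun y => (u (x, y))%:E) \_ B.
Proof.
move=> Ax; apply/funext => y; rewrite /zext !patchE.
case: ifPn => [|]; rewrite ?inE /= => h.
  by case: ifPn => //; rewrite notin_setE; case: h.
by case: ifPn => //; rewrite inE => By; exfalso; apply: (negP h); rewrite inE.
Qed.

Lemma fubini_ae u : L1p A B u ->
  {ae leb, forall x, A x -> L1 B (fun y => u (x, y))}.
Proof.
move=> /zext_int /ae_integrable1; apply: filterS => x + Ax.
by rewrite zextE // => /(integrable_mkcond _ mB).
Qed.

Lemma zextF u : fubini_F leb (ext u) = (fun x => \int[leb]_(y in B) (u (x, y))%:E)%E \_ A.
Proof.
apply/funext => x; rewrite /fubini_F patchE; case: ifPn; rewrite ?inE ?notin_setE => Ax.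
  by rewrite [RHS]integral_mkcond zextE.
rewrite integral0_eq // => y _; rewrite /zext patchE; case: ifPn => //.
by rewrite inE => -[].
Qed.

Lemma fubini_L1 u : L1p A B u -> L1 A (fun x => Int B (fun y => u (x, y))).
Proof.
move=> u1; have := integrable_fubini_F (zext_int u1); rewrite zextF => /(integrable_mkcond _ mA) F1.
have mF : mfun A (fun x => Int B (fun y => u (x, y))).
  have /integrableP[mF _] := F1.
  by apply: measurableT_comp mF; exact: fine_measurable.
apply: (le_integrable mA _ _ F1); first exact/measurable_EFinP.
move=> x Ax /=; rewrite /Int /Rintegral.
by case: (integral _ _ _) => //=; rewrite ?normr0 ?leey ?lexx.
Qed.

Lemma Int_zext u : L1p A B u ->
  (Int A (fun x => Int B (fun y => u (x, y))))%:E =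
  (\int[leb]_x \int[leb]_y zext A B u (x, y))%E.
Proof.
move=> u1; rewrite -EInt //; last exact: fubini_L1.
have -> : (fun x => \int[leb]_y zext A B u (x, y))%E = fubini_F leb (zext A B u) by [].
have := integrable_fubini_F (zext_int u1); rewrite zextF => /(integrable_mkcond _ mA) F1.
rewrite -integral_mkcond.
apply: ae_eq_integral => //.
- by apply/measurable_EFinP; apply: L1_meas; exact: fubini_L1.
- by have /integrableP[] := F1.
- move: (fubini_ae u1); apply: aeS => x h Ax.
  by rewrite EInt //; exact: h.
Qed.

(** Almost every section of a null set is null, by Tonelli. *)
Lemma ae_prod (P : R * R -> Prop) :
  {ae (leb \x leb)%E, forall z, ((A : set mR) `*` (B : set mR)) z -> P z} ->
  {ae leb, forall x, A x -> {ae leb, forall y, B y -> P (x, y)}}.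
Proof.
move=> [N [mN N0 sN]].
have : {ae leb, forall x, leb (xsection N x) = 0%E}.
  have mx : measurable_fun setT (leb \o xsection N).
    exact: measurable_fun_xsection.
  have := ae_eq_integral_abs leb measurableT mx.
  move=> [+ _]; rewrite /ae_eq => h.
  have /h : (\int[leb]_x `|(leb \o xsection N) x| = 0)%E.
    rewrite -N0; apply: eq_integral => x _ /=.
    by rewrite gee0_abs.
  by apply: aeS => x; apply.
apply: aeS => x x0 Ax; exists (xsection N x); split => //.
  exact: measurable_xsection.
move=> y ny; rewrite /xsection /= inE; apply: sN => /= h; apply: ny => By.
exact: h.
Qed.

Lemma L1p_meas u : L1p A B u -> measurable_fun ((A : set mR) `*` (B : set mR)) u.
Proof. by move=> /integrableP[/measurable_EFinP]. Qed.

Lemma L1p_le u h : measurable_fun ((A : set mR) `*` (B : set mR)) u ->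
  (forall x y, A x -> B y -> `|u (x, y)| <= `|h (x, y)|) -> L1p A B h -> L1p A B u.
Proof.
move=> mu uh h1; apply: (le_integrable mAB _ _ h1).
  exact/measurable_EFinP.
by move=> [x y] [Ax By] /=; rewrite lee_fin; exact: uh.
Qed.

Lemma L1p_scale (c : R) u : L1p A B u -> L1p A B (fun z => c * u z).
Proof. by move=> u1; have := integrableZl mAB c u1. Qed.

Lemma L1p_mul h u (M : R) : measurable_fun ((A : set mR) `*` (B : set mR)) h ->
  (forall x y, A x -> B y -> `|h (x, y)| <= M) -> L1p A B u -> L1p A B (fun z => h z * u z).
Proof.
move=> mh hM u1.
apply: (@L1p_le _ (fun z => M * u z)).
- by apply: measurable_funM => //; exact: L1p_meas.
- move=> x y Ax By; rewrite !normrM ler_wpM2r //.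
  by apply: (le_trans (hM x y Ax By)); exact: ler_norm.
- exact: L1p_scale.
Qed.

End Fubini.

Section Fubini2.
Context {R : realType}.
Notation leb := (@lebesgue_measure R).
Notation mR := (measurableTypeR R).
Notation mset A := (measurable (A : set mR)).
Notation mfun A f := (measurable_fun (A : set mR) (f : mR -> R)).
Variables (A B : set R).
Hypotheses (mA : mset A) (mB : mset B).
Implicit Types (u h : R * R -> R).

Lemma zext_swap (A' B' : set R) u : zext B' A' (fun z => u (z.2, z.1)) = zext A' B' u \o (@swap_pair mR mR).
Proof.
apply/funext => -[x y]; rewrite /zext /= !patchE /=.
case: ifPn => [|/negP] h1; case: ifPn => [|/negP] h2 //; exfalso.
  by apply: h2; move: h1; rewrite !inE => -[].
by apply: h1; move: h2; rewrite !inE => -[].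
Qed.

Lemma L1p_swap u : L1p A B u -> L1p B A (fun z => u (z.2, z.1)).
Proof.
move=> u1.
have mAB : measurable ((A : set mR) `*` (B : set mR)) by exact: measurableX.
have mBA : measurable ((B : set mR) `*` (A : set mR)) by exact: measurableX.
apply/(integrable_mkcond _ mBA).
have /(integrable_mkcond _ mAB) e1 := u1.
rewrite -/(zext _ _ _) zext_swap; rewrite -/(zext _ _ _) in e1.
have /integrableP[me _] := e1.
have mf : measurable_fun setT (zext A B u \o (@swap_pair mR mR)).
  by apply: measurableT_comp => //; exact: measurable_swap.
apply/integrable12ltyP => //.
by have /(integrable21ltyP _ _ me) := e1.
Qed.

Lemma fubini_swap u : L1p A B u ->
  Int A (fun x => Int B (fun y => u (x, y))) = Int B (fun y => Int A (fun x => u (x, y))).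
Proof.
move=> u1.
have : (Int A (fun x => Int B (fun y => u (x, y))))%:E =
       (Int B (fun y => Int A (fun x => u (x, y))))%:E; last by case.
rewrite (Int_zext mA mB u1) (Int_zext mB mA (L1p_swap u1)) zext_swap.
exact: (Fubini (zext_int mA mB u1)).
Qed.

Lemma fubini_ae2 u : L1p A B u -> {ae leb, forall y, B y -> L1 A (fun x => u (x, y))}.
Proof. by move=> /L1p_swap /(fubini_ae mB mA). Qed.

Lemma fubini_L2 u : L1p A B u -> L1 B (fun y => Int A (fun x => u (x, y))).
Proof. by move=> /L1p_swap /(fubini_L1 mB mA). Qed.

(** The L^1 case of the test of Schur, from Tonelli. The kernel may be unbounded, as
    the Abel kernel is on the diagonal. *)
Lemma L1p_kernel (k : R * R -> R) (g : R -> R) (M : R) :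
  measurable_fun ((A : set mR) `*` (B : set mR)) k ->
  (forall y, B y -> (\int[leb]_(x in A) `|k (x, y)|%:E <= M%:E)%E) ->
  L1 B g -> L1p A B (fun z => k z * g z.2).
Proof.
move=> mk kM g1.
have mAB : measurable ((A : set mR) `*` (B : set mR)) by exact: measurableX.
have mu : measurable_fun ((A : set mR) `*` (B : set mR)) (fun z => k z * g z.2).
  apply: measurable_funM => //.
  have mg := L1_meas g1.
  apply: (measurable_comp mB _ mg) => //; first by move=> y [[x' y'] [_ By] <-].
  by apply: measurable_funTS; exact: measurable_snd.
apply/(integrable_mkcond _ mAB); rewrite -/(zext A B _).
have me : measurable_fun setT (zext A B (fun z => k z * g z.2)).
  by apply/(measurable_restrictT _ mAB); exact/measurable_EFinP.
apply/integrable21ltyP => //.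
have Mg1 : L1 B (fun y => M * `|g y|) by apply: L1_scale => //; exact: L1_norm.
apply: (@le_lt_trans _ _ (\int[leb]_(y in B) (M%:E * `|(g y)%:E|))%E); last first.
  by have := integrable_lty mB Mg1.
rewrite [leRHS]integral_mkcond; apply: ge0_le_integral => //.
- by move=> y _; apply: integral_ge0.
- apply: (@measurable_fun_fubini_tonelli_G _ _ _ _ _ leb (abse \o zext A B (fun z => k z * g z.2))) => //.
  exact: measurableT_comp.
  by move=> z; exact: abse_ge0.
- by apply: (measurable_restrictT _ mB).1; have /integrableP[mMg _] := Mg1; exact: mMg.
move=> y _; rewrite patchE; case: ifPn => [|]; rewrite ?inE ?notin_setE => By; last first.
  rewrite integral0_eq // => x _; rewrite /zext patchE; case: ifPn; rewrite ?abse0 //.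
  by rewrite inE => -[].
have -> : (fun x : mR => `|zext A B (fun z => (k z * g z.2)%R) (x, y)|)%E =
  (fun x : mR => `|(g y)%:E| * `|(k (x, y))%:E|)%E \_ A.
  apply/funext => x; rewrite /zext !patchE /=; case: ifPn; case: ifPn; rewrite ?inE ?notin_setE => h1 h2.
  - by rewrite muleC -EFinM -normrM.
  - by case: h2.
  - by case: h2.
  - by rewrite abse0.
rewrite -integral_mkcond ge0_integralZl //; last first.
  apply: measurableT_comp => //; apply/measurable_EFinP.
  apply: (measurable_comp mAB _ mk) => //; first by move=> _ [x Ax <-].
  by apply: measurable_funTS; exact: pair2_measurable.
by rewrite muleC lee_wpmul2r // kM.
Qed.

End Fubini2.

(** * Weak derivatives and primitives *)

Section Intervals.
Context {R : realType}.
Notation leb := (@lebesgue_measure R).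
Notation mR := (measurableTypeR R).
Notation mset A := (measurable (A : set mR)).
Notation mfun A f := (measurable_fun (A : set mR) (f : mR -> R)).
Implicit Types (A B : set R) (f g h : R -> R) (a b c x : R).

Lemma mset_itv (i : interval R) : mset [set` i].
Proof. exact: measurable_itv. Qed.
#[local] Hint Resolve mset_itv : core.

Lemma leb_itv a b : (leb `]a, b[ < +oo)%E.
Proof. by rewrite lebesgue_measure_itv /=; case: ifP => _; rewrite ?ltry. Qed.
#[local] Hint Resolve leb_itv : core.

Lemma cont_mfun A f : mset A -> continuous f -> mfun A f.
Proof. by move=> mA cf; apply: measurable_funTS; exact: continuous_measurable_fun. Qed.

Lemma itv_norm a b x : x \in `]a, b[ -> `|x| <= `|a| + `|b|.
Proof.
rewrite in_itv /= => /andP[ax xb]; have := ler_norm b; have := ler_norm (- a); rewrite normrN => h1 h2.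
have := normr_ge0 a; have := normr_ge0 b => h3 h4.
by rewrite ler_norml; apply/andP; split; lra.
Qed.

Lemma cont_itv_bounded a b f : continuous f -> exists2 M : R, 0 <= M & forall x, `]a, b[%classic x -> `|f x| <= M.
Proof.
move=> cf; have [M M0 h] := cont_bounded f (`|a| + `|b|) cf.
by exists M => // x /itv_norm xab; exact: h.
Qed.

Lemma cont_L1 a b f : continuous f -> L1 `]a, b[ f.
Proof.
move=> cf; have [M _ h] := cont_itv_bounded a b cf.
by apply: (@L1_bounded _ _ _ M) => //; exact: cont_mfun.
Qed.

Lemma cont_L1_mul a b f g : continuous f -> L1 `]a, b[ g -> L1 `]a, b[ (fun x => f x * g x).
Proof.
move=> cf g1; have [M _ h] := cont_itv_bounded a b cf.
by apply: (@L1_mul _ _ _ _ M) => //; exact: cont_mfun.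
Qed.

Lemma Int_restr A B (P : R -> bool) f :
  (forall x, A x <-> B x /\ P x) -> Int B (fun x => (P x)%:R * f x) = Int A f.
Proof.
move=> h; rewrite /Int Rintegral_mkcond [RHS]Rintegral_mkcond.
apply: eq_Rintegral => x _; rewrite !patchE.
case: ifPn => hB; case: ifPn => hA; rewrite ?notin_setE ?inE in hA hB.
- by have [_ ->] := (h x).1 hA; rewrite mul1r.
- case Px : (P x); last by rewrite mul0r.
  by exfalso; apply: hA; apply/h.
- by exfalso; apply: hB; have [] := (h x).1 hA.
- by [].
Qed.

Lemma Int_split a c b f : a <= c <= b -> L1 `]a, b[ f ->
  Int `]a, b[ f = Int `]a, c[ f + Int `]c, b[ f.
Proof.
move=> /andP[ac cb] f1; have [cb'|cb'] := ltP c b; last first.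
  have -> : c = b by apply/eqP; rewrite eq_le cb cb'.
  rewrite [X in _ + X](_ : _ = 0) ?addr0 //.
  by rewrite /Int set_itv_ge ?Rintegral_set0// bnd_simp ltxx.
have := @Rintegral_itvB _ f (BRight a) (BLeft b) c f1.
rewrite !bnd_simp => /(_ ac cb') h.
apply/eqP; rewrite addrC -subr_eq; apply/eqP; rewrite /Int -h; congr (_ - _).
apply: Rintegral_itv_bndo_bndc; apply: (L1_subset _ _ _ f1) => //.
by apply: subset_itvl; rewrite bnd_simp.
Qed.

Lemma Int_cst a b c : a <= b -> Int `]a, b[ (fun=> c) = (b - a) * c.
Proof.
move=> ab; rewrite /Int Rintegral_cst //= lebesgue_measure_itv /= lte_fin.
by case: ltgtP ab => // [|->] _; rewrite ?mulr0 ?subrr ?mul0r ?mulr0 // -EFinD mulrC.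
Qed.

Lemma Int_J a b f : continuous f -> 0 <= a <= b -> Int `]a, b[ f = J f b - J f a.
Proof.
move=> cf /andP[a0 ab]; have h x : 0 <= x -> J f x = Int `]0, x[ f.
  move=> x0; rewrite J_itv // /Int -Rintegral_itv_obnd_cbnd; last first.
    by apply: (integrableS _ _ _ (cont_integrable_itv f 0 x cf)) => //; exact: subset_itv_oc_cc.
  by rewrite -Rintegral_itv_bndo_bndc //; exact: cont_L1.
rewrite !h ?(le_trans a0) // (@Int_split 0 a b) ?a0 ?ab //; last exact: cont_L1.
by rewrite addrC addKr.
Qed.

Lemma Int_dct A (F : nat -> R -> R) f g : mset A ->
  (forall n, mfun A (F n)) -> mfun A f -> L1 A g ->
  (forall x, A x -> F n x @[n --> \oo] --> f x) ->
  (forall n x, A x -> `|F n x| <= g x) ->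
  Int A (F n) @[n --> \oo] --> Int A f.
Proof.
move=> mA mF mf g1 Ff Fg.
have [] := @dominated_convergence _ _ _ leb A mA (fun n => EFin \o F n) (EFin \o f) (EFin \o g).
- by move=> n; exact/measurable_EFinP.
- exact/measurable_EFinP.
- by apply: ae_forall => x Ax; apply: cvg_EFin; [exact: nearW|exact: Ff].
- exact: g1.
- by apply: ae_forall => x n Ax /=; rewrite lee_fin; exact: Fg.
move=> f1 _; rewrite (EInt f1 mA) => h.
exact: (fine_cvg h).
Qed.

(** By Lebesgue differentiation of the primitive, which is constant here. *)
Lemma interval_ae0 b h : L1 `]0, b[ h ->
  (forall x1 x2, 0 < x1 -> x1 < x2 -> x2 < b -> Int `]x1, x2[ h = 0) ->
  {ae leb, forall x, `]0, b[%classic x -> h x = 0}.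
Proof.
move=> h1 hI.
pose g := h \_ `]0, b[.
have g1 : leb.-integrable setT (EFin \o g).
  by have /integrable_mkcond := h1 => /(_ (mset_itv _)); rewrite restrict_EFin.
have gl : locally_integrable setT g.
  split; [by have /L1_meas := g1|exact: openT|] => K _ cK.
  have mK : mset K by apply: closed_measurable; apply: compact_closed => //; exact: Rhausdorff.
  apply: le_lt_trans (integrable_lty measurableT (integrable_abse g1)).
  by apply: ge0_subset_integral => //; have /integrableP[] := integrable_abse g1.
have gi (y : R) : leb.-integrable [set` Interval -oo%O (BRight y)] (EFin \o g).
  by apply: (integrableS _ _ _ g1).
have := FTC1 gi gl.
apply: aeS => x h0 xb; have [dg gx] := h0 (ltNyr x).
have xb' := xb; rewrite /= in_itv /= in xb'; have /andP[x0 xb1] := xb'.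
have gE : g x = h x by rewrite /g patchE mem_set.
rewrite -gE -gx.
set F := (fun x : R => _) in dg gx *.
have F0 y z : 0 < y -> y < z -> z < b -> F z = F y.
  move=> y0 yz zb; apply/eqP; rewrite -subr_eq0; apply/eqP; rewrite /F Rintegral_itvB //; last by rewrite bnd_simp ltW.
  rewrite -(hI y z) // -Rintegral_itv_bndo_bndc; last by apply: (integrableS _ _ _ g1).
  apply: eq_Int => t; rewrite /= in_itv /= => /andP[yt tz]; rewrite /g patchE mem_set //=.
  by rewrite in_itv /= (lt_trans y0 yt) (lt_trans tz zb).
have FE : \forall y \near x, F y = F x.
  have : \forall y \near x, y \in `]0, b[ by exact: near_in_itvoo.
  apply: filterS => w; rewrite in_itv /= => /andP[w0 wb].
  by case: (ltgtP w x) => [wx|xw|-> //]; [rewrite [RHS](F0 w)|rewrite (F0 x)].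
by rewrite derive1E (@near_eq_derive _ _ _ F (cst (F x)) x 1) ?derive_cst // oner_eq0.
Qed.

Lemma test_deriv b phi : test_function b phi -> test_function b (derive1 phi).
Proof.
move=> tphi; have sphi := smooth_deriv _ (test_smooth _ _ tphi).
split; first exact: smooth_derivable.
have [_ [c [d [c0 db h]]]] := tphi; exists c, d; split => // x.
apply: contraNT => nx; rewrite derive1E (@near_eq_derive _ _ _ phi (cst 0) x 1) ?derive_cst ?oner_eq0 //.
have z y : ~~ (c <= y <= d) -> phi y = 0.
  by move=> ny; apply/eqP; apply: contraNT ny; exact: h.
move: nx; rewrite negb_and -!ltNge => /orP[xc|dx].
  have : \forall y \near x, y < c by exact: lt_nbhsl.
  by apply: filterS => y yc; rewrite z // negb_and -ltNge yc.
have : \forall y \near x, d < y by exact: lt_nbhsr.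
by apply: filterS => y yc; rewrite z // negb_and -!ltNge yc orbT.
Qed.

Lemma test_out b phi x : test_function b phi -> ~~ (0 < x < b) -> phi x = 0.
Proof.
move=> [_ [c [d [c0 db h]]]] nx; apply/eqP; apply: contraNT nx => /h /andP[cx xd].
by rewrite (lt_le_trans c0 cx) (le_lt_trans xd db).
Qed.

Lemma test_cont b phi : test_function b phi -> continuous phi.
Proof. by move=> /test_smooth /smooth_continuous. Qed.

Lemma test_is_derive b phi x : test_function b phi -> is_derive x (1 : R) phi (derive1 phi x).
Proof. by move=> [h _]; rewrite derive1E; apply/derivableP; exact: (h 0%N). Qed.

Lemma test_J b phi x : test_function b phi -> J (derive1 phi) x = phi x.
Proof.
move=> tphi; apply/esym; apply: (J_unique _ _ (test_cont (test_deriv tphi))).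
  by move=> y; exact: test_is_derive tphi.
by apply: (test_out tphi); rewrite ltxx.
Qed.

Lemma L1p_bounded_kernel A B (k : R * R -> R) g (M : R) : mset A -> mset B -> (leb A < +oo)%E ->
  measurable_fun setT (k : mR * mR -> R) ->
  (forall x y, A x -> B y -> `|k (x, y)| <= M) -> L1 B g -> L1p A B (fun z => k z * g z.2).
Proof.
move=> mA mB fA mk kM g1.
apply: (@L1p_kernel _ A B mA mB k g (`|M| * fine (leb A))) => //.
  exact: measurable_funTS.
move=> y By; rewrite EFinM fineK ?ge0_fin_numE // -integral_cst //.
apply: ge0_le_integral => //.
- apply/measurable_EFinP; apply: measurableT_comp => //.
  by apply: measurable_funTS; apply: measurableT_comp => //; exact: pair2_measurable.
- by move=> x Ax; rewrite lee_fin (le_trans (kM x y Ax By)) // ler_norm.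
Qed.

Lemma measurable_step : measurable_fun setT (fun z : mR * mR => ((z.2 < z.1)%R : bool)%:R : R).
Proof.
rewrite (_ : (fun z => _) = (fun z : mR * mR => if z.2 < z.1 then (1 : R) else 0)); last first.
  by apply/funext => z; case: ifP.
apply: measurable_fun_ifT => //.
by apply: measurable_fun_ltr; [exact: measurable_snd|exact: measurable_fst].
Qed.

(** The primitive of a merely integrable function; [J] is kept for continuous
    integrands, where it can be differentiated. *)
Definition prim g x := Int `]0, x[ g.

(** Writes [prim] as an integral operator with a bounded kernel, so that Fubini
    applies to it. *)
Lemma L1p_prim_kernel b f g : 0 < b -> continuous f -> L1 `]0, b[ g ->
  L1p `]0, b[ `]0, b[ (fun z => (f z.1 * ((z.2 < z.1)%R : bool)%:R) * g z.2).
Proof.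
move=> b0 cf g1; have [M M0 fM] := cont_itv_bounded 0 b cf.
apply: (@L1p_bounded_kernel _ _ (fun z => f z.1 * ((z.2 < z.1)%R : bool)%:R) g M) => //.
  apply: measurable_funM; last exact: measurable_step.
  apply: (measurableT_comp (continuous_measurable_fun cf)); exact: measurable_fst.
move=> x y Ax Ay /=; rewrite normrM; apply: le_trans (fM x Ax).
by rewrite -[leRHS]mulr1 ler_wpM2l //; case: (_ < _); rewrite ?normr1 ?normr0.
Qed.

Lemma prim_step b g x (c : R) : 0 < b -> `]0, b[%classic x -> L1 `]0, b[ g ->
  Int `]0, b[ (fun y => (c * ((y < x)%R : bool)%:R) * g y) = c * prim g x.
Proof.
move=> b0; rewrite /= in_itv /= => /andP[x0 xb] g1.
rewrite /prim -(@Int_restr `]0, x[%classic `]0, b[%classic (fun y => y < x)); last first.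
  move=> y /=; rewrite !in_itv /=; split => [/andP[y0 yx]|[/andP[-> _] ->] //].
  by rewrite y0 (lt_trans yx xb) yx.
rewrite -IntZ //; first by apply: eq_Int => y _; rewrite mulrA.
apply: (@L1_mul _ _ _ _ 1) => //; last by move=> y _; case: (_ < _); rewrite ?normr1 ?normr0.
apply: measurable_funTS.
rewrite (_ : (fun z => _) = (fun z : mR => if z < x then (1 : R) else 0)); last first.
  by apply/funext => z; case: ifP.
by apply: measurable_fun_ifT => //; exact: measurable_fun_ltr.
Qed.

Lemma L1_eq A f g : mset A -> (forall x, A x -> f x = g x) -> L1 A f -> L1 A g.
Proof. by move=> mA fg; apply: eq_integrable => // x; rewrite inE => /fg /= ->. Qed.

Lemma prim_L1_mul b f g : 0 < b -> continuous f -> L1 `]0, b[ g ->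
  L1 `]0, b[ (fun x => f x * prim g x).
Proof.
move=> b0 cf g1; have := fubini_L1 (mset_itv _) (mset_itv _) (L1p_prim_kernel b0 cf g1).
by apply: L1_eq => // x xb; rewrite /= (prim_step _ b0).
Qed.

Lemma prim_L1 b g : 0 < b -> L1 `]0, b[ g -> L1 `]0, b[ (prim g).
Proof.
move=> b0 g1; have c1 : continuous (fun _ : R => (1 : R)) by exact: ct_cst.
have := prim_L1_mul b0 c1 g1.
by apply: L1_eq => // x _; rewrite mul1r.
Qed.

(** Integration by parts against a primitive, through Fubini on the triangle y < x. *)
Lemma prim_test b f g : 0 < b -> continuous f -> L1 `]0, b[ g ->
  Int `]0, b[ (fun x => f x * prim g x) = Int `]0, b[ (fun y => g y * (J f b - J f y)).
Proof.
move=> b0 cf g1; have K := L1p_prim_kernel b0 cf g1.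
rewrite (@eq_Int _ _ _ (fun x => Int `]0, b[ (fun y => (f x * ((y < x)%R : bool)%:R) * g y))); last first.
  by move=> x xb; rewrite prim_step.
rewrite (fubini_swap (mset_itv _) (mset_itv _) K); apply: eq_Int => y yb /=.
have yb' := yb; rewrite /= in_itv /= in yb'; have /andP[y0 yb1] := yb'.
rewrite -Int_J ?(ltW y0) ?(ltW yb1) //.
rewrite -(@Int_restr `]y, b[%classic `]0, b[%classic (fun x => y < x)); last first.
  move=> x /=; rewrite !in_itv /=; split => [/andP[yx ->]|[/andP[x0 ->] ->] //].
  by rewrite (lt_trans y0 yx) yx.
rewrite -IntZ //; first by apply: eq_Int => x _; ring.
rewrite (_ : (fun x => _) = (fun x => f x * (if y < x then (1 : R) else 0))); last first.
  by apply/funext => x; rewrite mulrC; case: ifP.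
have [M M0 fM] := cont_itv_bounded 0 b cf.
apply: (@L1_bounded _ _ _ M) => //.
  apply: measurable_funM; first exact: cont_mfun.
  by apply: measurable_funTS; apply: measurable_fun_ifT => //; exact: measurable_fun_ltr.
move=> x xb; rewrite normrM; apply: le_trans (fM x xb).
by rewrite -[leRHS]mulr1 ler_wpM2l //; case: ifP; rewrite ?normr1 ?normr0.
Qed.

(** A bump is not the derivative of a test function, but its difference with the
    multiple of a fixed bump of the same integral is. *)
Lemma bump_test b x1 x2 y1 y2 n : 0 < x1 -> x1 < x2 -> x2 < b -> 0 < y1 -> y1 < y2 -> y2 < b ->
  let c := J (bump n x1 x2) b / J (bump 1 y1 y2) b in
  J (bump 1 y1 y2) b != 0 ->
  test_function b (J (fun x => bump n x1 x2 x - c * bump 1 y1 y2 x)).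
Proof.
move=> x10 x12 x2b y10 y12 y2b c B0.
have s1 : smooth (bump n x1 x2) by exact: smooth_bump.
have s2 : smooth (bump 1 y1 y2) by exact: smooth_bump.
have b0 : 0 < b by apply: lt_trans x2b; exact: lt_trans x12.
set f := fun x => _.
have sf : smooth f.
  move=> k; apply: derivable_upto_add; first exact: s1.
  apply: (@derivable_upto_ext _ _ (fun x => (- c) * bump 1 y1 y2 x)); first by move=> x; rewrite mulNr.
  by apply: derivable_upto_mul; [exact: derivable_upto_cst|exact: s2].
have cf := smooth_continuous _ sf.
split; first exact: (smooth_derivable _ (smooth_J _ sf)).
pose c0 := Num.min x1 y1; pose d0 := Num.max x2 y2.
have f0 x : x < c0 \/ d0 < x -> f x = 0.
  rewrite /c0 /d0 /f => h; rewrite !bump_out ?mulr0 ?subrr //; apply/negP => /andP[h1 h2];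
  by move: h; rewrite lt_min gt_max => -[/andP[h3 h4]|/andP[h3 h4]]; lra.
have c00 : 0 < c0 by rewrite /c0 lt_min x10.
have d0b : d0 < b by rewrite /d0 gt_max x2b.
exists c0, d0; split => // x; apply: contraNT; rewrite negb_and -!ltNge => /orP[xc|dx].
  have [x0|x0] := leP 0 x.
    rewrite (@eq_J_ge0 _ f (fun=> 0) x x0) ?J_cst ?mul0r // => t /andP[t0 tx].
    by apply: f0; left; apply: le_lt_trans tx xc.
  rewrite -[x]opprK J_opp // oppr_eq0 (@eq_J_ge0 _ _ (fun=> 0)) ?J_cst ?mul0r ?oppr_ge0 ?ltW // => t /andP[t0 tx].
  by apply: f0; left; apply: le_lt_trans c00; rewrite oppr_le0.
have Jb : J f b = 0.
  rewrite /f JB; last 2 first.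
  - exact: smooth_continuous.
  - by apply: ct_mul; [exact: ct_cst|exact: smooth_continuous].
  by rewrite JZ ?/c ?divfK ?subrr //; exact: smooth_continuous.
have d00 : 0 < d0 by rewrite /d0 lt_max (lt_trans x10 x12).
have xx : 0 <= x by exact/ltW/(lt_trans d00).
have [xb|bx] := leP x b.
  have := @Int_J x b f cf; rewrite xx xb Jb sub0r => /(_ isT) /eqP; rewrite -eqr_oppLR => /eqP <-.
  rewrite oppr_eq0 (@eq_Int _ _ _ (fun=> 0)) ?Int_cst ?mulr0 // => t.
  by rewrite /= in_itv /= => /andP[xt _]; apply: f0; right; exact: lt_trans xt.
have := @Int_J b x f cf; rewrite (ltW b0) (ltW bx) Jb subr0 => /(_ isT) <-.
rewrite (@eq_Int _ _ _ (fun=> 0)) ?Int_cst ?mulr0 ?(ltW bx) // => t.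
by rewrite /= in_itv /= => /andP[xt _]; apply: f0; right; apply: lt_trans xt.
Qed.

Lemma J_bump_gt0 b y1 y2 : 0 < y1 -> y1 < y2 -> y2 < b -> 0 < J (bump 1 y1 y2) b.
Proof.
move=> y10 y12 y2b; have cb : continuous (bump 1 y1 y2) by apply: smooth_continuous; exact: smooth_bump.
have mono x y : 0 <= x -> x <= y -> J (bump 1 y1 y2) x <= J (bump 1 y1 y2) y.
  move=> x0 xy; rewrite -subr_ge0 -Int_J ?x0 //; apply: Int_ge0 => t _.
  by have /andP[] := bump_itv 1 y1 y2 t.
have b0 : 0 < b by lra.
rewrite lt_neqAle; apply/andP; split; last by have := mono 0 b (lexx _) (ltW b0); rewrite J0.
apply/eqP => /esym Jb.
have z : bump 1 y1 y2 ((y1 + y2) / 2) = 0.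
  apply: (@J_eq0 _ _ b cb); last by apply/andP; split; lra.
  move=> x /andP[x0 xb]; apply/eqP; rewrite eq_le; apply/andP; split.
    by rewrite -Jb; apply: mono; exact: ltW.
  by have := mono 0 x (lexx _) (ltW x0); rewrite J0.
have h : y1 < (y1 + y2) / 2 < y2 by apply/andP; split; lra.
by have := @bump_gt0 R 1 y1 y2 _ isT h; rewrite z ltxx.
Qed.

(** A function and the primitive of its weak derivative differ by something
    orthogonal to all derivatives of test functions. *)
Lemma weak_orth b f g phi : 0 < b -> L1 `]0, b[ f -> L1 `]0, b[ g -> is_weak_deriv b f g ->
  test_function b phi -> Int `]0, b[ (fun x => derive1 phi x * (f x - prim g x)) = 0.
Proof.
move=> b0 f1 g1 fg tphi; have cphi := test_cont tphi.
have cdphi := test_cont (test_deriv tphi).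
rewrite (@eq_Int _ _ _ (fun x => derive1 phi x * f x - derive1 phi x * prim g x)); last first.
  by move=> x _; rewrite mulrBr.
rewrite IntB //; [|exact: cont_L1_mul|exact: prim_L1_mul].
rewrite prim_test // (@eq_Int _ _ (fun y => g y * _) (fun y => - (g y * phi y))); last first.
  move=> y _; rewrite !(test_J _ tphi) (@test_out b phi b) ?sub0r ?mulrN // ltxx andbF //.
rewrite IntN //; last by apply: L1_eq (cont_L1_mul cphi g1) => // y _; rewrite mulrC.
rewrite (@eq_Int _ _ _ (fun x => f x * derive1 phi x)); last by move=> x _; rewrite mulrC.
by have := fg _ tphi; rewrite -/(Int _ _) -/(Int _ _) => ->; rewrite opprK addNr.
Qed.

(** Lemma of du Bois-Reymond. By [weak_orth] and [bump_test], [F] has the same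
    integral against each bump as the constant [C]; bumps converging to the
    indicator of an interval give equal integrals over intervals. *)
Lemma weak_deriv_prim b f g : 0 < b -> L1 `]0, b[ f -> L1 `]0, b[ g -> is_weak_deriv b f g ->
  exists C, {ae leb, forall x, `]0, b[%classic x -> f x = C + prim g x}.
Proof.
move=> b0 f1 g1 fg; pose F x := f x - prim g x.
have F1 : L1 `]0, b[ F by apply: L1_sub => //; exact: prim_L1.
pose B0 := bump 1 (b / 3) (2 * b / 3).
have cB0 : continuous B0 by apply: smooth_continuous; exact: smooth_bump.
have JB0 : 0 < J B0 b by apply: J_bump_gt0; lra.
pose C := Int `]0, b[ (fun x => B0 x * F x) / J B0 b.
exists C; have : {ae leb, forall x, `]0, b[%classic x -> F x - C = 0}.
  apply: interval_ae0; first by apply: L1_sub => //; exact: L1_cst.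
  move=> x1 x2 x10 x12 x2b.
  have sub : `]x1, x2[%classic `<=` `]0, b[%classic.
    by move=> x; rewrite /= !in_itv /= => /andP[? ?]; apply/andP; split; lra.
  pose bn n := bump n x1 x2.
  have cbn n : continuous (bn n) by apply: smooth_continuous; exact: smooth_bump.
  have E n : Int `]0, b[ (fun x => bn n x * F x) = Int `]0, b[ (bn n) * C.
    have t : test_function b (J (fun x => bn n x - (J (bn n) b / J B0 b) * B0 x)).
      by apply: bump_test => //; try lra; rewrite gt_eqF.
    have cf : continuous (fun x => bn n x - (J (bn n) b / J B0 b) * B0 x).
      by cont.
    have := weak_orth b0 f1 g1 fg t.
    rewrite (@eq_Int _ _ _ (fun x => bn n x * F x - (J (bn n) b / J B0 b) * (B0 x * F x))); last first.
      move=> x _; rewrite derive1E; have dJ := is_derive_J _ x cf; rewrite derive_val /F; ring.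
    rewrite IntB //; [|exact: cont_L1_mul|by apply: L1_scale => //; exact: cont_L1_mul].
    rewrite IntZ //; last exact: cont_L1_mul.
    rewrite (@Int_J 0 b (bn n)) ?lexx ?(ltW b0) // J0 subr0 /C => /eqP; rewrite subr_eq0 => /eqP ->.
    by rewrite mulrAC mulrA.
  have ind (h : R -> R) : Int `]0, b[ (fun x => ((x1 < x < x2)%R : bool)%:R * h x) = Int `]x1, x2[ h.
    apply: Int_restr => x /=; rewrite !in_itv /=; split => [xx|[] //].
    by split => //; move: xx => /andP[? ?]; apply/andP; split; lra.
  have mind : mfun `]0, b[ (fun x => ((x1 < x < x2)%R : bool)%:R : R).
    apply: measurable_funTS.
    rewrite (_ : (fun z => _) = (fun z : mR => if (x1 < z) && (z < x2) then (1 : R) else 0)); last first.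
      by apply/funext => z; case: ifP.
    by apply: measurable_fun_ifT => //; apply: measurable_and; exact: measurable_fun_ltr.
  have L1' : Int `]0, b[ (fun x => bn n x * F x) @[n --> \oo] --> Int `]x1, x2[ F.
    rewrite -ind; apply: (@Int_dct _ _ _ (fun x => `|F x|)) => //.
    - by move=> n; apply: measurable_funM; [exact: cont_mfun|exact: L1_meas].
    - by apply: measurable_funM => //; exact: L1_meas.
    - exact: L1_norm.
    - by move=> x _; apply: cvgMl; exact: bump_cvg.
    - move=> n x _; rewrite normrM ger0_norm; last by have /andP[] := bump_itv n x1 x2 x.
      by apply: ler_piMl => //; have /andP[] := bump_itv n x1 x2 x.
  have L2' : Int `]0, b[ (bn n) @[n --> \oo] --> x2 - x1.
    rewrite (_ : x2 - x1 = Int `]0, b[ (fun x => ((x1 < x < x2)%R : bool)%:R * 1)); last first.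
      by rewrite ind Int_cst ?mulr1 // ltW.
    apply: (@Int_dct _ _ _ (fun x => 1)) => //.
    - by move=> n; exact: cont_mfun.
    - by apply: measurable_funM => //; exact: measurable_cst.
    - exact: L1_cst.
    - by move=> x _; rewrite mulr1; exact: bump_cvg.
    - by move=> n x _; rewrite ger0_norm; have /andP[] := bump_itv n x1 x2 x.
  have L3 : Int `]x1, x2[ F = (x2 - x1) * C.
    apply: (cvg_unique _ L1') => //.
    rewrite (_ : (fun n => _) = (fun n => Int `]0, b[ (bn n) * C)); last exact/funext.
    exact: cvgMl L2'.
  rewrite IntB //; [|by apply: (L1_subset _ _ sub)|exact: L1_cst].
  by rewrite L3 Int_cst ?subrr // ltW.
by apply: aeS => x h xb; have := h xb; rewrite /F => /eqP; rewrite subr_eq0 => /eqP <-; rewrite subrK.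
Qed.

End Intervals.

(** * Mixed norms and traces *)

Section LebesgueL2.
Context {R : realType}.
Notation leb := (@lebesgue_measure R).
Notation mR := (measurableTypeR R).
Notation mset A := (measurable (A : set mR)).
Notation mfun A f := (measurable_fun (A : set mR) (f : mR -> R)).
Implicit Types (A B : set R) (f g h : R -> R) (a b c x l T r : R) (u : R * R -> R).
#[local] Hint Resolve mset_itv : core.
#[local] Hint Resolve leb_itv : core.

Local Notation oI b := (`]0%R, b[%classic).

(** The constant of the embedding of L^2(0, l) into L^1(0, l). *)
Definition L2norm1 l : \bar R := L2norm l (fun=> 1).

Lemma L2normE l f : L2norm l f = ((\int[leb]_(x in `]0%R, l[) ((f x ^+ 2)%R)%:E) `^ 2^-1)%E.
Proof.
rewrite /L2norm unlock; congr (_ `^ _)%E; rewrite [RHS]integral_mkcond.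
apply: eq_integral => x _ /=; rewrite !patchE; case: ifPn => _.
  by rewrite powR_mulrn ?normr_ge0 // -normrX ger0_norm ?sqr_ge0.
by rewrite normr0 powR0 // pnatr_eq0.
Qed.

Lemma L2norm1_lty l : (L2norm1 l < +oo)%E.
Proof.
rewrite /L2norm1 L2normE; apply: poweR_lty.
rewrite (eq_integral (cst 1%E)); last by move=> x _; rewrite expr1n.
by rewrite integral_cst ?mul1e //; exact: leb_itv.
Qed.

Lemma L2norm_ge0 l f : (0 <= L2norm l f)%E.
Proof. exact: Lnorm_ge0. Qed.

Lemma integral_L2norm l f : mfun `]0, l[ f ->
  (\int[leb]_(x in `]0%R, l[) `|f x|%:E <= L2norm l f * L2norm1 l)%E.
Proof.
move=> mf.
have m1 : mfun setT (f \_ `]0, l[) by apply/(measurable_restrictT _ _).1.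
have m2 : mfun setT ((fun=> (1 : R)) \_ `]0, l[) by apply/(measurable_restrictT _ _).1.
have := @hoelder _ _ _ leb _ _ 2 2 m1 m2 ltac:(lra) ltac:(lra) ltac:(lra).
rewrite Lnorm1 => h; apply: (le_trans _ h).
rewrite [X in (X <= _)%E]integral_mkcond le_eqVlt; apply/orP; left; apply/eqP; apply: eq_integral => x _ /=.
by rewrite !patchE; case: ifPn => _ /=; rewrite ?mulr1 ?mulr0 ?normr0.
Qed.

Lemma L2norm_meas l T u : measurable_fun (cylinder l T) u ->
  measurable_fun (`]0, T[%classic : set mR) (fun t : mR => L2norm l (fun x => u (x, t))).
Proof.
move=> mu.
have mc : measurable (cylinder l T) by apply: measurableX.
have m : measurable_fun (oI T : set mR) (fun t : mR => (\int[leb]_x (zext (oI l) (oI T) (fun z => (u z ^+ 2)%R) (x, t))) `^ 2^-1)%E.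
  apply: (measurableT_comp (measurable_poweR _)); apply: measurable_funTS.
  apply: (@measurable_fun_fubini_tonelli_G _ _ _ _ _ leb (zext (oI l) (oI T) (fun z => (u z ^+ 2)%R))) => //.
    by apply/(measurable_restrictT _ mc); apply/measurable_EFinP; exact: measurable_funX.
  by move=> z; rewrite /zext patchE; case: ifPn => //= _; rewrite lee_fin sqr_ge0.
move: m; apply: eq_measurable_fun.
move=> t; rewrite inE => It; rewrite L2normE; congr (_ `^ _)%E; rewrite [RHS]integral_mkcond.
apply: eq_integral => x _; rewrite /zext !patchE; case: ifPn; case: ifPn => //; rewrite ?notin_setE ?inE.
  by move=> nx [/=].
by move=> xx nz; exfalso; apply: nz.
Qed.

Lemma measurable_time_section l T u : measurable_fun (cylinder l T) u ->
  forall t, `]0, T[%classic t -> mfun `]0, l[ (fun x => u (x, t)).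
Proof.
move=> mu t It.
have mc : measurable (cylinder l T) by apply: measurableX.
apply: (measurable_comp mc _ mu) => //; first by move=> _ [x Ax <-].
by apply: measurable_funTS; exact: pair2_measurable.
Qed.

(** For the exponent 2, from h <= 1 + h^2 on a bounded time interval. *)
Lemma LrL2_int (r : R) l T u : r = 1 \/ r = 2 -> LrL2 r l T u ->
  (\int[leb]_(t in `]0%R, T[) L2norm l (fun x => u (x, t)) < +oo)%E.
Proof.
move=> r12 [mu]; have mh := L2norm_meas mu.
set h := fun t => L2norm l (fun x => u (x, t)) in mh *.
have h0 t : (0 <= h t)%E by exact: L2norm_ge0.
case: r12 => ->.
  rewrite Lnorm1 [X in _ -> (X < _)%E]integral_mkcond; apply: le_lt_trans.
  rewrite le_eqVlt; apply/orP; left; apply/eqP; apply: eq_integral => t _.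
  rewrite !patchE; case: ifPn => It; first by rewrite gee0_abs; [reflexivity|exact: h0].
  by rewrite abse0.
move=> h2.
have H2 : (\int[leb]_(t in `]0%R, T[) (h t `^ 2) < +oo)%E.
  have := poweR_lty 2 h2; rewrite poweR_Lnorm ?pnatr_eq0 //; apply: le_lt_trans.
  rewrite [X in (X <= _)%E]integral_mkcond le_eqVlt; apply/orP; left; apply/eqP; apply: eq_integral => t _.
  rewrite !patchE; case: ifPn => _; rewrite ?gee0_abs ?abse0 // poweR0r ?pnatr_eq0 //.
have m2 : measurable_fun (`]0, T[%classic : set mR) (fun t : mR => h t `^ 2)%E.
  by apply: (measurableT_comp (measurable_poweR _)).
have : (\int[leb]_(t in `]0%R, T[) (1 + h t `^ 2) < +oo)%E.
  rewrite ge0_integralD //=; last by move=> t _; exact: poweR_ge0.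
  by rewrite integral_cst //= mul1e lte_add_pinfty //; exact: leb_itv.
apply: le_lt_trans; apply: ge0_le_integral => //.
- by move=> t _; exact: h0.
- exact: emeasurable_funD.
- move=> t _; rewrite -/(h t); case: (h t) (h0 t) => [x| |] //.
    rewrite lee_fin => x0 /=; rewrite -EFinD lee_fin powR_mulrn //; nra.
  by move=> _; rewrite poweRyr ?pnatr_eq0 // addey.
Qed.

(** Brings the Bochner spaces down to joint integrability on the cylinder, where
    Fubini applies. *)
Lemma LrL2_L1p (r : R) l T u : r = 1 \/ r = 2 -> LrL2 r l T u -> L1p `]0, l[ `]0, T[ u.
Proof.
move=> r12 uL; have hi := LrL2_int r12 uL; have [mu _] := uL.
have mh := L2norm_meas mu.
have mc : measurable (cylinder l T) by apply: measurableX.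
apply/(integrable_mkcond _ mc); rewrite -/(zext (oI l) (oI T) u).
have me : measurable_fun setT (zext (oI l) (oI T) u).
  by apply/(measurable_restrictT _ mc); exact/measurable_EFinP.
apply/integrable21ltyP => //.
have zE t : (\int[leb]_x `|zext (oI l) (oI T) u (x, t)|)%E =
   ((fun t : mR => (\int[leb]_(x in oI l) `|u (x, t)|%:E)%E) \_ (oI T)) t.
  rewrite patchE; case: ifPn; rewrite ?inE ?notin_setE => It; last first.
    rewrite integral0_eq // => x _; rewrite /zext patchE; case: ifPn; rewrite ?abse0 //.
    by rewrite inE => -[].
  rewrite [RHS]integral_mkcond; apply: eq_integral => x _.
  rewrite /zext !patchE; case: ifPn; case: ifPn => //; rewrite ?notin_setE ?inE ?abse0 //.
    by move=> nx [/=].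
  by move=> xx nz; exfalso; apply: nz.
have mz : measurable_fun (`]0, T[%classic : set mR) (fun t : mR => \int[leb]_(x in `]0%R, l[) `|u (x, t)|%:E)%E.
  apply/(measurable_restrictT _ _) => //.
  have <- : (fun t => \int[leb]_x `|zext (oI l) (oI T) u (x, t)|)%E = (fun t : mR => (\int[leb]_(x in oI l) `|u (x, t)|%:E)%E) \_ (oI T).
    by apply/funext => t; exact: zE.
  apply: (@measurable_fun_fubini_tonelli_G _ _ _ _ _ leb (abse \o zext (oI l) (oI T) u)) => //.
    exact: measurableT_comp.
  by move=> z; exact: abse_ge0.
rewrite (eq_integral _ _ (fun t _ => zE t)) -integral_mkcond.
apply: (@le_lt_trans _ _ (\int[leb]_(t in `]0%R, T[) (L2norm l (fun x => u (x, t)) * L2norm1 l))%E).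
  apply: ge0_le_integral => //.
  - by move=> t _; apply: integral_ge0.
  - by apply: emeasurable_funM.
  - by move=> t It; apply: integral_L2norm; exact: (measurable_time_section mu).
have Cfin : L2norm1 l \is a fin_num by rewrite ge0_fin_numE ?L2norm1_lty // L2norm_ge0.
rewrite -(fineK Cfin) ge0_integralZr //; last 2 first.
- by move=> t _; exact: L2norm_ge0.
- by apply: fine_ge0; exact: L2norm_ge0.
by rewrite muleC lte_mul_pinfty // ?lee_fin; apply: fine_ge0; exact: L2norm_ge0.
Qed.

Lemma continuous_clamp l f : 0 <= l -> {within `[0, l], continuous f} ->
  continuous (fun x => f (clamp 0 l x)).
Proof.
move=> l0 cf x.
have /subspace_continuousP h := cf.
have xl : `[0, l]%classic (clamp 0 l x) by rewrite /= in_itv /= clamp_itv.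
have := h _ xl.
move=> H A nA; have nA' := H A nA.
have := ct_clamp 0 l x _ nA'.
rewrite !nbhs_filterE /= => H1; near=> y; have /= H2 : (fun t => `[0, l]%classic t -> A (f t)) (clamp 0 l y) by near: y.
by apply: H2; rewrite in_itv /= clamp_itv.
Unshelve. all: by end_near.
Qed.

Lemma prim_clamp b g : 0 < b -> L1 (oI b) g -> continuous (fun x => prim g (clamp 0 b x)).
Proof.
move=> b0 g1; pose g' := g \_ (oI b).
have gT : leb.-integrable setT (EFin \o g').
  by have /integrable_mkcond := g1 => /(_ (mset_itv _)); rewrite restrict_EFin.
have gi (i : interval R) : leb.-integrable [set` i] (EFin \o g') by apply: (integrableS _ _ _ gT).
have := continuous_clamp (ltW b0) (@parameterized_integral_continuous _ 0 b g' (ltW b0) (gi _)).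
rewrite (_ : (fun x => _) = (fun x => prim g (clamp 0 b x))) //.
apply/funext => x; have /andP[y0 yb] := clamp_itv 0 b x (ltW b0).
rewrite /parameterized_integral; set y := clamp 0 b x in y0 yb *.
rewrite -Rintegral_itv_obnd_cbnd // -Rintegral_itv_bndo_bndc //.
apply: eq_Int => t; rewrite /= in_itv /= => /andP[t0 ty]; rewrite /g' patchE mem_set //=.
by rewrite in_itv /= t0 (lt_le_trans ty yb).
Qed.

Lemma ae_continuous_eq0 l h : 0 < l -> continuous h ->
  {ae leb, forall x, oI l x -> h x = 0} -> forall x, 0 <= x <= l -> h x = 0.
Proof.
move=> l0 ch h0.
have Jh x : 0 < x < l -> J h x = 0.
  move=> /andP[x0 xl]; have := @Int_J _ 0 x h ch; rewrite lexx (ltW x0) J0 subr0 => <- //.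
  rewrite (@ae_Int _ _ h (fun=> 0)) //; last 2 first.
  - exact: cont_mfun.
  - move: h0; apply: aeS => t ht; rewrite /= in_itv /= => /andP[t0 tx]; apply: ht.
    by rewrite /= in_itv /= t0 (lt_trans tx xl).
  by rewrite Int_cst ?mulr0 // ltW.
have hx := J_eq0 _ _ ch Jh.
move=> x xl; apply/eqP; rewrite -normr_le0.
by apply: (closure_le _ _ _ ch l0 _ _ xl) => y /hx ->; rewrite normr0.
Qed.

(** Two continuous functions that agree almost everywhere agree, so any continuous
    representative computes the trace. *)
Lemma trace0_eq l f G : 0 < l -> continuous G ->
  {ae leb, forall x, oI l x -> G x = f x} -> trace0 l f = G 0.
Proof.
move=> l0 cG Gf; rewrite /trace0.
set S := [set g | _].
have SG : S G by split => //; exact: continuous_subspaceT.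
have [cg gf] : S (xget (fun=> 0) S) by apply: xgetPex; exists G.
set g := xget _ _ in cg gf *.
have ch : continuous (fun x => g (clamp 0 l x) - G x).
  have cgl := continuous_clamp (ltW l0) cg; cont.
have h0 : {ae leb, forall x, oI l x -> g (clamp 0 l x) - G x = 0}.
  apply: (aeS2 _ gf Gf) => x h1 h2 xl; have := xl; rewrite /= in_itv /= => /andP[x0 xl'].
  by rewrite clamp_id ?(ltW x0) ?(ltW xl') // h1 // h2 // subrr.
have := ae_continuous_eq0 l0 ch h0 (x := 0).
rewrite lexx (ltW l0) clamp_id ?lexx ?(ltW l0) // => /(_ isT) /eqP.
by rewrite subr_eq0 => /eqP.
Qed.

Lemma trace0_prim l f g C : 0 < l -> L1 (oI l) g ->
  {ae leb, forall x, oI l x -> f x = C + prim g x} -> trace0 l f = C.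
Proof.
move=> l0 g1 fg; have cp := prim_clamp l0 g1.
rewrite (@trace0_eq l f (fun x => C + prim g (clamp 0 l x))) //.
- rewrite clamp_id ?lexx ?(ltW l0) // /prim /Int set_itv_ge ?Rintegral_set0 ?addr0 //.
  by rewrite bnd_simp ltxx.
- by cont.
move: fg; apply: aeS => x h xl; rewrite h //; have := xl; rewrite /= in_itv /= => /andP[x0 xl'].
by rewrite clamp_id // (ltW x0) (ltW xl').
Qed.

(** Expresses a boundary value by integrals. Unlike a pointwise value, these commute
    with the Laplace transform in time. *)
Lemma weak_moment b f g C : 0 < b -> L1 (oI b) f -> L1 (oI b) g ->
  {ae leb, forall x, oI b x -> f x = C + prim g x} ->
  Int (oI b) f - Int (oI b) (fun x => (b - x) * g x) = b * C.
Proof.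
move=> b0 f1 g1 fg.
have p1 := prim_L1 b0 g1.
rewrite (@ae_Int _ _ f (fun x => C + prim g x)) //; last 2 first.
- exact: L1_meas.
- by apply: measurable_funD => //; exact: L1_meas.
rewrite IntD //; last exact: L1_cst.
rewrite Int_cst ?(ltW b0) // subr0.
have c1 : continuous (fun _ : R => (1 : R)) by exact: ct_cst.
have := prim_test b0 c1 g1.
rewrite (@eq_Int _ _ (fun x => 1 * prim g x) (prim g)); last by move=> x _; rewrite mul1r.
rewrite (@eq_Int _ _ (fun y => g y * _) (fun x => (b - x) * g x)); last first.
  by move=> y _; rewrite !J_cst !mul1r mulrC.
by move=> ->; rewrite addrK.
Qed.

End LebesgueL2.

(** * The Abel kernel and its Laplace transform *)

Section Affine.
Context {R : realType}.
Notation leb := (@lebesgue_measure R).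
Notation mR := (measurableTypeR R).
Notation mset A := (measurable (A : set mR)).
Notation mfun A f := (measurable_fun (A : set mR) (f : mR -> R)).
Implicit Types (c d : R).

Definition affine c d (x : mR) : mR := c * x + d.

Lemma measurable_affine c d : measurable_fun setT (affine c d).
Proof.
apply: (continuous_measurable_fun (f := fun x : R => c * x + d)).
have h : continuous (fun x : R => x) by exact: ct_id.
by cont.
Qed.

Definition push_affine c d : {measure set mR -> \bar R} :=
  measure_function_pushforward__canonical__measure_function_Measure leb (measurable_affine c d).

(** By uniqueness of the Lebesgue measure, checked on half-open intervals. *)
Lemma leb_affine c d (c0 : 0 < c) (A : set mR) : measurable A ->
  leb A = mscale (NngNum (ltW c0)) (push_affine c d) A.
Proof.
apply: lebesgue_measure_unique => X [[a b] _ <-].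
rewrite [RHS](_ : _ = c%:E * leb (affine c d @^-1` `]a, b]))%E; last by [].
have -> : affine c d @^-1` `]a, b] = `](a - d) / c, (b - d) / c]%classic.
  apply/seteqP; split => x /=; rewrite !in_itv /= /affine => /andP[h1 h2].
    by rewrite ltr_pdivrMr // ler_pdivlMr // ltrBlDr lerBrDr ![x * c]mulrC h1 h2.
  by move: h1 h2; rewrite ltr_pdivrMr // ler_pdivlMr // ltrBlDr lerBrDr ![x * c]mulrC => -> ->.
rewrite !lebesgue_measure_itv /= !lte_fin ltr_pM2r ?invr_gt0 // ltrD2r.
case: ifP => ab; last by rewrite mule0.
rewrite -!EFinD -EFinM; congr EFin; field; exact: lt0r_neq0.
Qed.

Lemma integral_affine c d (f : mR -> \bar R) : 0 < c -> measurable_fun setT f ->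
  (forall x, 0 <= f x)%E ->
  (\int[leb]_x f x = c%:E * \int[leb]_x f (c * x + d)%R)%E.
Proof.
move=> c0 mf f0.
rewrite (eq_measure_integral (mscale (NngNum (ltW c0)) (push_affine c d))); last first.
  by move=> A mA _; exact: leb_affine.
rewrite ge0_integral_mscale //; congr (_ * _)%E.
by have := ge0_integral_pushforward (measurable_affine c d) leb measurableT mf (fun x _ => f0 x); rewrite preimage_setT.
Qed.

End Affine.

Section GammaIntegral.
Context {R : realType}.
Notation leb := (@lebesgue_measure R).
Notation mR := (measurableTypeR R).
Notation mset A := (measurable (A : set mR)).
Notation mfun A f := (measurable_fun (A : set mR) (f : mR -> R)).
Implicit Types (alpha s x r : R).
#[local] Hint Resolve mset_itv : core.
#[local] Hint Resolve leb_itv : core.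

(** The Abel kernel with exponential damping. At [s = 0] it is the kernel of the
    Caputo derivative; for [s > 0] it is what exp (- s t) leaves of it once exp (- s
    tau) has been moved to the other factor of the convolution. *)
Definition frac_kernel alpha s (r : R) : R := if 0 < r then r `^ (- alpha) * expR (- (s * r)) else 0.

Lemma frac_kernel_ge0 alpha s r : 0 <= frac_kernel alpha s r.
Proof. by rewrite /frac_kernel; case: ifP => // _; rewrite mulr_ge0 ?powR_ge0 ?expR_ge0. Qed.

Lemma measurable_frac_kernel alpha s : mfun setT (frac_kernel alpha s).
Proof.
apply: measurable_fun_ifT => //; first by apply: measurable_fun_ltr.
apply: measurable_funM; first exact: measurable_powR.
apply: (continuous_measurable_fun (f := fun x : R => expR (- (s * x)))).
have h : continuous (fun x : R => x) by exact: ct_id.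
by cont.
Qed.

Lemma frac_kernel_scale alpha s r : 0 < s -> frac_kernel alpha s r = s `^ alpha * frac_kernel alpha 1 (s * r + 0).
Proof.
move=> s0; rewrite /frac_kernel addr0 pmulr_rgt0 //; case: ifP => r0; last by rewrite mulr0.
rewrite powRM ?(ltW s0) ?(ltW r0) // mul1r !mulrA -powRD ?subrr ?powRr0 ?mul1r //.
by apply/implyP => _; rewrite gt_eqF.
Qed.

Definition frac_mass alpha s : \bar R := (\int[leb]_r (frac_kernel alpha s r)%:E)%E.

Lemma frac_mass_scale alpha s : 0 < s -> frac_mass alpha s = ((s `^ (alpha - 1))%:E * frac_mass alpha 1)%E.
Proof.
move=> s0; rewrite /frac_mass [in RHS](@integral_affine _ s 0 (fun r => (frac_kernel alpha 1 r)%:E)) //; last 2 first.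
- by apply/measurable_EFinP; exact: measurable_frac_kernel.
- by move=> x; rewrite lee_fin frac_kernel_ge0.
rewrite muleA -EFinM -ge0_integralZl //; last 3 first.
- apply/measurable_EFinP; apply: (measurableT_comp (measurable_frac_kernel _ _)); exact: (measurable_affine s 0).
- by move=> x _; rewrite lee_fin frac_kernel_ge0.
- by rewrite lee_fin mulr_ge0 ?powR_ge0 // ltW.
apply: eq_integral => x _; rewrite -EFinM frac_kernel_scale // powRD ?powRrN ?powRr1 ?(ltW s0) //; last first.
  by apply/implyP => _; rewrite gt_eqF.
by rewrite powR_inv1 ?(ltW s0) // divfK // gt_eqF.
Qed.

Lemma powR_cont x alpha : 0 < x -> {for x, continuous (fun y : R => y `^ alpha)}.
Proof.
move=> x0; have [d _] := is_derive1_powR alpha x0.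
by apply: differentiable_continuous; exact/derivable1_diffP.
Qed.

Lemma powR_FTC alpha e : alpha < 1 -> 0 < e -> e < 1 ->
  (\int[leb]_(x in `[e, 1%R]) (x `^ (- alpha))%:E <= ((1 - alpha)^-1)%:E)%E.
Proof.
move=> a1 e0 e1.
have a1' : 1 - alpha != 0 by rewrite subr_eq0 gt_eqF.
pose F (x : R) : R := (1 - alpha)^-1 * x `^ (1 - alpha).
have dF x : 0 < x -> is_derive x 1 F (x `^ (- alpha)).
  move=> x0; have d := is_derive1_powR (1 - alpha) x0.
  have d2 : is_derive x (1 : R) (fun _ : R => (1 - alpha)^-1) 0 by exact: is_derive_cst.
  apply: (is_derive_ext (is_deriveM d2 d)) => //.
  rewrite scaler0 addr0 /GRing.scale /= mulrA mulVf // mul1r; congr (_ `^ _); ring.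
have cF x : 0 < x -> {for x, continuous F}.
  by move=> x0; have [d _] := dF x x0; apply: differentiable_continuous; exact/derivable1_diffP.
rewrite (@continuous_FTC2 _ _ F) //.
- rewrite -EFinB lee_fin /F powR1 mulr1 gerBl mulr_ge0 ?powR_ge0 // invr_ge0; lra.
- apply: continuous_in_subspaceT => x; rewrite inE /= in_itv /= => /andP[ex _].
  by apply: powR_cont; lra.
- split.
  + by move=> x; rewrite in_itv /= => /andP[ex _]; have [] := dF x (lt_trans e0 ex).
  + by apply: cvg_at_right_filter; exact: cF.
  + by apply: cvg_at_left_filter; exact: (cF 1 ltr01).
- move=> x; rewrite in_itv /= => /andP[ex _].
  by rewrite derive1E; have [_ ->] := dF x (lt_trans e0 ex).
Qed.

Lemma powR_lty alpha : alpha < 1 ->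
  (\int[leb]_(x in `]0%R, 1%R]) (x `^ (- alpha))%:E < +oo)%E.
Proof.
move=> a1.
pose F (n : nat) : set mR := `[(n.+2%:R)^-1, 1]%classic.
have -> : `]0, 1]%classic = \bigcup_n F n.
  apply/seteqP; split => x /=; rewrite in_itv /=.
    move=> /andP[x0 x1]; have /ltr_add_invr [n /= nx] := x0.
    exists n => //; rewrite /F /= in_itv /= x1 andbT.
    rewrite add0r in nx; apply: le_trans (ltW nx).
    by rewrite lef_pV2 ?posrE ?ltr0n // ler_nat.
  by move=> [n _]; rewrite /F /= in_itv /= => /andP[nx ->]; rewrite (lt_le_trans _ nx).
have h := @ge0_nondecreasing_set_cvg_integral _ _ _ F (fun x => (x `^ (- alpha))%:E) leb.
apply: (@le_lt_trans _ _ ((1 - alpha)^-1)%:E); last by rewrite ltry.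
apply: (cvge_le _ (h _ _ _ _)).
- apply: nearW => n; apply: powR_FTC => //.
  by rewrite invf_lt1 // ltr1n.
- move=> m n mn; apply/subsetPset; apply: subset_itvr; rewrite bnd_simp.
  by rewrite lef_pV2 ?posrE ?ltr0n // ler_nat !ltnS.
- by move=> n; exact: measurable_itv.
- by move=> n; apply: measurable_funTS; apply/measurable_EFinP; exact: measurable_powR.
- by move=> n x _; rewrite lee_fin powR_ge0.
Qed.

Lemma expR_lty : (\int[leb]_(x in `[1%R, +oo[) (expR (- x))%:E < +oo)%E.
Proof.
have d (x : R) : is_derive x 1 (fun y : R => - expR (- y)) (expR (- x)).
  have dN : is_derive (x : R) 1 (fun y : R => 0 + (-1) * y) (-1) by exact: is_derive_affine.
  have dN' : is_derive (x : R) 1 (fun y : R => - y) (-1).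
    by apply: (is_derive_ext dN) => // y; rewrite add0r mulN1r.
  have de : is_derive (- x : R) 1 (@expR R) (expR (- x)) by exact: is_derive_expR.
  apply: (is_derive_ext (is_deriveN (@is_derive1_comp _ (@expR R) (fun y : R => - y) x _ _ de dN'))) => //.
  by rewrite mulrN1 opprK.
have cE : continuous (fun y : R => expR (- y)).
  by have h : continuous (fun x : R => x) by [exact: ct_id]; cont.
rewrite (@ge0_continuous_FTC2y _ _ (fun y => - expR (- y)) 1 0).
- by rewrite sub0e /= ltry.
- by move=> x _; exact: expR_ge0.
- exact: continuous_subspaceT.
- by rewrite -oppr0; apply: cvgN; exact: cvgr_expR.
- by move=> x _; have [] := d x.
- by apply: cvg_at_right_filter; apply: cvgN; exact: cE.
- by move=> x _; rewrite derive1E; have [_ ->] := d x.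
Qed.

(** Comparison with r^(- alpha) on ]0, 1] and with exp (- r) beyond. *)
Lemma frac_mass_lty alpha : 0 < alpha -> alpha < 1 -> (frac_mass alpha 1 < +oo)%E.
Proof.
move=> a0 a1.
pose f1 := (fun x : mR => (x `^ (- alpha))%:E) \_ (`]0%R, 1%R]%classic).
pose f2 := (fun x : mR => (expR (- x))%:E) \_ (`[1%R, +oo[%classic).
have m1 : measurable_fun setT f1.
  apply/(measurable_restrictT _ (mset_itv _)); apply/measurable_EFinP; apply: measurable_funTS.
  exact: measurable_powR.
have m2 : measurable_fun setT f2.
  apply/(measurable_restrictT _ (mset_itv _)); apply/measurable_EFinP; apply: measurable_funTS.
  apply: (continuous_measurable_fun (f := fun x : R => expR (- x))).
  by have h : continuous (fun x : R => x) by [exact: ct_id]; cont.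
have f10 x : (0 <= f1 x)%E by rewrite /f1 patchE; case: ifP => // _; rewrite lee_fin powR_ge0.
have f20 x : (0 <= f2 x)%E by rewrite /f2 patchE; case: ifP => // _; rewrite lee_fin expR_ge0.
apply: (@le_lt_trans _ _ (\int[leb]_x (f1 x + f2 x))%E); last first.
  rewrite ge0_integralD // -!integral_mkcond lte_add_pinfty //; [exact: powR_lty|exact: expR_lty].
apply: ge0_le_integral => //.
- by move=> x _; rewrite lee_fin frac_kernel_ge0.
- by apply/measurable_EFinP; exact: measurable_frac_kernel.
- exact: emeasurable_funD.
move=> x _; rewrite /frac_kernel mul1r; case: ifP => x0; last by apply: adde_ge0.
have [x1|x1] := leP x 1.
  rewrite -[leLHS]adde0 leeD // /f1 patchE mem_set ?lee_fin /= ?in_itv /= ?x0 //.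
  by rewrite ler_piMr ?powR_ge0 // expR_le1 oppr_le0 ltW.
rewrite -[leLHS]add0e leeD // /f2 patchE mem_set ?lee_fin /= ?in_itv /= ?(ltW x1) //.
rewrite ler_piMl ?expR_ge0 // powRN invf_le1 ?powR_gt0 //.
have -> : 1 = (1 : R) `^ alpha by rewrite powR1.
by apply: ge0_ler_powR; rewrite ?nnegrE ?(ltW a0) ?(ltW x0) ?(ltW x1).
Qed.

Lemma frac_mass_gt0 alpha : 0 < alpha -> (0 < frac_mass alpha 1)%E.
Proof.
move=> a0.
pose c : R := 2 `^ (- alpha) * expR (- 2).
apply: (@lt_le_trans _ _ (\int[leb]_(x in `[1%R, 2%R]) c%:E)%E).
  rewrite integral_cst //= lebesgue_measure_itv /= lte_fin ltr1n.
  by rewrite -EFinD -EFinM lte_fin mulr_gt0 ?mulr_gt0 ?powR_gt0 ?expR_gt0 //; lra.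
apply: (@le_trans _ _ (\int[leb]_(x in `[1%R, 2%R]) (frac_kernel alpha 1 x)%:E)%E).
  apply: ge0_le_integral => //.
  - by move=> x _; rewrite lee_fin mulr_ge0 ?powR_ge0 ?expR_ge0.
  - by apply/measurable_EFinP; apply: measurable_funTS; exact: measurable_frac_kernel.
  - move=> x; rewrite /= in_itv /= => /andP[x1 x2]; have x0 : 0 < x by lra.
    rewrite lee_fin /frac_kernel x0 mul1r ler_pM ?powR_ge0 ?expR_ge0 ?ler_expR ?lerN2 //.
    rewrite !powRN lef_pV2 ?posrE ?powR_gt0 //.
    by apply: ge0_ler_powR; rewrite ?nnegrE ?(ltW a0) ?(ltW x0).
apply: ge0_subset_integral => //.
- by apply/measurable_EFinP; exact: measurable_frac_kernel.
- by move=> x _; rewrite lee_fin frac_kernel_ge0.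
Qed.

Definition frac_gamma alpha : R := fine (frac_mass alpha 1).

Lemma frac_massE alpha s : 0 < alpha -> alpha < 1 -> 0 < s -> frac_mass alpha s = (s `^ (alpha - 1) * frac_gamma alpha)%:E.
Proof.
move=> a0 a1 s0; rewrite frac_mass_scale // EFinM /frac_gamma fineK // ge0_fin_numE ?frac_mass_lty // ltW //.
exact: frac_mass_gt0.
Qed.

Lemma frac_gamma_gt0 alpha : 0 < alpha -> alpha < 1 -> 0 < frac_gamma alpha.
Proof. by move=> a0 a1; rewrite /frac_gamma fine_gt0 // frac_mass_gt0 // frac_mass_lty. Qed.

Lemma GammaE alpha : Gamma (1 - alpha) = frac_gamma alpha.
Proof.
rewrite /Gamma /frac_gamma /Rintegral; congr fine.
rewrite integral_mkcond; apply: eq_integral => x _; rewrite patchE /frac_kernel mul1r.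
have -> : 1 - alpha - 1 = - alpha by ring.
case: ifPn => [|]; rewrite ?inE ?notin_setE /= in_itv /= andbT => x0; first by rewrite x0.
by move/negP/negbTE : x0 => ->.
Qed.

Notation oI b := (`]0%R, b[%classic).

Lemma integral_frac_kernel_shift alpha s tau : 0 < alpha -> alpha < 1 -> 0 < s ->
  (\int[leb]_t (frac_kernel alpha s (t - tau))%:E)%E = (s `^ (alpha - 1) * frac_gamma alpha)%:E.
Proof.
move=> a0 a1 s0.
have mk : measurable_fun setT (fun r : mR => (frac_kernel alpha s r)%:E).
  by apply/measurable_EFinP; exact: measurable_frac_kernel.
have k0 (r : mR) : (0 <= (frac_kernel alpha s r)%:E)%E by rewrite lee_fin frac_kernel_ge0.
have := integral_affine (- tau) ltr01 mk k0.
rewrite -/(frac_mass alpha s) frac_massE // mul1e => ->.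
by apply: eq_integral => x _; rewrite mul1r.
Qed.

Lemma measurable_frac_kernel_shift alpha s tau : mfun setT (fun t => frac_kernel alpha s (t - tau)).
Proof.
apply: (measurableT_comp (measurable_frac_kernel _ _)).
by have := measurable_affine 1 (- tau); rewrite /affine; under eq_fun do rewrite mul1r.
Qed.

Lemma frac_kernel_shift_L1 alpha s tau : 0 < alpha -> alpha < 1 -> 0 < s ->
  L1 setT (fun t => frac_kernel alpha s (t - tau)).
Proof.
move=> a0 a1 s0; apply/integrableP; split.
  by apply/measurable_EFinP; exact: measurable_frac_kernel_shift.
have := @integral_frac_kernel_shift alpha s tau a0 a1 s0.
rewrite (eq_integral (fun x : mR => `|(EFin \o (fun t => frac_kernel alpha s (t - tau))) x|)%E); first by move=> ->; rewrite ltry.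
by move=> x _ /=; rewrite ger0_norm // frac_kernel_ge0.
Qed.

Lemma Int_frac_kernel_shift alpha s tau : 0 < alpha -> alpha < 1 -> 0 < s ->
  Int setT (fun t => frac_kernel alpha s (t - tau)) = s `^ (alpha - 1) * frac_gamma alpha.
Proof. by move=> a0 a1 s0; rewrite /Int /Rintegral integral_frac_kernel_shift. Qed.

(** Beyond [T], half of the damping is spent on the small factor and the other half
    keeps the kernel integrable. *)
Lemma frac_kernel_tail alpha s T tau : 0 < alpha -> alpha < 1 -> 0 < s -> oI T tau ->
  `|Int (oI T) (fun t => frac_kernel alpha s (t - tau)) - s `^ (alpha - 1) * frac_gamma alpha| <=
  expR (- (s / 2 * (T - tau))) * ((s / 2) `^ (alpha - 1) * frac_gamma alpha).
Proof.
move=> a0 a1 s0; rewrite /= in_itv /= => /andP[t0 tT].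
have s20 : 0 < s / 2 by rewrite divr_gt0.
have f1 := @frac_kernel_shift_L1 alpha s tau a0 a1 s0.
have h1 := @frac_kernel_shift_L1 alpha (s / 2) tau a0 a1 s20.
pose P (t : R) := (0 < t) && (t < T).
have restr : Int setT (fun t => (P t)%:R * frac_kernel alpha s (t - tau)) = Int (oI T) (fun t => frac_kernel alpha s (t - tau)).
  by apply: Int_restr => x /=; rewrite in_itv /=; split => [//|[]].
have mP : mfun setT (fun t => (P t)%:R : R).
  rewrite (_ : (fun t => _) = (fun t : mR => if (0 < t) && (t < T) then (1 : R) else 0)); last first.
    by apply/funext => z; rewrite /P; case: ifP.
  by apply: measurable_fun_ifT => //; apply: measurable_and; exact: measurable_fun_ltr.
have P1 t : `|(P t)%:R : R| <= 1 by case: (P t); rewrite ?normr1 ?normr0.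
have Pf1 : L1 setT (fun t => (P t)%:R * frac_kernel alpha s (t - tau)).
  by apply: (@L1_mul _ _ _ _ 1) => // t _; exact: P1.
rewrite -restr -(@Int_frac_kernel_shift alpha s tau) // -(@Int_frac_kernel_shift alpha (s / 2) tau) //.
rewrite -IntB // -IntZ //.
apply: le_trans (Int_norm measurableT (L1_sub measurableT Pf1 f1)) _.
apply: Int_le => //.
- by apply: L1_norm => //; exact: L1_sub.
- exact: L1_scale.
move=> t _; rewrite /P; have g0 u := frac_kernel_ge0 alpha u (t - tau).
have [t00|t00] /= := ltP 0 t; last first.
  have -> : frac_kernel alpha s (t - tau) = 0 by rewrite /frac_kernel ifF //; apply/negbTE; rewrite -leNgt; lra.
  by rewrite mul0r sub0r oppr0 normr0 mulr_ge0 ?expR_ge0.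
have [tT'|tT'] := ltP t T; first by rewrite mul1r subrr normr0 mulr_ge0 ?expR_ge0.
have tt : 0 < t - tau by lra.
rewrite mul0r sub0r normrN ger0_norm // /frac_kernel tt.
rewrite mulrCA ler_wpM2l ?powR_ge0 // -expRD ler_expR.
have : s * (T - tau) <= s * (t - tau) by apply: ler_wpM2l; [exact: ltW|lra].
lra.
Qed.

Lemma frac_kernel_exp alpha s t tau : expR (- (s * t)) * frac_kernel alpha 0 (t - tau) =
  expR (- (s * tau)) * frac_kernel alpha s (t - tau).
Proof.
rewrite /frac_kernel; case: ifP => _; last by rewrite !mulr0.
rewrite mul0r oppr0 expR0 mulr1 mulrCA [LHS]mulrC; congr (_ * _).
by rewrite -expRD; congr expR; ring.
Qed.

(** The weight exp (- s t) is at most exp (- s (t - tau)), so the total mass of the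
    damped kernel bounds the integrals in [t]. *)
Lemma L1p_frac_kernel alpha s T g : 0 < alpha -> alpha < 1 -> 0 < s -> L1 (oI T) g ->
  L1p (oI T) (oI T) (fun z => (expR (- (s * z.1)) * frac_kernel alpha 0 (z.1 - z.2)) * g z.2).
Proof.
move=> a0 a1 s0 g1.
apply: (@L1p_kernel _ _ _ _ _ (fun z => expR (- (s * z.1)) * frac_kernel alpha 0 (z.1 - z.2)) g
  (s `^ (alpha - 1) * frac_gamma alpha)) => //.
  apply: measurable_funTS; apply: measurable_funM.
    apply: (measurableT_comp (continuous_measurable_fun (f := fun x : R => expR (- (s * x))) _)); last exact: measurable_fst.
    by have h : continuous (fun x : R => x) by [exact: ct_id]; cont.
  apply: (measurableT_comp (measurable_frac_kernel _ _)).
  by apply: measurable_funB; [exact: measurable_fst|exact: measurable_snd].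
move=> tau; rewrite /= in_itv /= => /andP[t0 _].
rewrite -(@integral_frac_kernel_shift alpha s tau) //.
apply: (@le_trans _ _ (\int[leb]_(t in oI T) (frac_kernel alpha s (t - tau))%:E)%E); last first.
  apply: ge0_subset_integral => //.
  - by apply/measurable_EFinP; exact: measurable_frac_kernel_shift.
  - by move=> x _; rewrite lee_fin frac_kernel_ge0.
apply: ge0_le_integral => //.
- apply/measurable_EFinP; apply: measurableT_comp => //; apply: measurable_funTS.
  under eq_fun do rewrite frac_kernel_exp.
  by apply: measurable_funM => //; exact: measurable_frac_kernel_shift.
- by apply/measurable_EFinP; apply: measurable_funTS; exact: measurable_frac_kernel_shift.
move=> t _; rewrite lee_fin frac_kernel_exp ger0_norm ?mulr_ge0 ?expR_ge0 ?frac_kernel_ge0 //.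
by rewrite ler_piMl ?frac_kernel_ge0 // expR_le1 oppr_le0 mulr_ge0 // ltW.
Qed.

Lemma frac_kernel_conv alpha s T g : 0 < alpha -> alpha < 1 -> 0 < s -> L1 (oI T) g ->
  {ae leb, forall t, oI T t ->
    Int (oI T) (fun tau => (expR (- (s * t)) * frac_kernel alpha 0 (t - tau)) * g tau) =
    expR (- (s * t)) * Int (oI T) (fun tau => frac_kernel alpha 0 (t - tau) * g tau)}.
Proof.
move=> a0 a1 s0 g1; have K := L1p_frac_kernel a0 a1 s0 g1.
have mI : mset (oI T) by [].
have := fubini_ae mI mI K; apply: aeS => t /= Kt It; have {}Kt := Kt It.
rewrite -IntZ //; first by apply: eq_Int => tau _; rewrite mulrA.
have := L1_scale (expR (s * t)) mI Kt; apply: L1_eq => // tau _.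
by rewrite !mulrA -expRD subrr expR0 mul1r.
Qed.

(** The convolution theorem on a bounded interval: after Fubini the inner integral
    only misses the mass beyond [T], and the bound of [frac_kernel_tail] combines
    with exp (- s tau) into exp (- s T / 2) uniformly in tau. *)
Lemma frac_kernel_laplace alpha s T g : 0 < alpha -> alpha < 1 -> 0 < s -> L1 (oI T) g ->
  `|Int (oI T) (fun t => Int (oI T) (fun tau => (expR (- (s * t)) * frac_kernel alpha 0 (t - tau)) * g tau))
    - s `^ (alpha - 1) * frac_gamma alpha * Int (oI T) (fun tau => expR (- (s * tau)) * g tau)| <=
  expR (- (s * T / 2)) * ((s / 2) `^ (alpha - 1) * frac_gamma alpha) * Int (oI T) (fun tau => `|g tau|).
Proof.
move=> a0 a1 s0 g1; have K := L1p_frac_kernel a0 a1 s0 g1.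
have mI : mset (oI T) by [].
have cE : continuous (fun t : R => expR (- (s * t))).
  by have h : continuous (fun x : R => x) by [exact: ct_id]; cont.
have f1 tau := @frac_kernel_shift_L1 alpha s tau a0 a1 s0.
have f1' tau : L1 (oI T) (fun t => frac_kernel alpha s (t - tau)).
  by apply: (L1_subset _ _ _ (f1 tau)).
rewrite (fubini_swap mI mI K) /=.
have E tau : oI T tau -> Int (oI T) (fun t => (expR (- (s * t)) * frac_kernel alpha 0 (t - tau)) * g tau) =
   g tau * (expR (- (s * tau)) * Int (oI T) (fun t => frac_kernel alpha s (t - tau))).
  move=> It; rewrite -IntZ // -IntZ //; last exact: L1_scale.
  by apply: eq_Int => t _; rewrite frac_kernel_exp [RHS]mulrC.
rewrite (eq_Int E).
have l1 : L1 (oI T) (fun tau => g tau * (expR (- (s * tau)) * Int (oI T) (fun t => frac_kernel alpha s (t - tau)))).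
  by have := fubini_L2 mI mI K; apply: L1_eq => // tau It /=; exact: E.
have l2 : L1 (oI T) (fun tau => s `^ (alpha - 1) * frac_gamma alpha * (expR (- (s * tau)) * g tau)).
  by apply: L1_scale => //; exact: cont_L1_mul.
rewrite -IntZ //; last exact: cont_L1_mul.
rewrite -IntB //; apply: le_trans (Int_norm mI (L1_sub mI l1 l2)) _.
rewrite -IntZ //; last exact: L1_norm.
apply: Int_le => //.
- by apply: L1_norm => //; exact: L1_sub.
- by apply: L1_scale => //; exact: L1_norm.
move=> tau It.
rewrite (_ : _ - _ = g tau * (expR (- (s * tau)) * (Int (oI T) (fun t => frac_kernel alpha s (t - tau)) - s `^ (alpha - 1) * frac_gamma alpha))); last by ring.
rewrite normrM [X in _ <= X]mulrC ler_wpM2l // normrM ger0_norm ?expR_ge0 //.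
have h := frac_kernel_tail a0 a1 s0 It; have g0 := frac_gamma_gt0 a0 a1.
apply: le_trans (ler_wpM2l (expR_ge0 _) h) _.
rewrite [leLHS]mulrA; apply: ler_wpM2r; first by rewrite mulr_ge0 ?powR_ge0 // ltW.
rewrite -expRD ler_expR.
move: It; rewrite /= in_itv /= => /andP[t0 tT].
have : 0 <= s * tau by rewrite mulr_ge0 // ltW.
lra.
Qed.

End GammaIntegral.

(** * The truncated Laplace transform in time *)

Section Hat.
Context {R : realType}.
Notation leb := (@lebesgue_measure R).
Notation mR := (measurableTypeR R).
Notation mset A := (measurable (A : set mR)).
Notation mfun A f := (measurable_fun (A : set mR) (f : mR -> R)).
Notation oI b := (`]0%R, b[%classic).
Implicit Types (A B : set R) (f g h phi psi : R -> R) (a b c x l T r s : R) (u v w : R * R -> R).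
#[local] Hint Resolve mset_itv : core.
#[local] Hint Resolve leb_itv : core.

(** Replacing [f] by the minimum of [f] and [g] makes the inequality hold
    everywhere. *)
Lemma Int_le_ae A f g : mset A -> L1 A f -> L1 A g ->
  {ae leb, forall x, A x -> f x <= g x} -> Int A f <= Int A g.
Proof.
move=> mA f1 g1 fg.
have m1 : L1 A (fun x => Num.min (f x) (g x)).
  have := L1_scale 2^-1 mA (L1_sub mA (L1_add mA f1 g1) (L1_norm mA (L1_sub mA f1 g1))).
  apply: L1_eq => // x _; rewrite minr_absE mulrC //.
rewrite (@ae_Int _ A f (fun x => Num.min (f x) (g x))) //; try exact: L1_meas.
- by apply: Int_le => // x _; rewrite ge_min lexx orbT.
by move: fg; apply: aeS => x h Ax; apply/esym/min_idPl; exact: h.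
Qed.

Lemma ae_and (P Q : R -> Prop) : {ae leb, forall x, P x} -> {ae leb, forall x, Q x} ->
  {ae leb, forall x, P x /\ Q x}.
Proof. by apply: aeS2 => x p q; split. Qed.

Lemma cont_expN s : continuous (fun t : R => expR (- (s * t))).
Proof. by have h : continuous (fun x : R => x) by [exact: ct_id]; cont. Qed.

Lemma L1p_mul2 A b1 b2 phi u : mset A -> continuous phi -> L1p A `]b1, b2[ u ->
  L1p A `]b1, b2[ (fun z => phi z.2 * u z).
Proof.
move=> mA cphi u1; have [M _ hM] := cont_itv_bounded b1 b2 cphi.
apply: (@L1p_mul _ _ _ mA (mset_itv _) (fun z => phi z.2) _ M) => //; last by move=> x y _ /hM.
apply: measurable_funTS; apply: (measurableT_comp (continuous_measurable_fun cphi)); exact: measurable_snd.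
Qed.

Lemma L1p_mul1 A b1 b2 phi u : mset A -> continuous phi -> L1p `]b1, b2[ A u ->
  L1p `]b1, b2[ A (fun z => phi z.1 * u z).
Proof.
move=> mA cphi u1; have [M _ hM] := cont_itv_bounded b1 b2 cphi.
apply: (@L1p_mul _ _ _ (mset_itv _) mA (fun z => phi z.1) _ M) => //; last by move=> x y /hM.
apply: measurable_funTS; apply: (measurableT_comp (continuous_measurable_fun cphi)); exact: measurable_fst.
Qed.

Lemma L1p_norm A B u : mset A -> mset B -> L1p A B u -> L1p A B (fun z => `|u z|).
Proof. by move=> mA mB u1; have := integrable_abse u1. Qed.

Lemma L1p_subset A A' B u : mset A -> mset A' -> mset B -> A' `<=` A -> L1p A B u -> L1p A' B u.
Proof.
move=> mA mA' mB AA; apply: integrableS; [exact: measurableX|exact: measurableX|].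
by move=> [x y] [/= Ax By]; split => //; exact: AA.
Qed.

(** Truncated at [T], the end of the time interval where the solutions live; all
    errors due to the truncation are exponentially small in [s]. *)
Definition laplace T s u x : R := Int (oI T) (fun t => expR (- (s * t)) * u (x, t)).

(** The weights in [x] and in [t] are separate continuous factors; with different
    choices this covers test functions, moments and slices. *)
Lemma swap_mul a1 a2 b1 b2 phi psi u : continuous phi -> continuous psi ->
  L1p `]a1, a2[ `]b1, b2[ u ->
  Int `]a1, a2[ (fun x => phi x * Int `]b1, b2[ (fun t => psi t * u (x, t))) =
  Int `]b1, b2[ (fun t => psi t * Int `]a1, a2[ (fun x => phi x * u (x, t))).
Proof.
move=> cphi cpsi u1.
have v1 : L1p `]a1, a2[ `]b1, b2[ (fun z => psi z.2 * u z) by exact: L1p_mul2.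
have w1 : L1p `]a1, a2[ `]b1, b2[ (fun z => phi z.1 * (psi z.2 * u z)) by exact: L1p_mul1.
have v2 : L1p `]a1, a2[ `]b1, b2[ (fun z => phi z.1 * u z) by exact: L1p_mul1.
transitivity (Int `]a1, a2[ (fun x => Int `]b1, b2[ (fun t => phi x * (psi t * u (x, t))))).
  apply: ae_Int => //.
  - by apply: measurable_funM; [exact: cont_mfun|apply: L1_meas; exact: (fubini_L1 _ _ v1)].
  - by apply: L1_meas; exact: (fubini_L1 _ _ w1).
  have := fubini_ae (mset_itv _) (mset_itv _) v1; apply: aeS => x h Ax /=.
  by rewrite IntZ //; exact: (h Ax).
rewrite (fubini_swap _ _ w1) //=.
apply: ae_Int => //.
- by apply: L1_meas; exact: (fubini_L2 _ _ w1).
- by apply: measurable_funM; [exact: cont_mfun|apply: L1_meas; exact: (fubini_L2 _ _ v2)].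
have := fubini_ae2 (mset_itv _) (mset_itv _) v2; apply: aeS => t h It /=.
rewrite -IntZ //; last exact: (h It).
by apply: eq_Int => x _; ring.
Qed.

Lemma laplace_L1 l T s u : L1p (oI l) (oI T) u -> L1 (oI l) (laplace T s u).
Proof.
move=> u1; have v1 := L1p_mul2 (mset_itv _) (@cont_expN s) u1.
exact: (fubini_L1 _ _ v1).
Qed.

Definition mass l T u : R := Int (oI l) (fun x => Int (oI T) (fun t => `|u (x, t)|)).

Lemma laplace_mass l T s u : 0 <= s -> L1p (oI l) (oI T) u -> Int (oI l) (fun x => `|laplace T s u x|) <= mass l T u.
Proof.
move=> s0 u1.
have n1 := L1p_norm (mset_itv _) (mset_itv _) u1.
apply: Int_le_ae => //.
- by apply: L1_norm => //; exact: laplace_L1.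
- exact: (fubini_L1 _ _ n1).
have := fubini_ae (mset_itv _) (mset_itv _) u1; apply: aeS => x h Ax /=; have {}h := h Ax.
have h' := cont_L1_mul (@cont_expN s) h.
apply: le_trans (Int_norm (mset_itv _) h') _; apply: Int_le => //; try exact: L1_norm.
move=> t; rewrite /= in_itv /= => /andP[t0 _]; rewrite normrM ger0_norm ?expR_ge0 //.
by rewrite ler_piMl // expR_le1 oppr_le0 mulr_ge0 // ltW.
Qed.

Definition weak_dx_ae l T u v := {ae leb, forall t, oI T t ->
    is_weak_deriv l (fun x => u (x, t)) (fun x => v (x, t))}.

(** By [swap_mul], with the test function as weight in [x] and the exponential as
    weight in [t]. *)
Lemma laplace_weak_deriv l T s u v : 0 < l -> L1p (oI l) (oI T) u -> L1p (oI l) (oI T) v ->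
  weak_dx_ae l T u v -> is_weak_deriv l (laplace T s u) (laplace T s v).
Proof.
move=> l0 u1 v1 uv phi tphi.
have cphi := test_cont tphi; have cdphi := test_cont (test_deriv tphi).
rewrite -/(Int _ _) -/(Int _ _).
transitivity (Int (oI l) (fun x => derive1 phi x * laplace T s u x)).
  by apply: eq_Int => x _; rewrite mulrC.
transitivity (- Int (oI l) (fun x => phi x * laplace T s v x)); last first.
  by congr (- _); apply: eq_Int => x _; rewrite mulrC.
have e1 := swap_mul cdphi (@cont_expN s) u1.
have e2 := swap_mul cphi (@cont_expN s) v1.
have L1u : L1 (oI T) (fun t => expR (- (s * t)) * Int (oI l) (fun x => derive1 phi x * u (x, t))).
  by apply: cont_L1_mul; [exact: cont_expN|exact: (fubini_L2 _ _ (L1p_mul1 (mset_itv _) cdphi u1))].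
have L1v : L1 (oI T) (fun t => expR (- (s * t)) * Int (oI l) (fun x => phi x * v (x, t))).
  by apply: cont_L1_mul; [exact: cont_expN|exact: (fubini_L2 _ _ (L1p_mul1 (mset_itv _) cphi v1))].
rewrite /laplace e1 e2 -(IntN (mset_itv _) L1v).
apply: ae_Int; [exact: mset_itv|exact: (L1_meas L1u)|exact: (L1_meas (L1_opp (mset_itv _) L1v))|].
move: uv; rewrite /weak_dx_ae; apply: aeS => t h It; rewrite -[RHS]mulrN; congr (_ * _).
have := h It _ tphi; rewrite -/(Int _ _) -/(Int _ _) => E.
transitivity (Int (oI l) (fun x => u (x, t) * derive1 phi x)).
  by apply: eq_Int => x _; rewrite mulrC.
by rewrite E; congr (- _); apply: eq_Int => x _; rewrite mulrC.
Qed.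

(** The combination of [weak_moment], that is [l] times the trace at 0; unlike
    [trace0] it is visibly integrable in [t]. *)
Definition trace_moment l u v (t : R) : R :=
  Int (oI l) (fun x => 1 * u (x, t)) - Int (oI l) (fun x => (l - x) * v (x, t)).

Lemma cont_lx l : continuous (fun x : R => l - x).
Proof. by have h : continuous (fun x : R => x) by [exact: ct_id]; cont. Qed.

Lemma cont_one : continuous (fun x : R => (1 : R)).
Proof. exact: ct_cst. Qed.

Lemma trace_moment_L1 l T u v : L1p (oI l) (oI T) u -> L1p (oI l) (oI T) v -> L1 (oI T) (trace_moment l u v).
Proof.
move=> u1 v1; apply: L1_sub => //.
  exact: (fubini_L2 _ _ (L1p_mul1 (mset_itv _) cont_one u1)).
exact: (fubini_L2 _ _ (L1p_mul1 (mset_itv _) (@cont_lx l) v1)).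
Qed.

Lemma trace_momentE l T u v : 0 < l -> L1p (oI l) (oI T) u -> L1p (oI l) (oI T) v ->
  weak_dx_ae l T u v ->
  {ae leb, forall t, oI T t -> trace_moment l u v t = l * trace0 l (fun x => u (x, t))}.
Proof.
move=> l0 u1 v1.
have U := fubini_ae2 (mset_itv _) (mset_itv _) u1.
have V := fubini_ae2 (mset_itv _) (mset_itv _) v1.
apply: aeS2 (aeI_set U V) => t h1 h2 It; have [ut vt] := h1 It; have w := h2 It.
have [C CE] := weak_deriv_prim l0 ut vt w.
rewrite (trace0_prim l0 vt CE) -(weak_moment l0 ut vt CE) /trace_moment; congr (_ - _).
by apply: eq_Int => x _; rewrite mul1r.
Qed.

(** The constant is pinned down by the transform of the trace, so that it is the
    same for two solutions with the same boundary values. *)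
Lemma laplace_primitive l T s u v : 0 < l -> L1p (oI l) (oI T) u -> L1p (oI l) (oI T) v ->
  weak_dx_ae l T u v ->
  exists C, {ae leb, forall x, oI l x -> laplace T s u x = C + prim (laplace T s v) x} /\
    l * C = Int (oI T) (fun t => expR (- (s * t)) * trace_moment l u v t).
Proof.
move=> l0 u1 v1 uv.
have hu := laplace_L1 s u1; have hv := laplace_L1 s v1.
have [C CE] := weak_deriv_prim l0 hu hv (laplace_weak_deriv s l0 u1 v1 uv).
exists C; split => //; rewrite -(weak_moment l0 hu hv CE).
have e1 := swap_mul cont_one (@cont_expN s) u1.
have e2 := swap_mul (@cont_lx l) (@cont_expN s) v1.
rewrite -/(laplace T s v _) in e2.
transitivity (Int (oI T) (fun t => expR (- (s * t)) * Int (oI l) (fun x => 1 * u (x, t)))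
  - Int (oI T) (fun t => expR (- (s * t)) * Int (oI l) (fun x => (l - x) * v (x, t)))).
  by rewrite -e1 -e2; congr (_ - _); apply: eq_Int => x _; rewrite mul1r.
have L1u : L1 (oI T) (fun t => expR (- (s * t)) * Int (oI l) (fun x => 1 * u (x, t))).
  by apply: cont_L1_mul; [exact: cont_expN|exact: (fubini_L2 _ _ (L1p_mul1 (mset_itv _) cont_one u1))].
have L1v : L1 (oI T) (fun t => expR (- (s * t)) * Int (oI l) (fun x => (l - x) * v (x, t))).
  by apply: cont_L1_mul; [exact: cont_expN|exact: (fubini_L2 _ _ (L1p_mul1 (mset_itv _) (@cont_lx l) v1))].
rewrite -(IntB (mset_itv _) L1u L1v).
by apply: eq_Int => t _; rewrite mulrBr.
Qed.

Lemma ae_exists (P : R -> Prop) d : 0 < d -> {ae leb, forall x, P x} -> exists2 x, 0 < x < d & P x.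
Proof.
move=> d0 [N [mN N0 sN]]; apply: contrapT => h.
have sub : oI d `<=` N.
  by move=> x; rewrite /= in_itv /= => xd; apply: sN => /= Px; apply: h; exists x.
have : (leb (oI d) <= leb N)%E by apply: le_measure; rewrite ?inE //; exact: mset_itv.
by rewrite N0 lebesgue_measure_itv /= lte_fin d0 -EFinD lee_fin subr0 leNgt d0.
Qed.

Definition weak_dt_ae l T u v := forall phi, test_function T phi ->
  {ae leb, forall x, oI l x -> Int (oI T) (fun t => u (x, t) * derive1 phi t) =
    - Int (oI T) (fun t => v (x, t) * phi t)}.

(** Functions of time alone, to which weak derivatives in one variable apply; over
    all intervals they determine [u] almost everywhere. *)
Definition slice x1 x2 u (t : R) : R := Int `]x1, x2[ (fun x => 1 * u (x, t)).

Lemma itv_sub l x1 x2 : 0 <= x1 -> x2 <= l -> `]x1, x2[%classic `<=` oI l.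
Proof.
move=> h1 h2 x; rewrite /= !in_itv /= => /andP[h3 h4].
by rewrite (le_lt_trans h1 h3) (lt_le_trans h4 h2).
Qed.

Lemma slice_L1 l T x1 x2 u : 0 <= x1 -> x2 <= l -> L1p (oI l) (oI T) u -> L1 (oI T) (slice x1 x2 u).
Proof.
move=> h1 h2 u1; have u2 := L1p_subset (mset_itv _) (mset_itv _) (mset_itv _) (itv_sub h1 h2) u1.
exact: (fubini_L2 _ _ (L1p_mul1 (mset_itv _) cont_one u2)).
Qed.

Lemma slice_weak l T x1 x2 u v : 0 <= x1 -> x2 <= l ->
  L1p (oI l) (oI T) u -> L1p (oI l) (oI T) v -> weak_dt_ae l T u v ->
  is_weak_deriv T (slice x1 x2 u) (slice x1 x2 v).
Proof.
move=> h1 h2 u1 v1 uv phi tphi; have S := itv_sub h1 h2.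
have u2 := L1p_subset (mset_itv _) (mset_itv _) (mset_itv _) S u1.
have v2 := L1p_subset (mset_itv _) (mset_itv _) (mset_itv _) S v1.
have cphi := test_cont tphi; have cdphi := test_cont (test_deriv tphi).
rewrite -/(Int _ _) -/(Int _ _).
transitivity (Int (oI T) (fun x => derive1 phi x * slice x1 x2 u x)).
  by apply: eq_Int => x _; rewrite mulrC.
transitivity (- Int (oI T) (fun x => phi x * slice x1 x2 v x)); last first.
  by congr (- _); apply: eq_Int => x _; rewrite mulrC.
have e1 := swap_mul cont_one cdphi u2.
have e2 := swap_mul cont_one cphi v2.
have L1u : L1 `]x1, x2[ (fun x => 1 * Int (oI T) (fun t => derive1 phi t * u (x, t))).
  by apply: cont_L1_mul; [exact: cont_one|exact: (fubini_L1 _ _ (L1p_mul2 (mset_itv _) cdphi u2))].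
have L1v : L1 `]x1, x2[ (fun x => 1 * Int (oI T) (fun t => phi t * v (x, t))).
  by apply: cont_L1_mul; [exact: cont_one|exact: (fubini_L1 _ _ (L1p_mul2 (mset_itv _) cphi v2))].
rewrite /slice -e1 -e2 -(IntN (mset_itv _) L1v).
apply: ae_Int; [exact: mset_itv|exact: (L1_meas L1u)|exact: (L1_meas (L1_opp (mset_itv _) L1v))|].
have := uv phi tphi; apply: aeS => x h Ix; rewrite !mul1r.
have E := h (S _ Ix).
transitivity (Int (oI T) (fun t => u (x, t) * derive1 phi t)).
  by apply: eq_Int => t _; rewrite mulrC.
by rewrite E; congr (- _); apply: eq_Int => t _; rewrite mulrC.
Qed.

(** The initial condition freed from the choice of a representative. *)
Definition starts_at l T u (a : R -> R) := exists U : R * R -> R,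
  is_time_cont_repr l T u U /\ {ae leb, forall x, oI l x -> U (x, 0) = a x}.

Lemma L2_mfun l f : L2 l f -> mfun (oI l) f.
Proof.
rewrite /L2 => /sub_Lfun_mfun; rewrite inE /= => mf.
by apply/(measurable_restrictT _ (mset_itv _)).
Qed.

Lemma L2_L1 l f : L2 l f -> L1 (oI l) f.
Proof.
move=> f2; have mf := L2_mfun f2; apply/integrableP; split; first exact/measurable_EFinP.
apply: (le_lt_trans (integral_L2norm mf)).
have : (L2norm l f < +oo)%E by move: f2; rewrite /L2 => /sub_Lfun_finLfun; rewrite inE /=.
move=> h; rewrite lte_mul_pinfty ?L2norm1_lty ?L2norm_ge0 // ge0_fin_numE ?L2norm_ge0 //.
Qed.

(** At almost every small time the absolutely continuous representative of the slice
    equals the slice of the representative that is continuous in L^2; both have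
    limits as t tends to 0. *)
Lemma slice_initial l T x1 x2 u v (a : R -> R) C : 0 < T -> 0 <= x1 -> x2 <= l ->
  L1p (oI l) (oI T) u -> L1p (oI l) (oI T) v -> starts_at l T u a -> mfun (oI l) a ->
  {ae leb, forall t, oI T t -> slice x1 x2 u t = C + prim (slice x1 x2 v) t} ->
  C = Int `]x1, x2[ a.
Proof.
move=> T0 h1 h2 u1 v1 [U [[UL Uc Uu] Ua]] ma uC; have S := itv_sub h1 h2.
have V1 := slice_L1 h1 h2 v1; have cP := prim_clamp T0 V1.
have P0 : prim (slice x1 x2 v) (clamp 0 T 0) = 0.
  by rewrite clamp_id ?lexx ?(ltW T0) // /prim /Int set_itv_ge ?Rintegral_set0 // bnd_simp ltxx.
have U0L : L1 (oI l) (fun x => U (x, 0)).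
  by apply: L2_L1; apply: UL; rewrite in_itv /= lexx ltW.
have Ia : Int `]x1, x2[ a = Int `]x1, x2[ (fun x => U (x, 0)).
  apply: ae_Int; [exact: mset_itv|by apply: measurable_funS ma| |].
    by apply: L1_meas; apply: L1_subset U0L.
  by move: Ua; apply: aeS => x h Ix; rewrite h //; exact: S.
apply/eqP; rewrite -subr_eq0 -normr_le0 leNgt; apply/negP => e0; set e := `|_| in e0.
pose c := fine (L2norm1 l); have c0 : 0 <= c by apply: fine_ge0; exact: L2norm_ge0.
have cE : L2norm1 l = c%:E by rewrite fineK // ge0_fin_numE ?L2norm1_lty // L2norm_ge0.
have e1 : 0 < e / (2 * (c + 1)) by rewrite divr_gt0 // mulr_gt0 //; lra.
have T00 : 0 \in `[0, T] by rewrite in_itv /= lexx ltW.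
have [N1 N2] := (fine_cvgP _ _).1 (Uc 0 T00).
have {}N2 : \forall t \near within `[0, T] (nbhs (0 : R)), fine (L2norm l (fun x => U (x, t) - U (x, 0))) < e / (2 * (c + 1)).
  by apply: (cvgr_lt 0 N2).
have e20 : 0 < e / 2 by apply: divr_gt0.
have N3 : \forall t \near nbhs (0 : R), `|prim (slice x1 x2 v) (clamp 0 T t)| < e / 2.
  by have := cP 0; rewrite /continuous_at P0 => /cvgr0_norm_lt; apply.
have N1' : nbhs (0 : R) (fun t => `[0, T]%classic t -> L2norm l (fun x => U (x, t) - U (x, 0)) \is a fin_num) := N1.
have N2' : nbhs (0 : R) (fun t => `[0, T]%classic t -> fine (L2norm l (fun x => U (x, t) - U (x, 0))) < e / (2 * (c + 1))) := N2.
have [d /= d0 H] := (nbhs_ballP _ _).1 (filterI N1' (filterI N2' N3)).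
pose d' := Num.min d T.
have d'0 : 0 < d' by rewrite /d' lt_min d0.
have su := fubini_ae2 (mset_itv _) (mset_itv _) u1.
have [t /andP[t0 td] [h3 [h4 h5]]] :=
  ae_exists d'0 (ae_and uC (ae_and Uu su)).
have [td1 tT] : t < d /\ t < T by move: td; rewrite /d' lt_min => /andP[].
have It : oI T t by rewrite /= in_itv /= t0 tT.
have It' : `[0, T]%classic t by rewrite /= in_itv /= !ltW.
have bt : ball (0 : R) d t by rewrite -ball_normE /= sub0r normrN gtr0_norm.
have [M1 [M2 M3]] := H t bt.
have {}M1 := M1 It'; have {}M2 := M2 It'.
have UtL : L1 (oI l) (fun x => U (x, t)) by apply: L2_L1; apply: UL.
have It2 : slice x1 x2 u t = Int `]x1, x2[ (fun x => U (x, t)).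
  apply: ae_Int; [exact: mset_itv| | |].
  - apply: measurable_funM; first exact: measurable_cst.
    by apply: L1_meas; apply: L1_subset (h5 It).
  - by apply: L1_meas; apply: L1_subset UtL.
  have := h4 It; apply: aeS => x h Ix; rewrite mul1r h //; exact: S.
have D : `|Int `]x1, x2[ (fun x => U (x, t)) - Int `]x1, x2[ (fun x => U (x, 0))| < e / 2.
  have dL := L1_sub (mset_itv _) UtL U0L.
  rewrite -IntB ?(L1_subset _ _ S) //.
  apply: le_lt_trans (Int_norm (mset_itv _) (L1_subset (mset_itv _) (mset_itv _) S dL)) _.
  apply: (@le_lt_trans _ _ (Int (oI l) (fun x => `|U (x, t) - U (x, 0)|))).
    rewrite -lee_fin -!EInt //; try (by apply: L1_norm => //; apply: (L1_subset _ _ S)).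
    apply: ge0_subset_integral => //.
    by apply/measurable_EFinP; apply: L1_meas; exact: L1_norm.
  rewrite -lte_fin -EInt //; last exact: L1_norm.
  apply: (le_lt_trans (integral_L2norm (L1_meas dL))).
  rewrite cE -(fineK M1) -EFinM lte_fin.
  apply: (@le_lt_trans _ _ (fine (L2norm l (fun x => U (x, t) - U (x, 0))) * (c + 1))).
    by rewrite ler_wpM2l ?lerDl // fine_ge0 ?L2norm_ge0.
  rewrite -ltr_pdivlMr; last lra.
  by apply: (lt_le_trans M2); rewrite invfM mulrA.
have := h3 It; rewrite It2 => E.
move: M3; rewrite clamp_id ?(ltW t0) ?(ltW tT) // => M3.
move: D; rewrite -Ia E => D.
have : `|C - Int `]x1, x2[ a| < e.
  rewrite (_ : C - _ = (C + prim (slice x1 x2 v) t - Int `]x1, x2[ a) - prim (slice x1 x2 v) t); last by ring.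
  by apply: (le_lt_trans (ler_normB _ _)); rewrite [e]splitr ltrD.
by rewrite ltxx.
Qed.

End Hat.

(** * The transformed equation *)

Section Transformed.
Context {R : realType}.
Notation leb := (@lebesgue_measure R).
Notation mR := (measurableTypeR R).
Notation mset A := (measurable (A : set mR)).
Notation mfun A f := (measurable_fun (A : set mR) (f : mR -> R)).
Notation oI b := (`]0%R, b[%classic).
Implicit Types (A B : set R) (f g h phi psi p a : R -> R) (b c x l T s alpha : R) (u v w : R * R -> R).
#[local] Hint Resolve mset_itv : core.
#[local] Hint Resolve leb_itv : core.

Lemma J_exp_weight s x : s != 0 -> J (fun t => s * expR (- (s * t))) x = 1 - expR (- (s * x)).
Proof.
move=> s0; rewrite JZ; last exact: cont_expN.
rewrite (@eqJ _ _ (fun t => expR ((- s) * t))); last by move=> t; rewrite mulNr.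
by rewrite J_expR ?oppr_eq0 // mulNr; field.
Qed.

(** Integration by parts in the transform, with the boundary term at [T]. *)
Lemma laplace_prim T s C g : 0 < T -> s != 0 -> L1 (oI T) g ->
  Int (oI T) (fun t => (s * expR (- (s * t))) * (C + prim g t)) =
  C + Int (oI T) (fun t => expR (- (s * t)) * g t) - expR (- (s * T)) * (C + Int (oI T) g).
Proof.
move=> T0 s0 g1.
have cE := @cont_expN R s.
have cf : continuous (fun t : R => s * expR (- (s * t))) by cont.
have l1 : L1 (oI T) (fun t => C * (s * expR (- (s * t)))) by apply: L1_scale => //; exact: cont_L1.
have l2 := prim_L1_mul T0 cf g1.
rewrite (@eq_Int _ _ _ (fun t => C * (s * expR (- (s * t))) + (s * expR (- (s * t))) * prim g t)); last first.
  by move=> t _; ring.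
rewrite IntD // (prim_test T0 cf g1) IntZ //; last exact: cont_L1.
rewrite Int_J ?lexx ?(ltW T0) // J0 subr0 !J_exp_weight //.
have l3 : L1 (oI T) (fun t => expR (- (s * t)) * g t) by exact: cont_L1_mul.
rewrite (@eq_Int _ _ (fun y => g y * _) (fun t => expR (- (s * t)) * g t - expR (- (s * T)) * g t)); last first.
  by move=> t _; rewrite J_exp_weight //; ring.
rewrite IntB //; last exact: L1_scale.
by rewrite IntZ //; ring.
Qed.

Lemma Int_combine A (s e : R) f g h a : mset A -> L1 A f -> L1 A g -> L1 A h -> L1 A a ->
  L1 A (fun x => s * f x - ((a x + g x) - e * (a x + h x))) /\
  Int A (fun x => s * f x - ((a x + g x) - e * (a x + h x))) =
  s * Int A f - ((Int A a + Int A g) - e * (Int A a + Int A h)).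
Proof.
move=> mA f1 g1 h1 a1.
have ag := L1_add mA a1 g1; have ah := L1_add mA a1 h1; have sf := L1_scale s mA f1.
have eah := L1_scale e mA ah; have b := L1_sub mA ag eah.
split; first exact: L1_sub.
by rewrite (IntB mA sf b) (IntB mA ag eah) (IntZ e mA ah) (IntZ s mA f1) (IntD mA a1 g1) (IntD mA a1 h1).
Qed.

(** Proved for slices, where the initial value is available, and then localised in
    [x] by [interval_ae0]. *)
Lemma laplace_dt l T s u v a : 0 < l -> 0 < T -> 0 < s ->
  L1p (oI l) (oI T) u -> L1p (oI l) (oI T) v -> weak_dt_ae l T u v ->
  starts_at l T u a -> continuous a ->
  {ae leb, forall x, oI l x -> s * laplace T s u x =
    a x + laplace T s v x - expR (- (s * T)) * (a x + Int (oI T) (fun t => 1 * v (x, t)))}.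
Proof.
move=> l0 T0 s0 u1 v1 uv ua ca.
have s0' : s != 0 by rewrite gt_eqF.
pose V0 x := Int (oI T) (fun t => 1 * v (x, t)).
have V1 : L1 (oI l) V0 by exact: (fubini_L1 _ _ (L1p_mul2 (mset_itv _) cont_one v1)).
have hu := laplace_L1 s u1; have hv := laplace_L1 s v1.
have a1 : L1 (oI l) a by exact: cont_L1.
pose w x := s * laplace T s u x - ((a x + laplace T s v x) - expR (- (s * T)) * (a x + V0 x)).
have [w1 _] := Int_combine s (expR (- (s * T))) (mset_itv _) hu hv V1 a1.
have : {ae leb, forall x, oI l x -> w x = 0}; last first.
  by apply: aeS => x h xl; apply/eqP; rewrite -subr_eq0; apply/eqP; exact: h.
apply: interval_ae0 => // x1 x2 x10 x12 x2l.
have S : `]x1, x2[%classic `<=` oI l by apply: itv_sub; exact: ltW.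
have sub g : L1 (oI l) g -> L1 `]x1, x2[ g by apply: L1_subset.
have u2 := L1p_subset (mset_itv _) (mset_itv _) (mset_itv _) S u1.
have v2 := L1p_subset (mset_itv _) (mset_itv _) (mset_itv _) S v1.
have hat_slice z : L1p `]x1, x2[ (oI T) z ->
  Int `]x1, x2[ (laplace T s z) = Int (oI T) (fun t => expR (- (s * t)) * slice x1 x2 z t).
  move=> z1; rewrite /slice -(swap_mul cont_one (@cont_expN R s) z1).
  by apply: eq_Int => x _; rewrite mul1r.
have slice0 : Int `]x1, x2[ V0 = Int (oI T) (slice x1 x2 v).
  have := swap_mul cont_one cont_one v2; rewrite -/(slice _ _ _ _) => E.
  transitivity (Int `]x1, x2[ (fun x => 1 * V0 x)); first by apply: eq_Int => x _; rewrite mul1r.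
  by rewrite /V0 E; apply: eq_Int => t _; rewrite mul1r.
have Su := slice_L1 (ltW x10) (ltW x2l) u1; have Sv := slice_L1 (ltW x10) (ltW x2l) v1.
have [C CE] := weak_deriv_prim T0 Su Sv (slice_weak (ltW x10) (ltW x2l) u1 v1 uv).
have Ca := slice_initial T0 (ltW x10) (ltW x2l) u1 v1 ua (cont_mfun (mset_itv _) ca) CE.
have eA : s * Int `]x1, x2[ (laplace T s u) = C + Int `]x1, x2[ (laplace T s v)
    - expR (- (s * T)) * (C + Int `]x1, x2[ V0).
  have lU : L1 (oI T) (fun t => expR (- (s * t)) * slice x1 x2 u t).
    by apply: cont_L1_mul Su; exact: cont_expN.
  rewrite slice0 (hat_slice _ u2) (hat_slice _ v2) -(laplace_prim C T0 s0' Sv) -(IntZ s (mset_itv _) lU).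
  have cf : continuous (fun t : R => s * expR (- (s * t))) by have cE := @cont_expN R s; cont.
  apply: ae_Int; [exact: mset_itv| | |].
  - exact: (L1_meas (L1_scale s (mset_itv _) lU)).
  - apply: measurable_funM; first exact: cont_mfun.
    by apply: measurable_funD => //; apply: L1_meas; exact: prim_L1.
  by move: CE; apply: aeS => t h It; rewrite h // mulrA.
have [_] := Int_combine s (expR (- (s * T))) (mset_itv _) (sub _ hu) (sub _ hv) (sub _ V1) (sub _ a1).
rewrite -/(w _) => ->.
by rewrite eA Ca subrr.
Qed.

(** The constant of the Caputo derivative cancels the one in the mass of the kernel,
    and the error is that of [frac_kernel_laplace]. *)
Lemma laplace_equation l T alpha s u v w p : 0 < alpha -> alpha < 1 -> 0 < s ->
  L1p (oI l) (oI T) u -> L1p (oI l) (oI T) v -> L1p (oI l) (oI T) w ->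
  {ae leb, forall x, oI l x -> {ae leb, forall t, oI T t ->
    (frac_gamma alpha)^-1 * Int (oI T) (fun tau => frac_kernel alpha 0 (t - tau) * v (x, tau)) = w (x, t) - p x * u (x, t)}} ->
  {ae leb, forall x, oI l x ->
    `|laplace T s w x - p x * laplace T s u x - s `^ (alpha - 1) * laplace T s v x| <=
    expR (- (s * T / 2)) * (s / 2) `^ (alpha - 1) * Int (oI T) (fun t => `|v (x, t)|)}.
Proof.
move=> a0 a1 s0 u1 v1 w1.
have U := fubini_ae (mset_itv _) (mset_itv _) u1.
have V := fubini_ae (mset_itv _) (mset_itv _) v1.
have W := fubini_ae (mset_itv _) (mset_itv _) w1.
have cE := @cont_expN R s.
apply: (aeS2 _ (ae_and U (ae_and V W))) => x [hu [hv hw]] h xl.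
have {}hu := hu xl; have {}hv := hv xl; have {}hw := hw xl; have {}h := h xl.
have g0 := frac_gamma_gt0 a0 a1; have g0' : frac_gamma alpha != 0 by rewrite gt_eqF.
have Z := frac_kernel_conv a0 a1 s0 hv.
have B := frac_kernel_laplace a0 a1 s0 hv.
have E : Int (oI T) (fun t => Int (oI T) (fun tau => (expR (- (s * t)) * frac_kernel alpha 0 (t - tau)) * v (x, tau)))
  = frac_gamma alpha * (laplace T s w x - p x * laplace T s u x).
  have l1 : L1 (oI T) (fun t => expR (- (s * t)) * w (x, t)) by exact: cont_L1_mul.
  have l2 : L1 (oI T) (fun t => expR (- (s * t)) * u (x, t)) by exact: cont_L1_mul.
  rewrite /laplace -(IntZ (p x) (mset_itv _) l2) -IntB //; last exact: L1_scale.
  rewrite -IntZ //; last by apply: L1_sub => //; exact: L1_scale.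
  apply: ae_Int => //.
  - by apply: L1_meas; exact: (fubini_L1 _ _ (L1p_frac_kernel a0 a1 s0 hv)).
  - by apply: L1_meas; apply: L1_scale => //; apply: L1_sub => //; exact: L1_scale.
  move: (ae_and Z h); apply: aeS => t [h1 h2] It; rewrite h1 //.
  have := h2 It => /(congr1 ( *%R (frac_gamma alpha))); rewrite mulVKf // => ->.
  ring.
rewrite E in B; rewrite -(ler_pM2l g0).
rewrite -[X in X * `|_|](gtr0_norm g0) -normrM.
rewrite (_ : frac_gamma alpha * (_ - _) = frac_gamma alpha * (laplace T s w x - p x * laplace T s u x) - s `^ (alpha - 1) * frac_gamma alpha * laplace T s v x); last by ring.
by apply: (le_trans B); rewrite le_eqVlt; apply/orP; left; apply/eqP; ring.
Qed.

(** Eliminating the transform of [v] between [laplace_dt] and [laplace_equation]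
    creates the coefficient s^alpha and the source s^(alpha - 1) a. For [2 <= s] the
    powers of [s] in the errors are at most 1. *)
Lemma laplace_ode_error l T alpha s u v w p a : 0 < l -> 0 < T -> 0 < alpha -> alpha < 1 -> 2 <= s ->
  L1p (oI l) (oI T) u -> L1p (oI l) (oI T) v -> L1p (oI l) (oI T) w ->
  weak_dt_ae l T u v -> starts_at l T u a -> continuous a -> continuous p ->
  {ae leb, forall x, oI l x -> {ae leb, forall t, oI T t ->
    (frac_gamma alpha)^-1 * Int (oI T) (fun tau => frac_kernel alpha 0 (t - tau) * v (x, tau)) = w (x, t) - p x * u (x, t)}} ->
  let e x := laplace T s w x - ((s `^ alpha + p x) * laplace T s u x - s `^ (alpha - 1) * a x) in
  L1 (oI l) e /\
  Int (oI l) (fun x => `|e x|) <= expR (- (s * T / 2)) * (2 * mass l T v + Int (oI l) (fun x => `|a x|)).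
Proof.
move=> l0 T0 a0 a1 s2 u1 v1 w1 uv ua ca cp pde e.
have s0 : 0 < s by lra.
have s0' : s != 0 by rewrite gt_eqF.
have hu := laplace_L1 s u1; have hv := laplace_L1 s v1; have hw := laplace_L1 s w1.
have al1 : L1 (oI l) a by exact: cont_L1.
have e1 : L1 (oI l) e.
  apply: (L1_sub (mset_itv _) hw); apply: L1_sub; [exact: mset_itv| |exact: L1_scale].
  by apply: (cont_L1_mul _ hu); cont.
split => //.
have n1 := L1p_norm (mset_itv _) (mset_itv _) v1.
have m1 : L1 (oI l) (fun x => Int (oI T) (fun t => `|v (x, t)|)) by exact: (fubini_L1 _ _ n1).
have na : L1 (oI l) (fun x => `|a x|) by exact: L1_norm.
rewrite /mass -(IntZ 2 (mset_itv _) m1) -(IntD (mset_itv _) (L1_scale 2 (mset_itv _) m1) na).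
rewrite -(IntZ _ (mset_itv _) (L1_add (mset_itv _) (L1_scale 2 (mset_itv _) m1) na)).
apply: Int_le_ae; [exact: mset_itv|exact: L1_norm| |].
  exact: (L1_scale _ (mset_itv _) (L1_add (mset_itv _) (L1_scale 2 (mset_itv _) m1) na)).
have H1 := laplace_dt l0 T0 s0 u1 v1 uv ua ca.
have H2 := laplace_equation a0 a1 s0 u1 v1 w1 pde.
have V := fubini_ae (mset_itv _) (mset_itv _) v1.
apply: (aeS2 _ (ae_and H1 H2) V) => x [h1 h2] hvx xl.
have {}h1 := h1 xl; have {}h2 := h2 xl; have {}hvx := hvx xl.
set m := Int (oI T) (fun t => `|v (x, t)|) in h2 *.
set v0 := Int (oI T) (fun t => 1 * v (x, t)) in h1.
have v0m : `|v0| <= m.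
  rewrite /v0 (@eq_Int _ _ _ (fun t => v (x, t))); last by move=> t _; rewrite mul1r.
  exact: Int_norm.
set P := s `^ (alpha - 1) in h2 *; set P2 := (s / 2) `^ (alpha - 1) in h2.
have Ps : s `^ alpha = P * s.
  rewrite /P -[in X in _ * X](powRr1 (ltW s0)) -powRD ?subrK //.
  by apply/implyP => _.
have le1 (r : R) : 1 <= r -> 0 <= r `^ (alpha - 1) <= 1.
  move=> r1; have r0 : 0 < r by lra.
  have -> : alpha - 1 = - (1 - alpha) by ring.
  rewrite powR_ge0 /= powRN invf_le1 ?powR_gt0 //.
  have b0 : 0 <= 1 - alpha by lra.
  have := ge0_ler_powR b0 (_ : 1 \in Num.nneg) (_ : r \in Num.nneg) r1.
  by rewrite powR1 !nnegrE ler01 (ltW r0) => /(_ isT isT).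
have /andP[P0 P1] : 0 <= P <= 1 by apply: le1; lra.
have /andP[P20 P21] : 0 <= P2 <= 1 by apply: le1; lra.
set E := expR (- (s * T / 2)) in h2 *.
set E2 := expR (- (s * T)) in h1.
have E0 : 0 <= E by exact: expR_ge0.
have E20 : 0 <= E2 by exact: expR_ge0.
have EE : E2 <= E by rewrite ler_expR; have := mulr_gt0 s0 T0; lra.
have m0 : 0 <= m by apply: Int_ge0.
have -> : e x = (laplace T s w x - p x * laplace T s u x - P * laplace T s v x) + P * (E2 * (a x + v0)).
  by rewrite /e Ps -/P; move: h1; set U := laplace T s u x; set W := laplace T s v x => h1; rewrite (_ : E2 * (a x + v0) = a x + W - s * U); [ring|lra].
apply: (le_trans (ler_normD _ _)).
have A1 : `|laplace T s w x - p x * laplace T s u x - P * laplace T s v x| <= E * m.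
  apply: (le_trans h2); rewrite -mulrA; apply: ler_wpM2l => //.
  by apply: ler_piMl.
have A2 : `|P * (E2 * (a x + v0))| <= E * (`|a x| + m).
  rewrite !normrM (ger0_norm P0) (ger0_norm E20).
  apply: (@le_trans _ _ (E2 * `|a x + v0|)); first by apply: ler_piMl => //; rewrite mulr_ge0.
  apply: ler_pM => //; apply: (le_trans (ler_normD _ _)); exact: lerD.
by apply: (le_trans (lerD A1 A2)); rewrite le_eqVlt; apply/orP; left; apply/eqP; ring.
Qed.

(** Multiplication by [s] turns the source [d * a x] into k^2 a; here [d] stands for
    s^(alpha - 1). The profile is built from the continuous primitives of [U2], so
    that its equation holds at every point. *)
Lemma continuous_profile l s k d C0 C1 (U0 U1 U2 e p a : R -> R) :
  0 < l -> 0 < s -> s * d = k ^+ 2 ->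
  L1 (oI l) U0 -> L1 (oI l) U1 -> L1 (oI l) U2 -> L1 (oI l) e ->
  continuous p -> continuous a ->
  {ae leb, forall x, oI l x -> U0 x = C0 + prim U1 x} ->
  {ae leb, forall x, oI l x -> U1 x = C1 + prim U2 x} ->
  (forall x, U2 x = (k ^+ 2 + p x) * U0 x - d * a x + e x) ->
  exists v rho : R -> R,
  [/\ continuous v, continuous rho,
    forall x, 0 <= x <= l -> v x = s * C0 + s * C1 * x +
      J (J (fun y => (k ^+ 2 + p y) * v y - k ^+ 2 * a y)) x + rho x,
    forall x, 0 <= x <= l -> `|rho x| <= l * (s * Int (oI l) (fun y => `|e y|)) &
    forall x, 0 <= x <= l -> `|v x| <= s * (`|C0| + Int (oI l) (fun y => `|U1 y|))].
Proof.
move=> l0 s0 sd U01 U11 U21 e1 cp ca E0 E1 E2.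
have s0' : s != 0 by rewrite gt_eqF.
pose G y := C1 + prim U2 (clamp 0 l y).
have cG : continuous G by have c := prim_clamp l0 U21; rewrite /G; cont.
have cJG := continuous_J _ cG.
pose v x := s * (C0 + J G x).
have cv : continuous v by rewrite /v; cont.
have ce := prim_clamp l0 e1.
have inX x : 0 <= x <= l -> `]0, x[%classic `<=` oI l.
  by move=> /andP[x0 xl]; exact: itv_sub.
have clampX x : oI l x -> clamp 0 l x = x.
  by rewrite /= in_itv /= => /andP[x0 xl]; rewrite clamp_id // !ltW.
have pU1 x : 0 <= x <= l -> prim U1 x = J G x.
  move=> xl; have /andP[x0 _] := xl.
  rewrite /prim -[RHS]subr0 -[X in _ - X](J0 G) -(Int_J cG) ?lexx //.
  apply: ae_Int; [exact: mset_itv|by apply: L1_meas; apply: L1_subset U11 => //; exact: inX|exact: cont_mfun|].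
  move: E1; apply: aeS => t h It; have It' := inX x xl t It.
  by rewrite h // /G clampX.
have vU : {ae leb, forall x, oI l x -> s * U0 x = v x}.
  move: E0; apply: aeS => x h xl; rewrite h // pU1 //.
  by move: xl; rewrite /= in_itv /= => /andP[x0 xl]; rewrite !ltW.
pose h y := (k ^+ 2 + p y) * v y - k ^+ 2 * a y.
have ch : continuous h by rewrite /h; cont.
have pU2 x : 0 <= x <= l -> s * prim U2 x = J h x + s * prim e x.
  move=> xl; have /andP[x0 _] := xl.
  have S := inX x xl.
  have U21' : L1 `]0, x[ U2 by apply: L1_subset U21.
  have e1' : L1 `]0, x[ e by apply: L1_subset e1.
  have h1' : L1 `]0, x[ h by exact: cont_L1.
  rewrite /prim -[J h x]subr0 -[X in _ - X](J0 h) -(Int_J ch) ?lexx //.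
  rewrite -(IntZ s (mset_itv _) U21') -(IntZ s (mset_itv _) e1') -(IntD (mset_itv _) h1' (L1_scale s (mset_itv _) e1')).
  apply: ae_Int; [exact: mset_itv|exact: (L1_meas (L1_scale s (mset_itv _) U21'))| |].
    exact: (L1_meas (L1_add (mset_itv _) h1' (L1_scale s (mset_itv _) e1'))).
  move: vU; apply: aeS => t ht It; have {}ht := ht (S t It).
  by rewrite E2 /h -ht -sd; ring.
pose r y := s * prim e (clamp 0 l y).
have cr : continuous r by rewrite /r; cont.
exists v, (J r); split; [exact: cv|exact: continuous_J| | |].
- move=> x /andP[x0 xl].
  have -> : v x = s * C0 + J (fun y => s * G y) x by rewrite /v JZ // mulrDr.
  have -> : J (fun y => s * G y) x = J (fun y => s * C1 + (J h y + r y)) x.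
    apply: eq_J_ge0 => // y /andP[y0 yx]; have yl : 0 <= y <= l by rewrite y0 (le_trans yx).
    by rewrite /G mulrDr /r clamp_id // pU2.
  have cJh := continuous_J _ ch.
  have cc : continuous (fun y : R => s * C1) by exact: ct_cst.
  have cs : continuous (fun y : R => J h y + r y) by cont.
  rewrite (JD _ _ _ cc cs) (JD _ _ _ cJh cr) J_cst; ring.
- move=> x /andP[x0 xl].
  apply: (le_trans (J_bound r x (s * Int (oI l) (fun y => `|e y|)) cr x0 _)).
    move=> t /andP[t0 tx]; have tl : 0 <= t <= l by rewrite t0 (le_trans tx).
    rewrite /r clamp_id // normrM (gtr0_norm s0); apply: ler_wpM2l; first exact: ltW.
    have e1' : L1 `]0, t[ e by apply: L1_subset e1 => //; exact: inX.
    apply: (le_trans (Int_norm (mset_itv _) e1')).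
    have ne := L1_norm (mset_itv _) e1; have /andP[_ tl'] := tl.
    rewrite (@Int_split R 0 t l) ?t0 //; rewrite lerDl; exact: Int_ge0.
  rewrite mulrC; apply: ler_wpM2r => //; apply: mulr_ge0; [exact: ltW|exact: Int_ge0].
move=> x xl; have /andP[x0 xl'] := xl.
rewrite /v -pU1 // normrM (gtr0_norm s0); apply: ler_wpM2l; first exact: ltW.
apply: (le_trans (ler_normD _ _)); rewrite lerD2l.
have e1' : L1 `]0, x[ U1 by apply: L1_subset U11 => //; exact: inX.
apply: (le_trans (Int_norm (mset_itv _) e1')).
have ne := L1_norm (mset_itv _) U11.
rewrite (@Int_split R 0 x l) ?x0 //; rewrite lerDl; exact: Int_ge0.
Qed.

End Transformed.

(** * Profiles at large frequency and the initial hypotheses *)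

Section Assembly.
Context {R : realType}.
Notation leb := (@lebesgue_measure R).
Notation mR := (measurableTypeR R).
Notation mset A := (measurable (A : set mR)).
Notation mfun A f := (measurable_fun (A : set mR) (f : mR -> R)).
Notation oI b := (`]0%R, b[%classic).
Implicit Types (A B : set R) (f g h phi psi p a : R -> R) (b c x l T s k alpha : R) (u v w : R * R -> R).
#[local] Hint Resolve mset_itv : core.
#[local] Hint Resolve leb_itv : core.

(** The Laplace transform of the trace at 0, see [trace_momentE]. *)
Definition trace_laplace l T s u v : R := l^-1 * Int (oI T) (fun t => expR (- (s * t)) * trace_moment l u v t).

Lemma trace_laplace_bound l T s u v : 0 < l -> 0 <= s -> L1p (oI l) (oI T) u -> L1p (oI l) (oI T) v ->
  `|trace_laplace l T s u v| <= l^-1 * Int (oI T) (fun t => `|trace_moment l u v t|).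
Proof.
move=> l0 s0 u1 v1; have m1 := trace_moment_L1 u1 v1.
have em := cont_L1_mul (@cont_expN R s) m1.
rewrite /trace_laplace normrM gtr0_norm ?invr_gt0 //; apply: ler_wpM2l; first by rewrite invr_ge0 ltW.
apply: (le_trans (Int_norm (mset_itv _) em)).
apply: Int_le; [exact: mset_itv|exact: L1_norm|exact: L1_norm|].
move=> t; rewrite /= in_itv /= => /andP[t0 _]; rewrite normrM ger0_norm ?expR_ge0 //.
by apply: ler_piMl => //; rewrite expR_le1 oppr_le0 mulr_ge0 // ltW.
Qed.

Lemma eq_trace_laplace l T s u v u' v' :
  L1p (oI l) (oI T) u -> L1p (oI l) (oI T) v -> L1p (oI l) (oI T) u' -> L1p (oI l) (oI T) v' ->
  {ae leb, forall t, oI T t -> trace_moment l u v t = trace_moment l u' v' t} ->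
  trace_laplace l T s u v = trace_laplace l T s u' v'.
Proof.
move=> u1 v1 u1' v1' h; rewrite /trace_laplace; apply: f_equal.
apply: ae_Int; [exact: mset_itv| | |].
- exact: (L1_meas (cont_L1_mul (@cont_expN R s) (trace_moment_L1 u1 v1))).
- exact: (L1_meas (cont_L1_mul (@cont_expN R s) (trace_moment_L1 u1' v1'))).
by move: h; apply: aeS => t ht It; rewrite ht.
Qed.

(** [M] and [K] do not depend on [s], which the passage to large [k] requires. The
    data at 0 are transforms of the traces of the solution. *)
Lemma solution_profile l T alpha (p a : R -> R) u ut ux uxx :
  0 < l -> 0 < T -> 0 < alpha -> alpha < 1 ->
  L1p (oI l) (oI T) u -> L1p (oI l) (oI T) ut -> L1p (oI l) (oI T) ux -> L1p (oI l) (oI T) uxx ->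
  weak_dt_ae l T u ut -> weak_dx_ae l T u ux -> weak_dx_ae l T ux uxx ->
  starts_at l T u a -> continuous a -> continuous p ->
  {ae leb, forall x, oI l x -> {ae leb, forall t, oI T t ->
    (frac_gamma alpha)^-1 * Int (oI T) (fun tau => frac_kernel alpha 0 (t - tau) * ut (x, tau)) =
    uxx (x, t) - p x * u (x, t)}} ->
  exists M K : R, [/\ 0 <= M, 0 <= K & forall s k, 2 <= s -> s `^ alpha = k ^+ 2 ->
    exists v rho : R -> R,
    [/\ continuous v, continuous rho,
      forall x, 0 <= x <= l -> v x = s * trace_laplace l T s u ux + s * trace_laplace l T s ux uxx * x +
        J (J (fun y => (k ^+ 2 + p y) * v y - k ^+ 2 * a y)) x + rho x,
      forall x, 0 <= x <= l -> `|rho x| <= l * (s * (expR (- (s * T / 2)) * M)) &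
      forall x, 0 <= x <= l -> `|v x| <= s * K]].
Proof.
move=> l0 T0 a0 a1 u1 ut1 ux1 uxx1 dut dux duxx ua ca cp pde.
pose M := 2 * mass l T ut + Int (oI l) (fun x => `|a x|).
pose K := l^-1 * Int (oI T) (fun t => `|trace_moment l u ux t|) + mass l T ux.
have mass0 z : 0 <= mass l T z by apply: Int_ge0 => x _; apply: Int_ge0.
exists M, K; split.
- by apply: addr_ge0; [apply: mulr_ge0|apply: Int_ge0].
- by apply: addr_ge0 => //; apply: mulr_ge0; [rewrite invr_ge0 ltW|apply: Int_ge0].
move=> s k s2 sk; have s0 : 0 < s by lra.
have hu := laplace_L1 s u1; have hux := laplace_L1 s ux1; have huxx := laplace_L1 s uxx1.
have [C0 [E0 L0]] := laplace_primitive s l0 u1 ux1 dux.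
have [C1 [E1 LL1]] := laplace_primitive s l0 ux1 uxx1 duxx.
have lC C (Z : R) : l * C = Z -> C = l^-1 * Z by move=> <-; rewrite mulKf // gt_eqF.
have {}L0 := lC _ _ L0; have {}LL1 := lC _ _ LL1.
rewrite -/(trace_laplace l T s u ux) in L0; rewrite -/(trace_laplace l T s ux uxx) in LL1.
have [e1 eM] := laplace_ode_error l0 T0 a0 a1 s2 u1 ut1 uxx1 dut ua ca cp pde.
set e := fun x => _ in e1 eM.
have sd : s * s `^ (alpha - 1) = k ^+ 2.
  rewrite -sk -[X in X * _](powRr1 (ltW s0)) -powRD; first by congr (_ `^ _); ring.
  by apply/implyP => _; rewrite gt_eqF.
have E2 x : laplace T s uxx x = (k ^+ 2 + p x) * laplace T s u x - s `^ (alpha - 1) * a x + e x.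
  by rewrite /e sk; ring.
have [v [rho [cv crho Ev Br Bv]]] := continuous_profile l0 s0 sd hu hux huxx e1 cp ca E0 E1 E2.
exists v, rho; split; [exact: cv|exact: crho| | |].
- by rewrite -L0 -LL1.
- move=> x xl; apply: (le_trans (Br x xl)); apply: ler_wpM2l; first exact: ltW.
  by apply: ler_wpM2l; first exact: ltW.
move=> x xl; apply: (le_trans (Bv x xl)); apply: ler_wpM2l; first exact: ltW.
apply: lerD; last by apply: laplace_mass => //; exact: ltW.
by rewrite L0; apply: trace_laplace_bound => //; exact: ltW.
Qed.

(** With s = k^(2 / alpha) >= k^2 the truncation error exp (- s T / 2) falls below
    exp (- 4 l k). The exponent 2 / alpha is real, and [s] is then bounded by an
    integer power of [k]. *)
Lemma large_k l T alpha M : 0 < l -> 0 < T -> 0 < alpha -> alpha < 1 -> 0 <= M ->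
  exists k0 : R, exists N : nat, 0 < k0 /\ forall k, k0 <= k ->
    let s := k `^ (2 / alpha) in
    [/\ 2 <= s, s `^ alpha = k ^+ 2, s <= k ^+ N &
        l * (s * (expR (- (s * T / 2)) * M)) <= expR (- (4 * l * k))].
Proof.
move=> l0 T0 a0 a1 M0.
(* The left side of the last inequality is (s T / 8) c0 exp (- s T / 2); s T / 8 and c0
   are absorbed by their exponentials, and 3 s T / 8 >= 4 l k + c0 for k >= k0. *)
pose c0 := 8 * l * M / T.
have c00 : 0 <= c0 by rewrite /c0; apply: divr_ge0; [apply: mulr_ge0 => //; lra|exact: ltW].
pose k0 := 2 + 8 * (4 * l + c0) / (3 * T).
have q0 : 0 <= 8 * (4 * l + c0) / (3 * T) by apply: divr_ge0; lra.
exists k0, (Num.bound (2 / alpha)); split; first by rewrite /k0; lra.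
move=> k kk; rewrite /k0 in kk.
have k2 : 2 <= k by lra.
have k1 : 1 <= k by lra.
have kp : 0 < k by lra.
have al2 : 2 <= 2 / alpha by rewrite ler_pdivlMr //; lra.
set s := k `^ (2 / alpha).
have sk : k ^+ 2 <= s by rewrite -(powR_mulrn _ (ltW kp)) /s ler_powR.
have s4 : 4 <= s by apply: le_trans sk; nra.
cbv zeta; split; first by lra.
- by rewrite /s -powRrM divfK ?gt_eqF // powR_mulrn // ltW.
- rewrite -(powR_mulrn _ (ltW kp)) /s ler_powR //; apply/ltW.
  by apply: archi_boundP; lra.
have h1 : s * T / 8 <= expR (s * T / 8) by have := expR_ge1Dx (s * T / 8); lra.
have h2 : c0 <= expR c0 by have := expR_ge1Dx c0; lra.
have -> : l * (s * (expR (- (s * T / 2)) * M)) = (s * T / 8) * c0 * expR (- (s * T / 2)).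
  by rewrite /c0; field; rewrite gt_eqF.
apply: (@le_trans _ _ (expR (s * T / 8) * expR c0 * expR (- (s * T / 2)))).
  apply: ler_wpM2r; first exact: expR_ge0.
  by apply: ler_pM => //; apply: divr_ge0 => //; apply: mulr_ge0; lra.
rewrite -!expRD ler_expR.
have h3 : 8 * (4 * l + c0) <= 3 * T * k.
  have : 8 * (4 * l + c0) / (3 * T) <= k by lra.
  by rewrite ler_pdivrMr; [rewrite [k * _]mulrC|lra].
have h4 : 8 * (4 * l + c0) * k <= 3 * T * k * k by apply: ler_wpM2r => //; exact: ltW.
have h5 : T * k ^+ 2 <= T * s by apply: ler_wpM2l => //; exact: ltW.
have h6 : c0 <= c0 * k by apply: ler_peMr.
rewrite expr2 mulrA in h5; lra.
Qed.

Lemma weak_dtP l T u : W11_L2 l T u -> is_weak_dt l T u (weak_dt l T u).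
Proof. by move=> [_ [v uv]]; rewrite /weak_dt; apply: xgetPex; exists v. Qed.

Lemma weak_dxP l T u : (exists v, is_weak_dx l T u v) -> is_weak_dx l T u (weak_dx l T u).
Proof. by move=> [v uv]; rewrite /weak_dx; apply: xgetPex; exists v. Qed.

(** Weak derivatives of the same function have the same integrals against test
    functions, so the second derivative of one of them serves for the chosen one. *)
Lemma weak_dx2P l T u : L2_H2 l T u ->
  is_weak_dx l T u (weak_dx l T u) /\
  is_weak_dx l T (weak_dx l T u) (weak_dx l T (weak_dx l T u)).
Proof.
move=> [uL [v [w [uv vw]]]].
have uP : is_weak_dx l T u (weak_dx l T u) by apply: weak_dxP; exists v.
split; first exact: uP.
apply: weak_dxP; exists w; split; first by have [] := vw.
have [_ h1] := uP; have [_ h2] := uv; have [_ h3] := vw.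
apply: (aeS2 _ (ae_and h1 h2) h3) => t [d1 d2] d3 It phi tphi.
have tdphi := test_deriv tphi.
have := d1 It _ tdphi; rewrite (d2 It _ tdphi) => /oppr_inj <-.
exact: d3.
Qed.

(** Without any continuous representative [initial_value] would be the default value
    0, against the assumption on [a]. *)
Lemma starts_atP l T u (a : R -> R) : 0 < l -> (forall x, 0 <= x <= l -> a x != 0) ->
  {ae leb, forall x, x \in `]0, l[ -> initial_value l T u x = a x} -> starts_at l T u a.
Proof.
move=> l0 a0 ua.
have [[U HU]|none] := pselect (exists U, is_time_cont_repr l T u U).
  exists (xget (fun=> 0) [set U | is_time_cont_repr l T u U]); split.
    by apply: (@xgetPex _ _ [set U | is_time_cont_repr l T u U]); exists U.
  by move: ua; apply: aeS => x h xl; exact: h.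
have [x /andP[x0 xl] h] := ae_exists l0 ua.
have : a x = 0.
  rewrite -h ?in_itv /= ?x0 // /initial_value xgetPN // => U HU.
  by apply: none; exists U.
by move/eqP; rewrite (negbTE (a0 x _)) // !ltW.
Qed.

(** Puts data of class C^1 on [0, l] into the form of primitives of continuous
    functions on the line. *)
Lemma itv_FTC l f g : 0 < l -> {within `[0, l], continuous f} -> {within `[0, l], continuous g} ->
  (forall x, x \in `]0, l[ -> is_derive x (1 : R) f (g x)) ->
  forall x, 0 <= x <= l -> f x = f 0 + J (fun y => g (clamp 0 l y)) x.
Proof.
move=> l0 cf cg fg x /andP[x0 xl].
have cgl := continuous_clamp (ltW l0) cg.
have [x0'|] := ltP 0 x; last first.
  by move=> x0'; rewrite (le_anti (introT andP (conj x0' x0))) J0 addr0.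
rewrite J_itv // /Rintegral.
rewrite (@continuous_FTC2 _ (fun y => g (clamp 0 l y)) f 0 x) //.
- by rewrite -EFinB /= addrC subrK.
- exact: continuous_subspaceT.
- have S : `[0, x]%classic `<=` `[0, l]%classic by apply: subset_itvl; rewrite bnd_simp.
  have /continuous_within_itvP := continuous_subspaceW S cf.
  move=> /(_ x0') [_ c1 c2]; split => // y; rewrite in_itv /= => /andP[y0 yx].
  by have [] := fg y _; rewrite // in_itv /= y0 (lt_le_trans yx xl).
move=> y; rewrite in_itv /= => /andP[y0 yx]; have yl := lt_le_trans yx xl.
have yI : y \in `]0, l[ by rewrite in_itv /= y0 yl.
rewrite derive1E; have [_ ->] := fg y yI.
by rewrite clamp_id // !ltW.
Qed.

(** The kernel vanishes on the negative half-line, which encodes the upper limit [t]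
    of the integral. *)
Lemma caputoE l T alpha u x t : oI T t ->
  caputo l T alpha u (x, t) =
  (frac_gamma alpha)^-1 * Int (oI T) (fun tau => frac_kernel alpha 0 (t - tau) * weak_dt l T u (x, tau)).
Proof.
rewrite /= in_itv /= => /andP[t0 tT].
rewrite /caputo GammaE /=; congr (_ * _); rewrite -/(Int _ _).
rewrite -(@Int_restr R `]0, t[%classic (oI T) (fun tau => tau < t)); last first.
  move=> y /=; rewrite !in_itv /=; split => [/andP[y0 yt]|[/andP[-> _] ->] //].
  by rewrite y0 (lt_trans yt tT) yt.
apply: eq_Int => tau _; rewrite /frac_kernel subr_gt0 mul0r oppr0 expR0 mulr1.
by case: (tau < t); rewrite ?mul1r ?mul0r.
Qed.

End Assembly.

(** * Uniqueness of the potential *)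

Section Main.
Context {R : realType}.
Notation leb := (@lebesgue_measure R).
Notation mR := (measurableTypeR R).
Notation oI b := (`]0%R, b[%classic).

Definition derivatives_L1 (l T : R) (u : R * R -> R) :=
  [/\ L1p (oI l) (oI T) u, L1p (oI l) (oI T) (weak_dt l T u), L1p (oI l) (oI T) (weak_dx l T u)
    & L1p (oI l) (oI T) (weak_dx l T (weak_dx l T u))].

Lemma derivatives_L1P (l T : R) (u : R * R -> R) : W11_L2 l T u -> L2_H2 l T u -> derivatives_L1 l T u.
Proof.
move=> uW uH; have [utL _] := weak_dtP uW; have [[uxL _] [uxxL _]] := weak_dx2P uH.
have [uL _] := uH.
by split; [apply: LrL2_L1p uL|apply: LrL2_L1p utL|apply: LrL2_L1p uxL|apply: LrL2_L1p uxxL]; (left; reflexivity) || (right; reflexivity).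
Qed.

Lemma equation_ae (l T alpha : R) (p pc : R -> R) (u : R * R -> R) :
  (forall x, oI l x -> pc x = p x) -> subdiffusion_eq l T alpha p u ->
  {ae leb, forall x, oI l x -> {ae leb, forall t, oI T t ->
    (frac_gamma alpha)^-1 * Int (oI T) (fun tau => frac_kernel alpha 0 (t - tau) * weak_dt l T u (x, tau)) =
    weak_dx l T (weak_dx l T u) (x, t) - pc x * u (x, t)}}.
Proof.
move=> pE ueq; have := ae_prod ueq; apply: aeS => x h xl; have := h xl.
by apply: aeS => t ht It; rewrite -caputoE // ht //= pE.
Qed.

Lemma solution_of (l T alpha : R) (p pc a ac : R -> R) (u : R * R -> R) :
  0 < l -> 0 < T -> 0 < alpha -> alpha < 1 ->
  (forall x, 0 <= x <= l -> pc x = p x) -> (forall x, 0 <= x <= l -> ac x = a x) ->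
  (forall x, 0 <= x <= l -> ac x != 0) -> continuous pc -> continuous ac ->
  W11_L2 l T u -> L2_H2 l T u ->
  {ae leb, forall x, x \in `]0, l[ -> initial_value l T u x = a x} ->
  subdiffusion_eq l T alpha p u ->
  exists M K : R, [/\ 0 <= M, 0 <= K & forall s k : R, 2 <= s -> s `^ alpha = k ^+ 2 ->
    exists v rho : R -> R,
    [/\ continuous v, continuous rho,
      forall x, 0 <= x <= l -> v x = s * trace_laplace l T s u (weak_dx l T u) +
        s * trace_laplace l T s (weak_dx l T u) (weak_dx l T (weak_dx l T u)) * x +
        J (J (fun y => (k ^+ 2 + pc y) * v y - k ^+ 2 * ac y)) x + rho x,
      forall x, 0 <= x <= l -> `|rho x| <= l * (s * (expR (- (s * T / 2)) * M)) &
      forall x, 0 <= x <= l -> `|v x| <= s * K]].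
Proof.
move=> l0 T0 a0 a1 pE aE an0 cpc cac uW uH ui ueq.
have [u1 ut1 ux1 uxx1] := derivatives_L1P uW uH.
have [_ dut] := weak_dtP uW.
have [[_ dux] [_ duxx]] := weak_dx2P uH.
have cl x : oI l x -> 0 <= x <= l by rewrite /= in_itv /= => /andP[x0 xl]; rewrite !ltW.
apply: (solution_profile l0 T0 a0 a1 u1 ut1 ux1 uxx1 dut dux duxx _ cac cpc).
- apply: starts_atP => //; move: ui; apply: aeS => x h xl; rewrite h // aE //; exact: cl.
by apply: (equation_ae _ ueq) => x /cl; exact: pE.
Qed.

End Main.

Unset Implicit Arguments.

Theorem theorem2 (R : realType) (l T alpha : R) (p q a : R -> R)
    (u u' : R * R -> R)
    (l_gt0 : 0 < l) (T_gt0 : 0 < T) (alpha_gt0 : 0 < alpha) (alpha_lt1 : alpha < 1)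
    (p_C1 : Ck_itv 1 l p) (q_C1 : Ck_itv 1 l q) (a_C2 : Ck_itv 2 l a)
    (a_neq0 : forall x, x \in `[0, l] -> `|a x| != 0)
    (u_W11 : W11_L2 l T u) (u_H2 : L2_H2 l T u)
    (u'_W11 : W11_L2 l T u') (u'_H2 : L2_H2 l T u')
    (u_init : {ae (@lebesgue_measure R), forall x, x \in `]0, l[ ->
      initial_value l T u x = a x})
    (u'_init : {ae (@lebesgue_measure R), forall x, x \in `]0, l[ ->
      initial_value l T u' x = a x})
    (u_eq : subdiffusion_eq l T alpha p u)
    (u'_eq : subdiffusion_eq l T alpha q u')
    (pq_near0 : exists eps0, 0 < eps0 < l /\
      forall x, x \in `[0, eps0] -> p x = q x)
    (dirichlet : {ae (@lebesgue_measure R), forall t, t \in `]0, T[ ->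
      trace0 l (fun x => u (x, t)) = trace0 l (fun x => u' (x, t))})
    (neumann : {ae (@lebesgue_measure R), forall t, t \in `]0, T[ ->
      trace0 l (fun x => weak_dx l T u (x, t)) =
      trace0 l (fun x => weak_dx l T u' (x, t))}) :
  forall x, x \in `[0, l] -> p x = q x.
Proof.
have [cp _] := p_C1; have [cq _] := q_C1.
have [ca [a' [da [ca' [a2 [da' [ca2 _]]]]]]] := a_C2.
have l_ge0 := ltW l_gt0.
(* Continuous extensions of the data to the line; a double primitive for [a]. *)
pose pc x := p (clamp 0 l x); pose qc x := q (clamp 0 l x); pose a2c x := a2 (clamp 0 l x).
have cpc : continuous pc by exact: continuous_clamp.
have cqc : continuous qc by exact: continuous_clamp.
have ca2c : continuous a2c by exact: continuous_clamp.
pose ac x := a 0 + a' 0 * x + J (J a2c) x.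
have cac : continuous ac.
  have c1 := continuous_J _ ca2c; have c2 := continuous_J _ c1; have c0 : continuous (fun x : R => x) by exact: ct_id.
  by rewrite /ac; cont.
have clE f x : 0 <= x <= l -> f (clamp 0 l x) = f x :> R by move=> xl; rewrite clamp_id.
have aE x : 0 <= x <= l -> ac x = a x.
  move=> xl; have /andP[x0 xl'] := xl.
  rewrite (itv_FTC l_gt0 ca ca' da xl) /ac -addrA; congr (_ + _).
  have c1 := continuous_J _ ca2c.
  have cc : continuous (fun _ : R => a' 0) by exact: ct_cst.
  rewrite -(J_cst (a' 0) x) -(JD _ _ _ cc c1); apply: eq_J_ge0 => // t /andP[t0 tx].
  have tl : 0 <= t <= l by rewrite t0 (le_trans tx).
  by rewrite clE // (itv_FTC l_gt0 ca' ca2 da' tl).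
have an0 x : 0 <= x <= l -> ac x != 0.
  by move=> xl; rewrite aE // -normr_eq0; apply: a_neq0; rewrite in_itv.
have pE x : 0 <= x <= l -> pc x = p x by exact: clE.
have qE x : 0 <= x <= l -> qc x = q x by exact: clE.
have [M1 [K1 [M10 K10 H1]]] := solution_of l_gt0 T_gt0 alpha_gt0 alpha_lt1 pE aE an0 cpc cac u_W11 u_H2 u_init u_eq.
have [M2 [K2 [M20 K20 H2]]] := solution_of l_gt0 T_gt0 alpha_gt0 alpha_lt1 qE aE an0 cqc cac u'_W11 u'_H2 u'_init u'_eq.
have [u1 _ ux1 uxx1] := derivatives_L1P u_W11 u_H2.
have [u1' _ ux1' uxx1'] := derivatives_L1P u'_W11 u'_H2.
have [[_ dux] [_ duxx]] := weak_dx2P u_H2.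
have [[_ dux'] [_ duxx']] := weak_dx2P u'_H2.
(* Equal traces give both profiles the same Cauchy data. *)
have Em s : trace_laplace l T s u (weak_dx l T u) = trace_laplace l T s u' (weak_dx l T u').
  apply: eq_trace_laplace => //.
  have m1 := trace_momentE l_gt0 u1 ux1 dux; have m2 := trace_momentE l_gt0 u1' ux1' dux'.
  apply: (aeS2 _ (ae_and m1 m2) dirichlet) => t [h1 h2] h It.
  by rewrite (h1 It) (h2 It) (h It).
have En s : trace_laplace l T s (weak_dx l T u) (weak_dx l T (weak_dx l T u)) =
            trace_laplace l T s (weak_dx l T u') (weak_dx l T (weak_dx l T u')).
  apply: eq_trace_laplace => //.
  have m1 := trace_momentE l_gt0 ux1 uxx1 duxx; have m2 := trace_momentE l_gt0 ux1' uxx1' duxx'.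
  apply: (aeS2 _ (ae_and m1 m2) neumann) => t [h1 h2] h It.
  by rewrite (h1 It) (h2 It) (h It).
have M0 : 0 <= M1 + M2 by exact: addr_ge0.
have [k0 [N [k00 Hk]]] := large_k l_gt0 T_gt0 alpha_gt0 alpha_lt1 M0.
have pairs k : k0 <= k -> ode_pair pc qc ac l k (K1 + K2) N.
  move=> kk; have [s2 sk sN sE] := Hk k kk; set s := k `^ (2 / alpha) in s2 sk sN sE.
  have [v [rho [cv cr Ev Br Bv]]] := H1 s k s2 sk.
  have [w [sig [cw cs Ew Bs Bw]]] := H2 s k s2 sk.
  have s0 : 0 <= s by lra.
  have sb M : 0 <= M -> M <= M1 + M2 -> l * (s * (expR (- (s * T / 2)) * M)) <= expR (- (4 * l * k)).
    move=> M00 MM; apply: le_trans sE; apply: ler_wpM2l => //; apply: ler_wpM2l => //.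
    by apply: ler_wpM2l => //; exact: expR_ge0.
  have sK K : 0 <= K -> K <= K1 + K2 -> s * K <= (K1 + K2) * k ^+ N.
    by move=> K00 KK; rewrite mulrC; apply: ler_pM.
  exists v, w, rho, sig, (s * trace_laplace l T s u (weak_dx l T u)),
    (s * trace_laplace l T s (weak_dx l T u) (weak_dx l T (weak_dx l T u))); split.
  - by split.
  - exact: Ev.
  - by rewrite Em En; exact: Ew.
  - move=> x xl; split.
      by apply: (le_trans (Br x xl)); apply: sb => //; rewrite lerDl.
    by apply: (le_trans (Bs x xl)); apply: sb => //; rewrite lerDr.
  - move=> x xl; split.
      by apply: (le_trans (Bv x xl)); apply: sK => //; rewrite lerDl.
    by apply: (le_trans (Bw x xl)); apply: sK => //; rewrite lerDr.
have [eps0 [eps_itv pq]] := pq_near0.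
have pq' x : 0 <= x <= eps0 -> pc x = qc x.
  move=> /andP[x0 xe]; have /andP[_ el] := eps_itv.
  have xl : 0 <= x <= l by rewrite x0 (le_trans xe) // ltW.
  by rewrite pE // qE // pq // in_itv /= x0.
move=> x; rewrite in_itv /= => xl.
rewrite -pE // -qE //.
exact: (@reduced_unique R pc qc ac a2c (a 0) (a' 0) l k0 (K1 + K2) eps0 N cpc cqc ca2c (fun=> erefl) eps_itv pq' an0 pairs x xl).
Qed.
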